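(* The minimization problem $$\min_{(u,w)\in K}\; f(u)+\frac{\alpha}{2}\|u\|_U^2+\frac{\beta}{2}\|w\|_W^2+\gamma\int_\Omega |w|^p\,dx$$ admits a solution, i.e. there is $(\bar u,\bar w)\in K$ at which the minimum over $K$ is attained.
   Context: Setting. $\Omega\subset\mathbb{R}^d$ is a bounded Lipschitz domain, $I=(0,T)$ with $T>0$, and $U:=L^2(I\times\Omega)$. All functions are real valued. The space $W$ is one of the Hilbert spaces $H^s(\Omega)$, $H^s_0(\Omega)$, $\tilde H^s(\Omega)$, $\mathbb{H}^s(\Omega)$ for some $s\in(0,1)$, where: (1) $H^s(\Omega)$ is the set of $w\in L^2(\Omega)$ with $\int_\Omega\int_\Omega \frac{|w(x)-w(y)|^2}{|x-y|^{d+2s}}\,dy\,dx<\infty$, with inner product $(u,w)_{H^s(\Omega)}=\int_\Omega uw\,dx+\frac{c_{d,s}}{2}\int_\Omega\int_\Omega\frac{(u(x)-u(y))(w(x)-w(y))}{|x-y|^{d+2s}}\,dy\,dx$, $c_{d,s}=\frac{s2^{2s}\Gamma(s+d/2)}{\pi^{d/2}\Gamma(1-s)}$; (2) $H^s_0(\Omega)$ is the closure of $C_c^\infty(\Omega)$ in $H^s(\Omega)$, with the $H^s(\Omega)$-inner product; (3) $\tilde H^s(\Omega)=\{w\in H^s(\mathbb{R}^d): w=0 \text{ on } \mathbb{R}^d\setminus\Omega\}$, with the $H^s(\mathbb{R}^d)$-inner product (same formula as in (1) with $\mathbb{R}^d$ in place of $\Omega$); (4) $\mathbb{H}^s(\Omega)=\{w=\sum_n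 w_n\phi_n\in L^2(\Omega): \|w\|^2_{\mathbb{H}^s}=\sum_n\lambda_n^s w_n^2<\infty\}$, where $w_n=\int_\Omega w\phi_n\,dx$ and $(\phi_n,\lambda_n)$ are the ($L^2$-orthonormal) eigenfunctions and eigenvalues of the Laplacian with zero Dirichlet boundary conditions, with inner product $\sum_n\lambda_n^s u_nw_n$. The admissible set is $K:=\{(u,w)\in U\times W: |u(t,x)|\le w(x) \text{ for a.a. } (t,x)\in I\times\Omega\}$. Standing assumptions. $f:U\to\mathbb{R}$ is weakly lower semicontinuous, bounded from below by an affine function (there are $g\in U^*$, $c\in\mathbb{R}$ with $f(u)\ge g(u)+c$ for all $u\in U$), and continuously Fréchet differentiable. $\alpha,\beta,\gamma>0$ and $p\in(0,1)$. *)

(* Defs.v *)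
From HB Require Import structures.
From mathcomp Require Import all_boot all_order all_algebra.
From mathcomp Require Import all_classical all_reals all_analysis.
From mathcomp Require Import measurable_realfun.

Set Implicit Arguments.
Unset Strict Implicit.
Unset Printing Implicit Defensive.

Import Order.TTheory GRing.Theory Num.Theory.
Import numFieldNormedType.Exports.

Local Open Scope classical_set_scope.
Local Open Scope ring_scope.

(* R^d is 'rV[R]_d, with the library's topology; its sigma-algebra is generated
   by the coordinates (hence is the Borel one, see open_measurable_rV). *)
Definition rV_display : measure_display -> measure_display.
Proof. exact. Qed.

Section measurable_rV.
Context (R : realType) (d : nat).

Definition rV_coord (i : 'I_d) (x : 'rV[R]_d) : R := x ord0 i.

Let rV_set0 : g_sigma_preimage rV_coord set0.
Proof. exact: sigma_algebra0. Qed.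

Let rV_setC A : g_sigma_preimage rV_coord A -> g_sigma_preimage rV_coord (~` A).
Proof. exact: sigma_algebraC. Qed.

Let rV_bigcup (F : (set 'rV[R]_d)^nat) :
  (forall i, g_sigma_preimage rV_coord (F i)) ->
  g_sigma_preimage rV_coord (\bigcup_i (F i)).
Proof. exact: sigma_algebra_bigcup. Qed.

HB.instance Definition _ := @isMeasurable.Build (rV_display default_measure_display)
  'rV[R]_d (g_sigma_preimage rV_coord) rV_set0 rV_setC rV_bigcup.

Lemma measurable_rV_coord (i : 'I_d) : measurable_fun setT (rV_coord i).
Proof.
move=> _ Y mY; rewrite setTI; apply: sub_sigma_algebra => /=.
rewrite -bigcup_seq/=; exists i => /=; first by rewrite mem_index_enum.
by exists Y => //; rewrite setTI.
Qed.

Lemma measurable_fun_rVP d1 (T1 : measurableType d1) (f : T1 -> 'rV[R]_d) :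
  (forall i, measurable_fun setT (rV_coord i \o f)) -> measurable_fun setT f.
Proof.
move=> mf; apply: (@measurability _ _ _ _ _ _
  (\big[setU/set0]_(i < d) preimage_set_system setT (rV_coord i) measurable)) => //.
move=> _ [A + <-].
rewrite -bigcup_seq => -[i _ [B mB <-]].
rewrite !setTI -comp_preimage -[X in measurable X]setTI.
exact: mf.
Qed.

End measurable_rV.

Section open_measurable_rV.
Context (R : realType) (d : nat).

Let cube (q : 'rV[rat]_d) (k : nat) : set 'rV[R]_d :=
  [set x | forall i, `|x ord0 i - ratr (q ord0 i)| < k.+1%:R^-1].

Let measurable_cube q k : measurable (cube q k).
Proof.
have -> : cube q k = \bigcap_(i in [set: 'I_d])
    (rV_coord i @^-1` [set y | `|y - ratr (q ord0 i)| < k.+1%:R^-1]).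
  by apply/seteqP; split=> x /= xP i; [move=> _; exact: xP|exact: (xP i)].
apply: fin_bigcap_measurable => // i _.
rewrite -[X in measurable X]setTI; apply: measurable_rV_coord => //.
apply: open_measurable.
have -> : [set y : R | `|y - ratr (q ord0 i)| < k.+1%:R^-1] =
    ball (ratr (q ord0 i) : R) (k.+1%:R^-1).
  by apply/seteqP; split=> y; rewrite /= -ball_normE /ball_/= distrC.
exact: ball_open.
Qed.

Lemma open_measurable_rV (A : set 'rV[R]_d) : open A -> measurable A.
Proof.
move=> oA.
have -> : A = \bigcup_k \bigcup_(q in [set q | cube q k `<=` A]) cube q k.
  apply/seteqP; split; last by move=> x [k _ [q qA]] /qA.
  move=> x Ax; have : nbhs x A by exact: open_nbhs_nbhs.
  move=> /nbhs_ballP[e /= e0 xeA].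
  have [k ke] : exists k : nat, k.+1%:R^-1 < e / 2.
    have : (0 : R) < e / 2 by rewrite divr_gt0.
    move=> e20; have [k _ /(_ k (leqnn _)) ke] :=
      near_infty_natSinv_lt (PosNum e20).
    by exists k.
  have qP i : exists q : rat, `|x ord0 i - ratr q| < k.+1%:R^-1.
    have : x ord0 i - k.+1%:R^-1 < x ord0 i + k.+1%:R^-1.
      by rewrite ltrD2l (lt_trans (y := 0))// ?oppr_lt0 ?invr_gt0.
    move=> /rat_in_itvoo[q]; rewrite in_itv/= => /andP[q1 q2].
    by exists q; rewrite ltr_distlC -[_ - _ < _]/(_ < _); apply/andP; split.
  have [q qE] := choice qP.
  exists k => //; exists (\row_i q i); last by move=> i; rewrite mxE.
  move=> y /= yq; apply: xeA; split => // i j.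
  rewrite ord1 -ball_normE /ball_/= (splitr e).
  rewrite (le_lt_trans (ler_distD (ratr (q j)) _ _))// ltrD//.
    by rewrite (lt_trans (qE j)).
  by move: (yq j); rewrite mxE distrC => /lt_trans; apply.
apply: bigcupT_measurable => k.
rewrite bigcup_mkcond; apply: countable_bigcupT_measurable => [|q].
  exact: countableP.
by case: ifPn.
Qed.

End open_measurable_rV.

Section lebesgue_rV_succ.
Context (R : realType) (d : nat).
Variable mu : {sigma_finite_measure set 'rV[R]_d -> \bar R}.

Definition consrV (p : R * 'rV[R]_d) : 'rV[R]_d.+1 :=
  row_mx (const_mx p.1 : 'rV[R]_1) p.2.

Lemma consrVE0 a v : consrV (a, v) ord0 ord0 = a.
Proof.
rewrite /consrV /= (_ : ord0 = lshift d ord0 :> 'I_(1 + d)); last exact/val_inj.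
by apply: etrans (row_mxEl _ _ ord0 _) _; rewrite mxE.
Qed.

Lemma consrVES a v (i : 'I_d) : consrV (a, v) ord0 (lift ord0 i) = v ord0 i.
Proof.
rewrite /consrV /= (_ : lift ord0 i = rshift 1 i :> 'I_(1 + d)).
  exact: (row_mxEr _ _ ord0 i).
exact/val_inj.
Qed.

Lemma measurable_consrV : measurable_fun setT consrV.
Proof.
apply: measurable_fun_rVP => i.
have [j ->|j ->] := split_ordP (i : 'I_(1 + d)).
  rewrite (_ : _ \o _ = fst); first exact: measurable_fst.
  apply/funext => p /=; rewrite /rV_coord /consrV.
  by apply: etrans (row_mxEl _ _ ord0 j) _; rewrite mxE.
rewrite (_ : _ \o _ = rV_coord j \o snd).
  by apply: measurableT_comp; [exact: measurable_rV_coord|exact: measurable_snd].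
by apply/funext => p /=; exact: (row_mxEr _ _ ord0 j).
Qed.

Definition lebesgue_rV_succ : set 'rV[R]_d.+1 -> \bar R :=
  pushforward (@lebesgue_measure R \x mu)%E consrV.

Let m : {measure set 'rV[R]_d.+1 -> \bar R} :=
  measure_function_pushforward__canonical__measure_function_Measure
    (lebesgue_measure \x mu)%E measurable_consrV.

HB.instance Definition _ := isMeasure.Build _ _ _ lebesgue_rV_succ
  (measure0 m) (@measure_ge0 _ _ _ m) (@measure_semi_sigma_additive _ _ _ m).

Let uncons (x : 'rV[R]_d.+1) : R * 'rV[R]_d :=
  (x ord0 ord0, rsubmx (x : 'rV[R]_(1 + d))).

Let consrVK : cancel consrV uncons.
Proof.
move=> [a v]; rewrite /uncons /consrV; congr (_, _) => /=.
  exact: consrVE0.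
exact: row_mxKr.
Qed.

Let measurable_uncons : measurable_fun setT uncons.
Proof.
apply/measurable_fun_pairP; split.
  exact: (@measurable_rV_coord R d.+1 ord0).
apply: measurable_fun_rVP => i.
rewrite (_ : _ \o _ = rV_coord (rshift 1 i : 'I_d.+1)).
  exact: measurable_rV_coord.
by apply/funext => x /=; rewrite /rV_coord mxE.
Qed.

Let lebesgue_rV_succ_sigma_finite : sigma_finite setT lebesgue_rV_succ.
Proof.
have /sigma_finiteP[F [TF ndF Foo]] := sigma_finiteT (@lebesgue_measure R).
have /sigma_finiteP[G [TG ndG Goo]] := sigma_finiteT mu.
exists (fun n => uncons @^-1` (F n `*` G n)).
  rewrite -preimage_bigcup (_ : \bigcup_n (F n `*` G n) = setT) ?preimage_setT//.
  apply/seteqP; split => // -[x y] _.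
  have [n _ Fnx] : (\bigcup_n F n) x by rewrite -TF.
  have [k _ Gky] : (\bigcup_n G n) y by rewrite -TG.
  exists (maxn n k) => //; split.
  - by move: Fnx; exact/subsetPset/ndF/leq_maxl.
  - by move: Gky; exact/subsetPset/ndG/leq_maxr.
move=> n; have [mF Fn] := Foo n; have [mG Gn] := Goo n; split.
  by rewrite -[X in measurable X]setTI; apply: measurable_uncons => //;
    exact: measurableX.
rewrite /lebesgue_rV_succ /pushforward -comp_preimage.
rewrite (_ : uncons \o consrV = id); last by apply/funext => p; exact: consrVK.
by rewrite preimage_id product_measure1E// lte_mul_pinfty// ge0_fin_numE.
Qed.

HB.instance Definition _ := Measure_isSigmaFinite.Build _ _ _ lebesgue_rV_succ
  lebesgue_rV_succ_sigma_finite.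

End lebesgue_rV_succ.

(* Lebesgue measure on (the Borel sets of) R^d: the d-fold product of the
   one-dimensional one. *)
Fixpoint lebesgue_rV (R : realType) (d : nat) :
    {sigma_finite_measure set 'rV[R]_d -> \bar R} :=
  match d with
  | 0 => \d_(0 : 'rV[R]_0)
  | d'.+1 => lebesgue_rV_succ (lebesgue_rV R d')
  end.

Lemma lebesgue_rV_box (R : realType) (d : nat) (B : 'I_d -> set R) :
  (forall i, measurable (B i)) ->
  lebesgue_rV R d [set x | forall i, B i (x ord0 i)] =
  (\prod_(i < d) lebesgue_measure (B i))%E.
Proof.
elim: d B => [|d IH] B mB.
  by rewrite big_ord0 /= diracE mem_set// => -[].
have mB' : measurable [set x : 'rV[R]_d | forall i, B (lift ord0 i) (x ord0 i)].
  rewrite (_ : [set _ | _] =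
    \bigcap_(i in [set: 'I_d]) (rV_coord i @^-1` B (lift ord0 i))).
    apply: fin_bigcap_measurable => // i _.
    by rewrite -[X in measurable X]setTI; exact: measurable_rV_coord.
  by apply/seteqP; split=> x /= xP i; [move=> _; exact: xP|exact: (xP i)].
rewrite big_ord_recl -IH//= -product_measure1E//.
rewrite /lebesgue_rV_succ /pushforward.
congr (product_measure1 _ _ _); apply/seteqP; split=> -[a v] /=.
- move=> avB; split => [|i].
    by move: (avB ord0); rewrite (consrVE0 a v).
  by move: (avB (lift ord0 i)); rewrite consrVES.
- move=> [aB vB] i; have [->|[j ->]] : i = ord0 \/ exists j, i = lift ord0 j.
    by case: (unliftP ord0 i) => [j ->|->]; [right; exists j|left].
  + by rewrite (consrVE0 a v).
  + by rewrite consrVES.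
exact: mB.
Qed.

Definition enorm (R : realType) (d : nat) (x : 'rV[R]_d) : R :=
  Num.sqrt (\sum_i x ord0 i ^+ 2).

(* Near each boundary point, after an orthogonal change of coordinates Q, the
   set is the part lying strictly above the graph of a Lipschitz function g of
   the coordinates other than the k-th one. *)
Definition lipschitz_boundary (R : realType) (d : nat) (D : set 'rV[R]_d) :=
  forall x0, (closure D `\` D°) x0 ->
  exists (r L : R) (Q : 'M[R]_d) (k : 'I_d) (g : 'rV[R]_d.-1 -> R),
    [/\ 0 < r, Q *m Q^T = 1%:M,
        (forall a b, `|g a - g b| <= L * enorm (a - b)) &
        forall x, enorm (x - x0) < r ->
          (D x <-> g (col' k (x *m Q)) < (x *m Q) ord0 k)].

Record lipschitz_domain (R : realType) (d : nat) := LipschitzDomain {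
  domain_set :> set 'rV[R]_d;
  domain_open : open domain_set;
  domain_nonempty : domain_set !=set0;
  domain_connected : connected domain_set;
  domain_bounded : bounded_set domain_set;
  domain_lipschitz : lipschitz_boundary domain_set }.

Section function_spaces.
Context (R : realType) (d : nat).
Implicit Types (u v w : 'rV[R]_d -> R) (mu : {measure set 'rV[R]_d -> \bar R}).

Definition partial (i : 'I_d) v : 'rV[R]_d -> R := 'D_(delta_mx ord0 i) v.

Definition smooth v :=
  forall (l : seq 'I_d) x, differentiable (foldr partial v l) x.

Definition test_function (D : set 'rV[R]_d) : set ('rV[R]_d -> R) :=
  [set v | smooth v /\
    exists K, [/\ compact K, K `<=` D & forall x, ~ K x -> v x = 0]].

Definition L2 mu : set ('rV[R]_d -> R) := [set w | w \in Lfun mu 2%:E].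

Definition L2_ip mu u w : R := \int[mu]_x (u x * w x).

Definition gamma_fun (x : R) : R :=
  \int[lebesgue_measure]_(t in `]0, +oo[) (t `^ (x - 1) * expR (- t)).

Definition frac_const (s : R) : R :=
  s * 2 `^ (2 * s) * gamma_fun (s + d%:R / 2) / (pi `^ (d%:R / 2) * gamma_fun (1 - s)).

Definition gagliardo mu (s : R) u w : \bar R :=
  \int[mu]_x \int[mu]_y
    ((u x - u y) * (w x - w y) / enorm (x - y) `^ (d%:R + 2 * s))%:E.

(* With mu the restriction of the Lebesgue measure to D, this is H^s(D). *)
Definition Hs mu (s : R) : set ('rV[R]_d -> R) :=
  [set w | L2 mu w /\ (gagliardo mu s w w < +oo)%E].

Definition Hs_ip mu (s : R) u w : R :=
  L2_ip mu u w + frac_const s / 2 * fine (gagliardo mu s u w).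

End function_spaces.

Section domain_spaces.
Context (R : realType) (d : nat) (Omega : lipschitz_domain R d).
Implicit Types (u v w : 'rV[R]_d -> R).

Lemma measurable_domain : measurable (Omega : set 'rV[R]_d).
Proof. by apply: open_measurable_rV; exact: domain_open. Qed.

Definition vol : {measure set 'rV[R]_d -> \bar R} :=
  mrestr (lebesgue_rV R d) measurable_domain.

Definition Hs0 (s : R) : set ('rV[R]_d -> R) :=
  [set w | Hs vol s w /\
    forall e, 0 < e -> exists2 v, test_function Omega v &
      Hs_ip vol s (w \- v) (w \- v) < e].

Definition tildeHs (s : R) : set ('rV[R]_d -> R) :=
  [set w | Hs (lebesgue_rV R d) s w /\
    {ae lebesgue_rV R d, forall x, ~ (Omega : set _) x -> w x = 0}].

(* v is in H^1(Omega), with weak gradient G. *)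
Definition H1 v (G : 'I_d -> 'rV[R]_d -> R) :=
  [/\ L2 vol v, forall i, L2 vol (G i) &
      forall i z, test_function Omega z ->
        L2_ip vol v (partial i z) = - L2_ip vol (G i) z].

(* v is in H^1_0(Omega), the H^1-closure of the test functions, with weak
   gradient G. *)
Definition H10 v (G : 'I_d -> 'rV[R]_d -> R) :=
  H1 v G /\ forall e, 0 < e -> exists2 z, test_function Omega z &
    L2_ip vol (v \- z) (v \- z) +
    \sum_i L2_ip vol (G i \- partial i z) (G i \- partial i z) < e.

(* - Laplacian v = l v with zero Dirichlet boundary conditions, weakly. *)
Definition dirichlet_eigen v (l : R) :=
  exists2 G, H10 v G & forall z Z, H10 z Z ->
    \sum_i L2_ip vol (G i) (Z i) = l * L2_ip vol v z.

(* An L^2-orthonormal family of eigenfunctions, counted with multiplicity; the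
   last field says that no eigenfunction is left out. *)
Record dirichlet_eigensystem := DirichletEigensystem {
  eigenfun : nat -> 'rV[R]_d -> R;
  eigenval : nat -> R;
  eigenP : forall n, dirichlet_eigen (eigenfun n) (eigenval n);
  eigen_orthonormal : forall m n,
    L2_ip vol (eigenfun m) (eigenfun n) = (m == n)%:R;
  eigen_exhaustive : forall v l, dirichlet_eigen v l ->
    (forall n, L2_ip vol v (eigenfun n) = 0) -> {ae vol, forall x, v x = 0} }.

Definition eigen_coef (e : dirichlet_eigensystem) w (n : nat) : R :=
  L2_ip vol w (eigenfun e n).

Definition spectralHs (e : dirichlet_eigensystem) (s : R) :
    set ('rV[R]_d -> R) :=
  [set w | [/\ L2 vol w,
    (fun N => let r x := w x - \sum_(n < N) eigen_coef e w n * eigenfun e n x in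
       L2_ip vol r r) @ \oo --> (0 : R) &
    cvgn (series (fun n => eigenval e n `^ s * eigen_coef e w n ^+ 2))]].

Definition spectralHs_ip (e : dirichlet_eigensystem) (s : R) u w : R :=
  limn (series (fun n => eigenval e n `^ s * eigen_coef e u n * eigen_coef e w n)).

Inductive frac_space :=
| FracHs | FracHs0 | FracTildeHs | FracSpectral of dirichlet_eigensystem.

(* Elements of all four spaces are functions on R^d; those of H^s(Omega),
   H^s_0(Omega) and the spectral space matter only through their restriction to
   Omega, since vol is concentrated there. *)
Definition frac_set (W : frac_space) (s : R) : set ('rV[R]_d -> R) :=
  match W with
  | FracHs => Hs vol s
  | FracHs0 => Hs0 s
  | FracTildeHs => tildeHs s
  | FracSpectral e => spectralHs e s
  end.

Definition frac_ip (W : frac_space) (s : R) : _ -> _ -> R :=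
  match W with
  | FracHs | FracHs0 => Hs_ip vol s
  | FracTildeHs => Hs_ip (lebesgue_rV R d) s
  | FracSpectral e => spectralHs_ip e s
  end.

Definition frac_norm (W : frac_space) (s : R) w : R := Num.sqrt (frac_ip W s w w).

End domain_spaces.

Section functionals.
Context (R : realType) (V : lmodType R) (nrm : V -> R).
Implicit Type f : V -> R.

Definition bounded_functional (L : {scalar V}) :=
  exists C, forall v, `|L v| <= C * nrm v.

Definition weak_cvg (v_ : nat -> V) (v : V) :=
  forall L, bounded_functional L -> (fun k => L (v_ k)) @ \oo --> (L v : R).

Definition weakly_lsc f := forall v_ v, weak_cvg v_ v ->
  ((f v)%:E <= limn_einf (fun k => (f (v_ k))%:E))%E.

Definition affinely_minorized f :=
  exists2 g : {scalar V}, bounded_functional g &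
  exists c : R, forall v, g v + c <= f v.

Definition frechet_C1 f :=
  exists df : V -> {scalar V},
    [/\ forall v, bounded_functional (df v),
        forall v e, 0 < e -> exists2 r, 0 < r & forall h, nrm h < r ->
          `|f (v + h) - f v - df v h| <= e * nrm h &
        forall v e, 0 < e -> exists2 r, 0 < r & forall v', nrm (v' - v) < r ->
          forall h, `|df v' h - df v h| <= e * nrm h].

End functionals.

Section problem.
Context (R : realType) (d : nat) (Omega : lipschitz_domain R d) (T : R).

Lemma measurable_cylinder :
  measurable (`]0, T[%classic `*` (Omega : set 'rV[R]_d)).
Proof.
by apply: measurableX; [exact: measurable_itv|exact: measurable_domain].
Qed.

Definition cyl_vol : {measure set (measurableTypeR R * 'rV[R]_d) -> \bar R} :=
  mrestr (lebesgue_measure \x lebesgue_rV R d)%E measurable_cylinder.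

(* Representatives of the elements of L^2(I x Omega): LfunType does not
   identify functions that agree almost everywhere. *)
Definition U := LfunType cyl_vol (lee1n 2).

Definition U_norm (u : U) : R := fine ('N[cyl_vol]_2%:E[EFin \o u])%E.

Definition ae_invariant (f : U -> R) :=
  forall u v : U, {ae cyl_vol, forall z, u z = v z} -> f u = f v.

Definition admissible (W : frac_space Omega) (s : R) :
    set (U * ('rV[R]_d -> R)) :=
  [set uw : U * ('rV[R]_d -> R) | frac_set W s uw.2 /\
    {ae cyl_vol, forall z, `|uw.1 z| <= uw.2 z.2}].

Definition objective (W : frac_space Omega) (s : R) (f : U -> R)
    (alpha beta gamma p : R) (uw : U * ('rV[R]_d -> R)) : R :=
  f uw.1 + alpha / 2 * U_norm uw.1 ^+ 2 + beta / 2 * frac_norm W s uw.2 ^+ 2 +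
  gamma * \int[vol Omega]_x (`|uw.2 x| `^ p).

End problem.

(* Main.v *)
(* The direct method. Along a minimizing sequence (u_k, w_k) the affine minorant
   of f and the quadratic terms bound u_k in L^2 and w_k in W. A bound in W makes
   the local oscillation, the integral of |w(x) - w(y)|^2 over |x - y| < e, decay
   faster than e^d uniformly in k, so that averaging over small cubes yields a
   subsequence converging almost everywhere; for the spectral space the decay
   comes from splitting the eigenfunction expansion at frequency 1/e. Fatou's
   lemma then handles the W-norm and the concave power term. The functions u_k
   converge weakly after extraction, and convex (midpoint) combinations of the
   tails converge strongly by the parallelogram law; since the constraint
   |u_k| <= w_k passes to such combinations, it holds in the limit. *)
Require Import Defs.
From HB Require Import structures.
From mathcomp Require Import all_boot all_order all_algebra.
From mathcomp Require Import all_classical all_reals all_analysis.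
From mathcomp Require Import measurable_realfun zify ring lra.

Set Implicit Arguments.
Unset Strict Implicit.
Unset Printing Implicit Defensive.

Import Order.TTheory GRing.Theory Num.Theory.
Import numFieldNormedType.Exports.
Local Open Scope classical_set_scope.
Local Open Scope ring_scope.

(** * Subsequences, midpoint hulls and weak compactness *)

(** The term with [|w|^p] is not convex, so weak convergence in [W] could not pass to the limit in
    it; this is why almost everywhere convergence has to be produced. The gain over [e^d] matters
    because averages are divided by the volume [(2e)^d] of a cube; the averages themselves converge
    because they are inner products with indicators of cubes, against which a weakly convergent
    sequence of L^2 can be tested. Fatou alone does not keep the limit inside [H^s_0] or the
    spectral space, which are defined through approximation: there too midpoint hulls of the tails
    are used, which keep the almost everywhere limit and can be made Cauchy in norm. Finally,
    real-valued integrals read an infinite value as zero, so finiteness must be proved wherever one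
    occurs: for the Gamma function in the constant of the norm, for the energy of test functions and
    for the power term. *)

Lemma cvgn_epsP (R : realType) (u : nat -> R) (l : R) :
  u @ \oo --> l <->
  forall e : R, 0 < e -> exists N, forall n, (N <= n)%N -> `|u n - l| <= e.
Proof.
split=> [/cvgrPdist_le ul e e0|ul].
  have [N _ NP] := ul e e0; exists N => n Nn.
  by rewrite distrC; exact: NP.
apply/cvgrPdist_le => e e0; have [N NP] := ul e e0.
by exists N => // n /= Nn; rewrite distrC; exact: NP.
Qed.

Definition tail (V : Type) (u : nat -> V) (n : nat) : set V :=
  [set u k | k in [set k | (n <= k)%N]].

Definition incr (phi : nat -> nat) := {homo phi : m n / (m < n)%N}.

Lemma incr_ge phi n : incr phi -> (n <= phi n)%N.
Proof.
by move=> h; elim: n => // n IH; rewrite (leq_ltn_trans IH)//; exact: h.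
Qed.

Lemma incr_comp phi psi : incr phi -> incr psi -> incr (phi \o psi).
Proof. by move=> h1 h2 m n mn /=; apply/h1/h2. Qed.

Lemma incr_cvg (R : realType) (u : nat -> R) (l : R) phi : incr phi ->
  u @ \oo --> l -> u (phi k) @[k --> \oo] --> l.
Proof.
move=> hphi /cvgn_epsP ul; apply/cvgn_epsP => e /ul[N NP]; exists N => n Nn.
exact/NP/(leq_trans Nn)/incr_ge.
Qed.

Lemma incr_exists (P : nat -> set nat) :
  (forall n N, exists2 k, (N <= k)%N & P n k) ->
  exists2 phi, incr phi & forall n, P n (phi n).
Proof.
move=> PE; have /choice[F FP] : forall nN : nat * nat,
    exists k, (nN.2 <= k)%N /\ P nN.1 k.
  by move=> [n N] /=; have [k] := PE n N; exists k.
pose phi := fix phi n :=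
  if n is m.+1 then F (n, (phi m).+1) else F (0%N, 0%N).
exists phi; last by case=> [|n] /=; exact: (FP (_, _)).2.
apply: homo_ltn => [m n p|n]; first exact: ltn_trans.
exact: (FP (n.+1, (phi n).+1)).1.
Qed.

(* An ultrafilter finer than [\oo] gives the limits of all the sequences at
   once, which spares the diagonal extraction. *)
Lemma bounded_subseq (R : realType) (a : nat -> nat -> R) (M : nat -> R) :
  (forall j k, `|a j k| <= M j) ->
  exists2 phi, incr phi &
    forall j, exists l : R, a j (phi k) @[k --> \oo] --> l.
Proof.
move=> aM.
have [G [uG oG]] := ultraFilterLemma (@eventually_filter).
have limP j : exists l : R, a j @ G --> l.
  have pG : ProperFilter (a j @ G) by apply: fmap_proper_filter.
  have [|l [_ cl]] := @segment_compact R (- M j) (M j) (a j @ G) pG.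
    by apply: (@filterS _ G _ setT) filterT => k _ /=; rewrite in_itv/= -ler_norml.
  exists l; apply/cvgrPdist_le => e e0.
  (* A cluster point of an ultrafilter is its limit: either the wanted set or its complement belongs
     to [G], and the complement misses a ball around [l]. *)
  have [//|Gn] := in_ultra_setVsetC [set k | `|l - a j k| <= e] uG.
  have [x []] := cl [set x | ~ `|l - x| <= e] _ Gn (nbhsx_ballx l e e0).
  by rewrite -ball_normE /ball_/= => + /ltW.
have [l lP] := choice limP.
have [phi hphi phiP] : exists2 phi, incr phi &
    forall n, forall j, (j <= n)%N -> `|a j (phi n) - l j| <= n.+1%:R^-1.
  apply: (@incr_exists (fun n => [set k | forall j, (j <= n)%N ->
    `|a j k - l j| <= n.+1%:R^-1])) => n N.
  (* Filters are stable under finite intersections, so finitely many sequences are close to their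
     limits at a common index. *)
  have Gn m : G [set k | forall j, (j <= m)%N -> `|a j k - l j| <= n.+1%:R^-1].
    elim: m => [|m IH].
      have /cvgrPdist_le/(_ n.+1%:R^-1) := lP 0%N.
      rewrite invr_gt0 ltr0Sn => /(_ isT); apply: filterS => k kP j.
      by rewrite leqn0 => /eqP ->; rewrite distrC.
    have /cvgrPdist_le/(_ n.+1%:R^-1) := lP m.+1.
    rewrite invr_gt0 ltr0Sn => /(_ isT); apply: filterS2 IH => k km kP j.
    rewrite leq_eqVlt => /predU1P[->|]; first by rewrite distrC.
    exact: km.
  have GN : G [set k | (N <= k)%N] by apply: oG; exists N.
  by have [k [kn Nk]] := filter_ex (filterI (Gn n) GN); exists k.
exists phi => // j; exists (l j); apply/cvgn_epsP => e e0.
have [N _ NP] := near_infty_natSinv_lt (PosNum e0).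
exists (maxn N j) => n; rewrite geq_max => /andP[Nn jn].
by rewrite (le_trans (phiP n j jn))// ltW//; exact: NP.
Qed.

(** Midpoints suffice in place of all convex combinations, because the parallelogram law involves
    nothing else. With [mid] abstract, the same hull serves classes of type [LfunType] and plain
    functions. *)
Inductive mid_hull (V : Type) (mid : V -> V -> V) (A : set V) : set V :=
| mid_base x of A x : mid_hull mid A x
| mid_step x y of mid_hull mid A x & mid_hull mid A y :
    mid_hull mid A (mid x y).

Lemma mid_hull_sub (V : Type) (mid : V -> V -> V) (A B : set V) :
  A `<=` B -> (forall x y, B x -> B y -> B (mid x y)) -> mid_hull mid A `<=` B.
Proof. by move=> AB Bm x; elim => [y /AB|y z _ By _ Bz] //; exact: Bm. Qed.

Lemma mid_hullS (V : Type) (mid : V -> V -> V) (A B : set V) :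
  A `<=` B -> mid_hull mid A `<=` mid_hull mid B.
Proof.
move=> AB; apply: mid_hull_sub; last exact: mid_step.
by move=> x /AB; exact: mid_base.
Qed.

(* By the parallelogram law, almost minimizers of [q] over the hulls of the
   tails form a Cauchy sequence. *)
Lemma mazur_cauchy (R : realType) (V : Type) (mid : V -> V -> V) (D : set V)
    (q : V -> R) (dd : V -> V -> R) (u : nat -> V) (C : R) :
  (forall x y, D x -> D y -> D (mid x y)) ->
  (forall x, D x -> 0 <= q x) ->
  (forall x y, D x -> D y -> 0 <= dd x y) ->
  (forall x y, D x -> D y -> dd x y = 2 * q x + 2 * q y - 4 * q (mid x y)) ->
  (forall k, D (u k)) -> (forall k, q (u k) <= C) ->
  exists z, (forall n, mid_hull mid (tail u n) (z n)) /\
    forall e : R, 0 < e -> exists N, forall m n, (N <= m)%N -> (N <= n)%N ->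
      dd (z m) (z n) <= e.
Proof.
move=> Dm q0 dd0 ddE Du uC.
pose A n := mid_hull mid (tail u n).
have AD n : A n `<=` D.
  by apply: mid_hull_sub => // x [k _ <-].
have Amono m n : (m <= n)%N -> A n `<=` A m.
  by move=> mn; apply: mid_hullS => x [k /= nk <-]; exists k => //=; lia.
have Au n : A n (u n) by apply: mid_base; exists n => /=.
pose Q n := q @` A n.
have Qinf n : has_inf (Q n).
  split; first by exists (q (u n)), (u n).
  by exists 0 => _ [x /AD Dx <-]; exact: q0.
pose dn n := inf (Q n).
have dn_le n x : A n x -> dn n <= q x.
  by move=> Ax; apply: ge_inf; [exact: (Qinf n).2|exists x].
have dn_mono : {homo dn : n m / (n <= m)%N >-> n <= m}.
  move=> m n mn; apply: lb_le_inf; first exact: (Qinf n).1.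
  by move=> _ [x Ax <-]; apply: dn_le; exact: Amono Ax.
have dnC n : dn n <= C by rewrite (le_trans _ (uC n))//; exact/dn_le/Au.
have dnub : has_ubound (range dn) by exists C => _ [k _ <-].
have /cvgn_epsP dl := nondecreasing_cvgn dn_mono dnub.
set l := sup _ in dl.
have dnl n : dn n <= l.
  by apply: ub_le_sup => //; exists n.
have /choice[z zP] : forall n, exists x, A n x /\ q x < dn n + n.+1%:R^-1.
  move=> n; have n0 : (0 : R) < n.+1%:R^-1 by rewrite invr_gt0.
  by have [_ [x Ax <-] xP] := inf_adherent n0 (Qinf n); exists x.
exists z; split => [n|e e0]; first exact: (zP n).1.
(* The midpoint stays in the hull of the tail from [N1], so the distance is at most [2 (l + e/8) + 2
   (l + e/8) - 4 (l - e/8) = e]. *)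
have e8 : 0 < e / 8 by rewrite divr_gt0.
have [N1 N1P] := dl _ e8.
have [N2 _ N2P] := near_infty_natSinv_lt (PosNum e8).
exists (maxn N1 N2) => m n; rewrite !geq_max => /andP[m1 m2] /andP[n1 n2].
have [Am qm] := zP m; have [An qn] := zP n.
rewrite ddE; [|exact: AD Am|exact: AD An].
have h : dn N1 <= q (mid (z m) (z n)).
  by apply: dn_le; apply: mid_step; [exact: Amono Am|exact: Amono An].
have := N1P _ (leqnn N1); rewrite ler_norml => /andP[h1 _].
have h2 : m.+1%:R^-1 < e / 8 := N2P _ m2.
have h3 : n.+1%:R^-1 < e / 8 := N2P _ n2.
have h4 := dnl m; have h5 := dnl n.
move: qm qn h2 h3; move: (m.+1%:R^-1) (n.+1%:R^-1) => a b qm qn h2 h3.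
lra.
Qed.

Section weak_compactness.
Context (R : realType) (V : lmodType R) (B : V -> V -> R).
Hypothesis BC : forall x y, B x y = B y x.
Hypothesis BDl : forall x y z, B (x + y) z = B x z + B y z.
Hypothesis BZl : forall a x y, B (a *: x) y = a * B x y.
Hypothesis B_ge0 : forall x, 0 <= B x x.
Hypothesis B_complete : forall z : nat -> V,
  (forall e : R, 0 < e -> exists N, forall m n, (N <= m)%N -> (N <= n)%N ->
     B (z m - z n) (z m - z n) <= e) ->
  exists l, forall e : R, 0 < e -> exists N, forall n, (N <= n)%N ->
     B (z n - l) (z n - l) <= e.

Definition vmid (x y : V) : V := 2^-1 *: (x + y).

Let BDr x y z : B z (x + y) = B z x + B z y.
Proof. by rewrite BC BDl !(BC z). Qed.
Let BZr a x y : B y (a *: x) = a * B y x.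
Proof. by rewrite BC BZl BC. Qed.
Let BNl x y : B (- x) y = - B x y.
Proof. by rewrite -scaleN1r BZl mulN1r. Qed.
Let BNr x y : B y (- x) = - B y x.
Proof. by rewrite BC BNl BC. Qed.

(** Positivity of the form at [t x + y] and [t x - y]. The weight [t] does the work of the
    Cauchy-Schwarz inequality without square roots. *)
Lemma form_le x y t : 0 < t -> `|B x y| <= t * B x x + B y y / t.
Proof.
move=> t0.
have h1 := B_ge0 (t *: x + y); have h2 := B_ge0 (t *: x - y).
rewrite !(BDl, BDr, BZl, BZr, BNl, BNr) (BC y x) in h1 h2.
have hx := B_ge0 x; have hy := B_ge0 y.
rewrite -(ler_pM2l t0) mulrDr (mulrC t (_ / t)) divfK ?gt_eqF//.
have tb : t * `|B x y| = `|t * B x y| by rewrite normrM gtr0_norm.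
rewrite tb ler_norml; have : 0 <= t * (t * B x x) by rewrite !mulr_ge0// ltW.
by move=> ?; apply/andP; split; lra.
Qed.

Lemma form_vmid x y :
  B (x - y) (x - y) = 2 * B x x + 2 * B y y - 4 * B (vmid x y) (vmid x y).
Proof. by rewrite !(BDl, BDr, BZl, BZr, BNl, BNr) (BC y x); field. Qed.

Lemma mazur_limit (u : nat -> V) C : (forall k, B (u k) (u k) <= C) ->
  exists z l, (forall n, mid_hull vmid (tail u n) (z n)) /\
    forall e : R, 0 < e -> exists N, forall n, (N <= n)%N ->
      B (z n - l) (z n - l) <= e.
Proof.
move=> uC.
have [z [zu zc]] := @mazur_cauchy R V vmid setT (fun x => B x x)
  (fun x y => B (x - y) (x - y)) u C (fun _ _ _ _ => I) (fun x _ => B_ge0 x)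
  (fun x y _ _ => B_ge0 _) (fun x y _ _ => form_vmid x y) (fun=> I) uC.
by have [l lP] := B_complete zc; exists z, l.
Qed.

Lemma form_lim (z : nat -> V) l y :
  (forall e : R, 0 < e -> exists N, forall n, (N <= n)%N ->
      B (z n - l) (z n - l) <= e) ->
  B (z n) y @[n --> \oo] --> B l y.
Proof.
move=> zl; apply/cvgn_epsP => e e0.
(* Makes [B y y / t] at most [e / 2]; the summand 1 keeps [t] positive when [B y y] vanishes. *)
pose t := 2 * (B y y + 1) / e.
have y1 : 0 < B y y + 1 by rewrite ltr_wpDl.
have t0 : 0 < t by rewrite /t !(mulr_gt0, invr_gt0).
have [N NP] := zl (e / 2 / t) (divr_gt0 (divr_gt0 e0 (ltr0Sn _ _)) t0).
exists N => n /NP h.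
rewrite -BNl -BDl (le_trans (form_le _ _ t0))//.
have h1 : t * B (z n - l) (z n - l) <= e / 2 by rewrite mulrC -ler_pdivlMr.
have h2 : B y y / t <= e / 2.
  rewrite ler_pdivrMr// (_ : e / 2 * t = B y y + 1) ?lerDl//.
  by rewrite /t; field; rewrite gt_eqF.
lra.
Qed.

Lemma functional_lim (L : {scalar V}) (z : nat -> V) l (K : R) :
  (forall v, `|L v| <= K * Num.sqrt (B v v)) ->
  (forall e : R, 0 < e -> exists N, forall n, (N <= n)%N ->
      B (z n - l) (z n - l) <= e) ->
  L (z n) @[n --> \oo] --> (L l : R).
Proof.
move=> LK zl; apply/cvgn_epsP => e e0.
pose K' := `|K| + 1.
have K0 : 0 < K' by rewrite /K' ltr_wpDl.
have [N NP] := zl ((e / K') ^+ 2) (exprn_gt0 2 (divr_gt0 e0 K0)).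
exists N => n /NP h; rewrite -linearB (le_trans (LK _))//.
have : Num.sqrt (B (z n - l) (z n - l)) <= e / K'.
  by rewrite -(ger0_norm (ltW (divr_gt0 e0 K0))) -sqrtr_sqr ler_wsqrtr.
rewrite ler_pdivlMr// => h2; apply: le_trans h2.
rewrite mulrC ler_wpM2l ?sqrtr_ge0//.
by rewrite /K' (le_trans (ler_norm K))// lerDl.
Qed.

(* No representation theorem is needed: if [L u] stayed away from [L l] along a
   subsequence, its own hull limit would still have the same inner products with
   all the [u j], hence be equal to [l], but separated from it by [L]. *)
Lemma weak_subseq (u : nat -> V) C : (forall k, B (u k) (u k) <= C) ->
  exists2 phi, incr phi & exists l,
    weak_cvg (fun v => Num.sqrt (B v v)) (fun k => u (phi k)) l /\
    exists z, (forall n, mid_hull vmid (tail (fun k => u (phi k)) n) (z n)) /\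
      forall e : R, 0 < e -> exists N, forall n, (N <= n)%N ->
        B (z n - l) (z n - l) <= e.
Proof.
move=> uC.
have [phi hphi phiP] : exists2 phi, incr phi & forall j, exists l : R,
    B (u (phi k)) (u j) @[k --> \oo] --> l.
  apply: (@bounded_subseq _ (fun j k => B (u k) (u j)) (fun=> C + C)) => j k.
  by rewrite (le_trans (form_le _ _ ltr01))// mul1r divr1 lerD.
have [ell ellP] := choice phiP.
exists phi => //.
(* Any sequence drawn from ever later terms [u (phi n)] has a hull limit with the same products
   [ell]: the products converge along [phi], and midpoints stay in an interval around the limit. *)
have key (v : nat -> V) : (forall k, B (v k) (v k) <= C) ->
    (forall k, exists2 n, (k <= n)%N & v k = u (phi n)) ->
    exists z l, [/\ forall n, mid_hull vmid (tail v n) (z n),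
      forall e : R, 0 < e -> exists N, forall n, (N <= n)%N ->
        B (z n - l) (z n - l) <= e &
      forall j, B l (u j) = ell j].
  move=> vC vu; have [z [l [zv zl]]] := mazur_limit vC.
  exists z, l; split => // j.
  have h1 := form_lim (y := u j) zl.
  apply: (cvg_unique _ h1) => //.
  apply/cvgn_epsP => e e0; have /cvgn_epsP/(_ e e0)[N NP] := ellP j.
  exists N => n Nn.
  suff : mid_hull vmid (tail v n) `<=` [set x | `|B x (u j) - ell j| <= e].
    exact.
  apply: mid_hull_sub => [_ [k /= nk <-]|x y /=].
    by have [m km ->] := vu k; apply: NP; lia.
  rewrite BZl BDl !ler_norml => /andP[? ?] /andP[? ?].
  by apply/andP; split; lra.
have [z [l [zu zl lell]]] := key (fun k => u (phi k)) (fun k => uC _)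
  (fun k => ex_intro2 _ _ k (leqnn k) erefl).
exists l; split; last by exists z.
(* Only an upper bound is shown; applied to [L] and to its opposite it gives the convergence. *)
have side (L : {scalar V}) (K e : R) : 0 < e ->
    (forall v, `|L v| <= K * Num.sqrt (B v v)) ->
    exists N, forall k, (N <= k)%N -> L (u (phi k)) <= L l + e.
  move=> e0 LK; apply: contrapT => /forallNP h.
  have /choice[psi psiP] : forall N, exists k, (N <= k)%N /\ L l + e < L (u (phi k)).
    move=> N; have /existsNP[k /not_implyP[Nk /negP]] := h N.
    by rewrite -ltNge => ?; exists k.
  have [z' [l' [zu' zl' lell']]] := key (fun k => u (phi (psi k)))
    (fun k => uC _) (fun k => ex_intro2 _ _ (psi k) (psiP k).1 erefl).
  pose w := l - l'.
  have wu j : B w (u j) = 0 by rewrite BDl BNl lell lell' subrr.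
  have wz (v : nat -> V) x n : (forall k, exists j, v k = u j) ->
      mid_hull vmid (tail v n) x -> B x w = 0.
    move=> vu; move: x; apply: mid_hull_sub => [_ [k _ <-]|x y] /=.
      by have [j ->] := vu k; rewrite BC wu.
    by rewrite BZl BDl => -> ->; rewrite addr0 mulr0.
  have wl : B l w = 0.
    have := form_lim (y := w) zl; rewrite (_ : (fun n => _) = cst 0); last first.
      by apply/funext => n; apply: wz (zu n) => k; exists (phi k).
    by move=> /(cvg_unique _ (cvg_cst 0)) <-.
  have wl' : B l' w = 0.
    have := form_lim (y := w) zl'; rewrite (_ : (fun n => _) = cst 0); last first.
      by apply/funext => n; apply: wz (zu' n) => k; exists (phi (psi k)).
    by move=> /(cvg_unique _ (cvg_cst 0)) <-.
  (* The form may be degenerate, so [w = 0] does not follow; the boundedness of [L] still yields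
     [L w = 0]. *)
  have ww : B w w = 0 by rewrite {1}/w BDl BNl wl wl' subrr.
  have : L w = 0.
    by apply/eqP; rewrite -normr_eq0 eq_le normr_ge0 (le_trans (LK _))// ww sqrtr0 mulr0.
  rewrite linearB => /eqP; rewrite subr_eq0 => /eqP Ll.
  have /cvgn_epsP/(_ (e / 2) (divr_gt0 e0 (ltr0Sn _ _)))[N NP] := functional_lim LK zl'.
  have := NP _ (leqnn N); rewrite -Ll ler_norml => /andP[_].
  (* The half-space where [L] is at least [L l + e] contains the tail, hence its hull, while [L] of
     the hull sequence tends to [L l' = L l]. *)
  suff : mid_hull vmid (tail (fun k => u (phi (psi k))) N) `<=`
      [set x | L l + e <= L x] by move=> /(_ _ (zu' N)) /=; lra.
  apply: mid_hull_sub => [_ [k _ <-]|x y] /=; first exact/ltW/(psiP k).2.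
  by rewrite linearZ linearD /=; lra.
move=> L [K LK]; apply/cvgn_epsP => e e0.
have [N1 N1P] := side L K e e0 LK.
have [N2 N2P] := side (\- L)%R K e e0 (fun v => ltac:(rewrite /= normrN; exact: LK)).
exists (maxn N1 N2) => n; rewrite geq_max => /andP[/N1P h1 /N2P /= h2].
by rewrite ler_norml; apply/andP; split; lra.
Qed.

End weak_compactness.

(** * Convergence in measure and in L^2 *)

Section fatou_ae.
Context d (T : measurableType d) (R : realType).
Variable mu : {measure set T -> \bar R}.
Local Open Scope ereal_scope.

Lemma limn_einf_le (u : (\bar R)^nat) C : (forall k, u k <= C) -> limn_einf u <= C.
Proof.
move=> uC; rewrite limn_einf_lim; apply: lime_le; first exact: is_cvg_einfs.
apply: nearW => n; apply: le_trans (uC n).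
by apply: ereal_inf_lbound; exists n => /=.
Qed.

Lemma limn_einf_EFin (u : R^nat) (l : R) : (u @ \oo --> l)%R ->
  limn_einf (fun k => (u k)%:E) = l%:E.
Proof.
move=> ul; have /cvg_limn_einf_sup[]// : (fun k => (u k)%:E) @ \oo --> l%:E.
by apply: cvg_EFin => //; apply: nearW.
Qed.

(** Asks only for domination by the lower limit, so that it can be iterated for double integrals:
    there the inner application gives an inequality and not a limit. *)
Lemma fatou_ae (F_ : nat -> T -> \bar R) (F : T -> \bar R) :
  (forall k, measurable_fun setT (F_ k)) -> (forall k x, 0 <= F_ k x) ->
  measurable_fun setT F -> (forall x, 0 <= F x) ->
  {ae mu, forall x, F x <= limn_einf (fun k => F_ k x)} ->
  \int[mu]_x F x <= limn_einf (fun k => \int[mu]_x F_ k x).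
Proof.
move=> mF_ F_0 mF F0 FF.
apply: le_trans; last by apply: fatou => // k x _; exact: F_0.
have einf0 x : 0 <= limn_einf (F_ ^~ x).
  rewrite limn_einf_lim; apply: lime_ge; first exact: is_cvg_einfs.
  by apply: nearW => n; apply: le_ereal_inf_tmp => _ [m _ <-].
apply: ae_ge0_le_integral => //.
  rewrite (_ : (fun x => _) = \- (fun x => limn_esup (fun k => - F_ k x)))//.
  apply: measurableT_comp => //; apply: measurable_fun_limn_esup => // k.
  exact: measurableT_comp.
by apply: filterS FF => x h _.
Qed.

Lemma fatou_le (f_ : nat -> T -> R) (f : T -> R) C :
  (forall k, measurable_fun setT (f_ k)) -> (forall k x, (0 <= f_ k x)%R) ->
  measurable_fun setT f -> (forall x, (0 <= f x)%R) ->
  {ae mu, forall x, (f_ k x @[k --> \oo] --> f x)%R} ->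
  (forall k, \int[mu]_x (f_ k x)%:E <= C) -> \int[mu]_x (f x)%:E <= C.
Proof.
move=> mf_ f_0 mf f0 ff fC.
apply: le_trans (limn_einf_le fC).
apply: (@fatou_ae (fun k x => (f_ k x)%:E) (fun x => (f x)%:E)).
- by move=> k; exact/measurable_EFinP.
- by move=> k x; rewrite lee_fin.
- exact/measurable_EFinP.
- by move=> x; rewrite lee_fin.
- by apply: filterS ff => x /limn_einf_EFin ->.
Qed.

End fatou_ae.

Lemma geometric_eseries_lty (R : realType) (c z : R) : 0 <= c -> 0 <= z < 1 ->
  (\sum_(0 <= k <oo) (c * z ^+ k)%:E < +oo)%E.
Proof.
move=> c0 /andP[z0 z1].
have h : `|z| < 1 by rewrite ger0_norm.
have h2 : EFin \o series (geometric c z) @ \oo --> (c * (1 - z)^-1)%:E.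
  by apply: cvg_EFin; [exact: nearW|exact: cvg_geometric_series].
rewrite (_ : (\sum_(0 <= k <oo) _)%E = (c * (1 - z)^-1)%:E) ?ltry//.
apply/cvg_lim => //; move: h2; apply: cvg_trans; apply: near_eq_cvg.
by apply: nearW => n /=; rewrite /series /= sumEFin.
Qed.

Lemma cauchy_real_cvg (R : realType) (u : nat -> R) :
  (forall e : R, 0 < e -> exists N, forall n, (N <= n)%N -> `|u n - u N| <= e) ->
  cvgn u.
Proof.
move=> uc; apply/cauchy_cvgP; apply: cauchy_exP => e e0.
have [N NP] := uc (e / 2) (divr_gt0 e0 (ltr0Sn _ _)).
exists (u N), N => // n /= Nn; rewrite -ball_normE /ball_/= distrC.
by rewrite (le_lt_trans (NP _ Nn))// ltr_pdivrMr// ltr_pMr// ltr1n.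
Qed.

Lemma measurable_mem d (T : measurableType d) (A : set T) : measurable A ->
  measurable_fun setT (fun x => x \in A).
Proof.
move=> mA; apply: (measurable_fun_bool true).
rewrite setTI (_ : _ @^-1` _ = A)//.
by apply/seteqP; split => x /= => [/set_mem|/mem_set].
Qed.

Section real_integrals.
Context d (T : measurableType d) (R : realType).
Variable mu : {measure set T -> \bar R}.

Lemma ge0_le_int (f g : T -> R) : (forall x, 0 <= f x <= g x) ->
  measurable_fun setT f -> measurable_fun setT g ->
  (\int[mu]_x (f x)%:E <= \int[mu]_x (g x)%:E)%E.
Proof.
move=> fg mf mg; apply: ge0_le_integral => //.
- by move=> x _; rewrite lee_fin; have /andP[] := fg x.
- exact/measurable_EFinP.
- exact/measurable_EFinP.
- by move=> x _; rewrite lee_fin; have /andP[] := fg x.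
Qed.

Lemma ge0_intD (f g : T -> R) : (forall x, 0 <= f x) -> (forall x, 0 <= g x) ->
  measurable_fun setT f -> measurable_fun setT g ->
  (\int[mu]_x (f x + g x)%:E = \int[mu]_x (f x)%:E + \int[mu]_x (g x)%:E)%E.
Proof.
move=> f0 g0 mf mg; under eq_integral do rewrite EFinD.
apply: ge0_integralD => // [x _||x _|]; rewrite ?lee_fin//.
- exact/measurable_EFinP.
- exact/measurable_EFinP.
Qed.

Lemma ge0_intZ (f : T -> R) k : 0 <= k -> (forall x, 0 <= f x) ->
  measurable_fun setT f ->
  (\int[mu]_x (k * f x)%:E = k%:E * \int[mu]_x (f x)%:E)%E.
Proof.
move=> k0 f0 mf; under eq_integral do rewrite EFinM.
apply: ge0_integralZl_EFin => // [x _|]; first by rewrite lee_fin.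
exact/measurable_EFinP.
Qed.

Lemma ae_eq_int (f g : T -> R) : (forall x, 0 <= f x) -> (forall x, 0 <= g x) ->
  measurable_fun setT f -> measurable_fun setT g ->
  {ae mu, forall x, f x = g x} ->
  (\int[mu]_x (f x)%:E = \int[mu]_x (g x)%:E)%E.
Proof.
move=> f0 g0 mf mg fg; apply: ge0_ae_eq_integral => // [||x _|x _|]; rewrite ?lee_fin//.
- exact/measurable_EFinP.
- exact/measurable_EFinP.
- by apply: filterS fg => x -> .
Qed.

(** The integral of [min(1, |f - g|)] metrizes convergence in measure. Along a subsequence the
    successive distances are at most [2^-n], so their sum is integrable, hence finite almost
    everywhere, and where it is finite the differences telescope. *)
Lemma ae_subseq (f : nat -> T -> R) :
  (forall k, measurable_fun setT (f k)) ->
  (forall e : R, 0 < e -> exists N, forall m n, (N <= m)%N -> (N <= n)%N ->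
    (\int[mu]_x (Num.min 1 `|f m x - f n x|)%:E <= e%:E)%E) ->
  exists2 phi, incr phi & exists2 g, measurable_fun setT g &
    {ae mu, forall x, f (phi k) x @[k --> \oo] --> (g x : R)}.
Proof.
move=> mf fc.
pose r m n x := Num.min 1 `|f m x - f n x|.
have r0 m n x : 0 <= r m n x by rewrite /r le_min ler01 normr_ge0.
have mr m n : measurable_fun setT (r m n).
  apply: measurable_minr => //; apply: measurableT_comp => //.
  exact: measurable_funB.
have [phi hphi phiP] : exists2 phi, incr phi & forall n m, (phi n <= m)%N ->
    (\int[mu]_x (r m (phi n) x)%:E <= (2^-1 ^+ n)%:E)%E.
  apply: (@incr_exists (fun n => [set k | forall m, (k <= m)%N ->
    (\int[mu]_x (r m k x)%:E <= (2^-1 ^+ n)%:E)%E])) => n N.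
  have p0 : 0 < (2 : R)^-1 ^+ n by rewrite exprn_gt0 ?invr_gt0.
  have [N' N'P] := fc _ p0.
  exists (maxn N N') => [|m /= h]; first exact: leq_maxl.
  by apply: N'P => //; lia.
exists phi => //.
pose a k x := r (phi k.+1) (phi k) x.
have a0 k x : 0 <= a k x by exact: r0.
have ma k : measurable_fun setT (a k) by exact: mr.
have : (\int[mu]_x (\sum_(0 <= k <oo) (a k x)%:E) < +oo)%E.
  rewrite integral_nneseries//; last 2 first.
  - by move=> k; exact/measurable_EFinP.
  - by move=> k x _; rewrite lee_fin.
  apply: (@le_lt_trans _ _ (\sum_(0 <= k <oo) (2^-1 ^+ k)%:E)%E).
    apply: lee_nneseries => [k _ _|k _].
      by apply: integral_ge0 => x _; rewrite lee_fin.
    by apply: phiP; apply/ltnW/hphi.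
  under eq_eseriesr do rewrite -[_ ^+ _]mul1r.
  by apply: geometric_eseries_lty; lra.
pose S x := (\sum_(0 <= k <oo) (a k x)%:E)%E.
have mS : measurable_fun setT S.
  apply: ge0_emeasurable_sum => [k x _ _|k _]; first by rewrite lee_fin.
  exact/measurable_EFinP.
have S0 x : (0 <= S x)%E by apply: nneseries_ge0 => k _ _; rewrite lee_fin.
move=> Soo.
have : mu.-integrable setT S.
  by apply/integrableP; split=> //; under eq_integral do rewrite gee0_abs//.
move=> /integrable_ae => /(_ measurableT) [A [mA A0 SA]].
have cvA x : ~ A x -> cvgn (fun k => f (phi k) x).
  move=> nA; have Sx : S x \is a fin_num.
    by apply: contrapT => h; apply: nA; apply: SA => /= /(_ I).
  have /cvg_ex[l /cvgn_epsP al] : cvgn (series (a^~ x)).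
    apply: nnseries_is_cvg => //; by rewrite -ge0_fin_numE ?S0.
  apply: cauchy_real_cvg => e e0.
  (* A tail sum below 1/2 forces every term below 1, where the truncation by 1 is inactive and the
     term is the true difference. *)
  have h2 : 0 < Num.min e 2^-1 / 2 by rewrite divr_gt0// lt_min e0 invr_gt0 ltr0n.
  have [N NP] := al _ h2; exists N => n Nn.
  have h : \sum_(N <= k < n) a k x <= Num.min e 2^-1.
    have E : \sum_(0 <= k < n) a k x =
        \sum_(0 <= k < N) a k x + \sum_(N <= k < n) a k x.
      by rewrite -big_cat_nat.
    have := NP _ Nn; have := NP _ (leqnn N); rewrite !ler_distl /series /= E.
    move=> /andP[? ?] /andP[? ?].
    lra.
  rewrite le_min in h; case/andP: h => he h1.
  apply: le_trans he; rewrite -(telescope_sumr (fun k => f (phi k) x))//.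
  apply: le_trans (ler_norm_sum _ _ _) _.
  rewrite big_nat [leRHS]big_nat; apply: ler_sum => k /andP[Nk kn].
  have : a k x <= 2^-1.
    apply: le_trans h1; rewrite (bigD1_seq k) ?iota_uniq ?mem_index_iota ?Nk//=.
    by rewrite lerDl sumr_ge0.
  by rewrite /a /r minEle; case: ifPn => // _; lra.
(* Setting the functions to zero on the exceptional set makes them converge everywhere, so that the
   limit is measurable. *)
pose g_ k x := if x \in A then 0 else f (phi k) x.
have g_E x : ~ A x -> g_^~ x = (fun k => f (phi k) x).
  by move=> nA; apply/funext => k; rewrite /g_ memNset.
have g_cvg x : cvgn (g_^~ x).
  have [Ax|nA] := pselect (A x); last by rewrite g_E//; exact: cvA.
  rewrite (_ : g_^~ x = cst 0); first exact: is_cvg_cst.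
  by apply/funext => k; rewrite /g_ mem_set.
exists (fun x => limn (g_^~ x)).
  apply: (@measurable_fun_cvg _ _ _ _ g_) => [k|x _]; last exact: g_cvg.
  by apply: measurable_fun_ifT => //; exact: measurable_mem.
exists A; split => // x /= h; apply: contrapT => nA; apply: h.
by have := g_cvg x; rewrite g_E.
Qed.

End real_integrals.

(** * Square-integrable functions and their inner product *)

Section square_integrable.
Context d (T : measurableType d) (R : realType).
Variable mu : {measure set T -> \bar R}.

(** Extended-valued, so that Fatou's lemma and Cauchy conditions can be used before integrability is
    known; [ip] is the real counterpart, and [ip_sqint] links the two. Both live on any measurable
    space because the domain and the space-time cylinder are needed. *)
Definition sqint (w : T -> R) : \bar R := (\int[mu]_x ((w x) ^+ 2)%:E)%E.

Definition ip (u w : T -> R) : R := \int[mu]_x (u x * w x).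

Lemma sqint_ge0 w : (0 <= sqint w)%E.
Proof. by apply: integral_ge0 => x _; rewrite lee_fin sqr_ge0. Qed.

Lemma sqint_Lnorm w : 'N[mu]_2%:E [EFin \o w]%E = (sqint w `^ 2^-1)%E.
Proof.
rewrite unlock /sqint; congr (_ `^ _)%E; apply: eq_integral => x _ /=.
by rewrite powR_mulrn// real_normK ?num_real.
Qed.

Lemma Lfun2P w : w \in Lfun mu 2%:E <->
  measurable_fun setT w /\ (sqint w < +oo)%E.
Proof.
split=> [/[dup] wL /Lfun2_integrable_sqr /integrableP[_ h]|[mw h]].
  split; first by move: wL; rewrite inE => /andP[]; rewrite inE.
  apply: le_lt_trans h; rewrite le_eqVlt; apply/orP; left; apply/eqP.
  by apply: eq_integral => x _ /=; rewrite ger0_norm ?sqr_ge0.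
rewrite inE; apply/andP; split; rewrite inE//=.
by rewrite /finite_norm sqint_Lnorm poweR_lty.
Qed.

Lemma Lfun2_measurable w : w \in Lfun mu 2%:E -> measurable_fun setT w.
Proof. by move=> /Lfun2P[]. Qed.

Lemma Lfun2_mul_integrable u w : u \in Lfun mu 2%:E -> w \in Lfun mu 2%:E ->
  mu.-integrable setT (fun x => (u x * w x)%:E).
Proof. by move=> hu hw; apply/Lfun1_integrable; exact: Lfun2_mul_Lfun1. Qed.

Lemma ip_sqint w : w \in Lfun mu 2%:E -> sqint w = (ip w w)%:E.
Proof.
move=> /Lfun2P[mw h]; rewrite /ip /Rintegral fineK.
  by apply: eq_integral => x _; rewrite expr2.
rewrite ge0_fin_numE; last by apply: integral_ge0 => x _; rewrite -expr2 lee_fin sqr_ge0.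
by apply: le_lt_trans h; under eq_integral do rewrite -expr2.
Qed.

Lemma ip_ge0 w : 0 <= ip w w.
Proof. by apply: Rintegral_ge0 => x _; rewrite -expr2 sqr_ge0. Qed.

Lemma ipC u w : ip u w = ip w u.
Proof. by apply: eq_Rintegral => x _; rewrite mulrC. Qed.

Lemma ipDl u v w : u \in Lfun mu 2%:E -> v \in Lfun mu 2%:E ->
  w \in Lfun mu 2%:E -> ip (fun x => u x + v x) w = ip u w + ip v w.
Proof.
move=> hu hv hw; rewrite /ip -RintegralD//; last 2 first.
- exact: Lfun2_mul_integrable.
- exact: Lfun2_mul_integrable.
by apply: eq_Rintegral => x _; rewrite mulrDl.
Qed.

Lemma ipZl a u w : u \in Lfun mu 2%:E -> w \in Lfun mu 2%:E ->
  ip (fun x => a * u x) w = a * ip u w.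
Proof.
move=> hu hw; rewrite /ip -RintegralZl//; last exact: Lfun2_mul_integrable.
by apply: eq_Rintegral => x _; rewrite mulrA.
Qed.

Lemma sqintD_le (u v : T -> R) : measurable_fun setT u -> measurable_fun setT v ->
  (sqint (fun x => u x + v x)%R <= 2%:E * sqint u + 2%:E * sqint v)%E.
Proof.
move=> mu_ mv; have mX (w : T -> R) : measurable_fun setT w ->
    measurable_fun setT (fun x => w x ^+ 2) by move=> ?; exact: measurable_funX.
have X0 (w : T -> R) x : 0 <= 2 * w x ^+ 2 by rewrite mulr_ge0 ?sqr_ge0.
rewrite /sqint -!ge0_intZ//; last 4 first.
- by move=> x; exact: sqr_ge0.
- exact: mX.
- by move=> x; exact: sqr_ge0.
- exact: mX.
rewrite -ge0_intD//; last 2 first.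
- by apply: measurable_funM => //; exact: mX.
- by apply: measurable_funM => //; exact: mX.
apply: ge0_le_int => [x||]; last 2 first.
- by apply: mX; exact: measurable_funD.
- by apply: measurable_funD; apply: measurable_funM => //; exact: mX.
by rewrite sqr_ge0 /=; have := sqr_ge0 (u x - v x); nra.
Qed.

Lemma Lfun2D u v : u \in Lfun mu 2%:E -> v \in Lfun mu 2%:E ->
  (fun x => u x + v x) \in Lfun mu 2%:E.
Proof.
move=> /Lfun2P[mu_ uoo] /Lfun2P[mv voo]; apply/Lfun2P.
split; first exact: measurable_funD.
by rewrite (le_lt_trans (sqintD_le _ _))// lte_add_pinfty// lte_mul_pinfty.
Qed.

Lemma Lfun2Z a u : u \in Lfun mu 2%:E -> (fun x => a * u x) \in Lfun mu 2%:E.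
Proof.
move=> /Lfun2P[mu_ uoo]; apply/Lfun2P; split; first exact: measurable_funM.
rewrite /sqint; under eq_integral do rewrite exprMn.
rewrite ge0_intZ ?sqr_ge0//; first by rewrite lte_mul_pinfty ?lee_fin ?sqr_ge0.
- by move=> x; rewrite sqr_ge0.
- exact: measurable_funX.
Qed.

Lemma Lfun2_0 : (fun=> 0) \in Lfun mu 2%:E.
Proof.
apply/Lfun2P; split => //; rewrite /sqint; under eq_integral do rewrite expr0n/=.
by rewrite integral0.
Qed.

Lemma Lfun2B u v : u \in Lfun mu 2%:E -> v \in Lfun mu 2%:E ->
  (fun x => u x - v x) \in Lfun mu 2%:E.
Proof.
move=> hu hv; have := Lfun2D hu (Lfun2Z (-1) hv).
by rewrite (_ : (fun x => u x + -1 * v x) = (fun x => u x - v x))//;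
  apply/funext => x; rewrite mulN1r.
Qed.

Lemma Lfun2_norm (u : LfunType mu (lee1n 2)) :
  fine ('N[mu]_2%:E [EFin \o u])%E = Num.sqrt (ip u u).
Proof.
rewrite sqint_Lnorm ip_sqint ?LfunP// poweR_EFin /=.
by rewrite powR12_sqrt ?ip_ge0.
Qed.

End square_integrable.

(** * Completeness and weak compactness of L^2 over a finite measure *)

Section L2_compactness.
Context d (T : measurableType d) (R : realType).
Variable mu : {measure set T -> \bar R}.
Hypothesis mu_fin : (mu setT < +oo)%E.

(** Integrates [|h| <= t + h^2 / t]: on a finite measure, smallness in L^2 gives smallness in
    measure. *)
Lemma int_min1_le (h : T -> R) (t : R) : 0 < t -> measurable_fun setT h ->
  (\int[mu]_x (Num.min 1 `|h x|)%:E <= t%:E * mu setT + t^-1%:E * sqint mu h)%E.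
Proof.
move=> t0 mh; have mX : measurable_fun setT (fun x => h x ^+ 2).
  exact: measurable_funX.
have tV0 : 0 <= t^-1 by rewrite invr_ge0 ltW.
rewrite -(integral_cst _ measurableT) /sqint -ge0_intZ//; last first.
  by move=> x; exact: sqr_ge0.
rewrite -ge0_intD//; last 3 first.
- by move=> _; exact: ltW.
- by move=> x; rewrite mulr_ge0// sqr_ge0.
- exact: measurable_funM.
apply: ge0_le_int => [x||]; last 2 first.
- by apply: measurable_minr => //; exact: measurableT_comp.
- by apply: measurable_funD => //; exact: measurable_funM.
rewrite le_min ler01 normr_ge0 /= ge_min; apply/orP; right.
rewrite -(ler_pM2l t0) mulrDr mulrA divff ?gt_eqF// mul1r -(real_normK (num_real (h x))).
have := sqr_ge0 (t - `|h x|); have := normr_ge0 (h x); nra.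
Qed.

Lemma sqint_subseq (f : nat -> T -> R) :
  (forall k, measurable_fun setT (f k)) ->
  (forall e : R, 0 < e -> exists N, forall m n, (N <= m)%N -> (N <= n)%N ->
    (sqint mu (fun x => f m x - f n x)%R <= e%:E)%E) ->
  exists2 phi, incr phi & exists2 g, measurable_fun setT g &
    {ae mu, forall x, f (phi k) x @[k --> \oo] --> (g x : R)}.
Proof.
move=> mf fc; apply: ae_subseq => // e e0.
pose M := fine (mu setT) + 1.
have muM : mu setT = (fine (mu setT))%:E by rewrite fineK ?ge0_fin_numE.
have M0 : 0 < M by rewrite /M ltr_wpDl// fine_ge0.
(* With this [t] the constant part contributes at most [e / 2], and an L^2 bound of [e / 2 * t]
   makes the other part at most [e / 2]. *)
pose t := e / 2 / M; have t0 : 0 < t by rewrite /t !divr_gt0.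
have [N NP] := fc (e / 2 * t) (mulr_gt0 (divr_gt0 e0 (ltr0Sn _ _)) t0).
exists N => m n Nm Nn.
apply: le_trans (int_min1_le t0 _) _; first exact: measurable_funB.
rewrite muM; apply: (@le_trans _ _ ((e / 2)%:E + (e / 2)%:E)%E); last first.
  by rewrite -EFinD lee_fin; lra.
apply: leeD.
  by rewrite -EFinM lee_fin /t mulrAC ler_pdivrMr// ler_pM2l ?divr_gt0// lerDl.
apply: (@le_trans _ _ (t^-1%:E * (e / 2 * t)%:E)%E).
  by rewrite lee_pmul2l ?NP// lte_fin invr_gt0.
by rewrite -EFinM lee_fin mulrCA mulVf ?gt_eqF// mulr1.
Qed.

Lemma sqint_fatou (f : nat -> T -> R) (g : T -> R) C :
  (forall k, measurable_fun setT (f k)) -> measurable_fun setT g ->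
  {ae mu, forall x, f k x @[k --> \oo] --> (g x : R)} ->
  (forall k, sqint mu (f k) <= C)%E -> (sqint mu g <= C)%E.
Proof.
move=> mf mg fg fC; apply: (@fatou_le _ _ _ mu (fun k x => f k x ^+ 2)) => //.
- by move=> k; exact: measurable_funX.
- by move=> k x; exact: sqr_ge0.
- exact: measurable_funX.
- by move=> x; exact: sqr_ge0.
- by apply: filterS fg => x h; exact: cvgM.
Qed.

(** Riesz-Fischer: with one index fixed, Fatou's lemma along an almost everywhere convergent
    subsequence of the other turns the Cauchy bound into a bound on the distance to the limit. *)
Lemma sqint_complete (f : nat -> T -> R) :
  (forall k, f k \in Lfun mu 2%:E) ->
  (forall e : R, 0 < e -> exists N, forall m n, (N <= m)%N -> (N <= n)%N ->
    (sqint mu (fun x => f m x - f n x)%R <= e%:E)%E) ->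
  exists2 g, g \in Lfun mu 2%:E & forall e : R, 0 < e -> exists N,
    forall n, (N <= n)%N -> (sqint mu (fun x => f n x - g x)%R <= e%:E)%E.
Proof.
move=> fL fc; have mf k := Lfun2_measurable (fL k).
have [phi hphi [g mg fg]] := sqint_subseq mf fc.
have key (e : R) : 0 < e -> exists N, forall n, (N <= n)%N ->
    (sqint mu (fun x => f n x - g x)%R <= e%:E)%E.
  move=> e0; have [N NP] := fc e e0; exists N => n Nn.
  apply: (@sqint_fatou (fun k x => f n x - f (phi (N + k)%N) x)).
  - by move=> k; exact: measurable_funB.
  - exact: measurable_funB.
  - apply: filterS fg => x h; apply: cvgB; first exact: cvg_cst.
    have hN : incr (addn N) by move=> i j; lia.
    exact: incr_cvg hN h.
  - move=> k; apply: NP => //; apply: leq_trans (incr_ge _ hphi); lia.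
exists g => //; apply/Lfun2P; split => //.
have [N /(_ N (leqnn N)) NP] := key 1 ltr01.
have E : g = (fun x => f N x - (f N x - g x)).
  by apply/funext => x; rewrite opprB addrC subrK.
suff /Lfun2P[] : g \in Lfun mu 2%:E by [].
rewrite E; apply: Lfun2B => //; apply/Lfun2P; split; first exact: measurable_funB.
by rewrite (le_lt_trans NP)// ltry.
Qed.

Lemma L2_weak_subseq (u : nat -> LfunType mu (lee1n 2)) (C : R) :
  (forall k, ip mu (u k) (u k) <= C) ->
  exists2 phi, incr phi & exists l : LfunType mu (lee1n 2),
    weak_cvg (fun v : LfunType mu (lee1n 2) => fine ('N[mu]_2%:E [EFin \o v])%E)
      (fun k => u (phi k)) l /\
    exists z : nat -> LfunType mu (lee1n 2),
      (forall n, mid_hull (@vmid _ _) (tail (fun k => u (phi k)) n) (z n)) /\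
      forall e : R, 0 < e -> exists N, forall n, (N <= n)%N ->
        (sqint mu (fun x => z n x - l x)%R <= e%:E)%E.
Proof.
move=> uC.
have subE (v w : LfunType mu (lee1n 2)) : ((v - w : LfunType mu (lee1n 2)) : T -> R) =
  (fun x => v x - w x) by [].
have sqE (v w : LfunType mu (lee1n 2)) :
    sqint mu (fun x => v x - w x) = (ip mu (v - w) (v - w))%:E.
  by rewrite -ip_sqint ?LfunP.
have := @weak_subseq R (LfunType mu (lee1n 2)) (fun v w => ip mu v w) _ _ _ _ _ u C uC.
case.
- by move=> v w; exact: ipC.
- by move=> v w z; exact: (ipDl (LfunP v) (LfunP w) (LfunP z)).
- by move=> a v w; exact: (ipZl _ (LfunP v) (LfunP w)).
- by move=> v; exact: ip_ge0.
- move=> z zc; have [|g gL gP] := @sqint_complete (fun k => z k) (fun k => LfunP (z k)).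
    by move=> e /zc[N NP]; exists N => m n Nm Nn; rewrite sqE lee_fin NP.
  exists (Lfun_Sub (lee1n 2) gL) => e /gP[N NP]; exists N => n Nn.
  by rewrite -lee_fin -sqE; exact: NP.
move=> phi hphi [l [wl [z [zu zl]]]]; exists phi => //; exists l; split.
  rewrite (_ : (fun v => _) = (fun v : LfunType mu (lee1n 2) => Num.sqrt (ip mu v v)))//.
  by apply/funext => v; exact: Lfun2_norm.
by exists z; split => // e /zl[N NP]; exists N => n Nn; rewrite sqE lee_fin NP.
Qed.

End L2_compactness.

(** * Positivity of the Gamma function *)

Lemma nneseries_term_le (R : realType) (u : nat -> \bar R) k :
  (forall i, 0 <= u i)%E -> (u k <= \sum_(0 <= i <oo) u i)%E.
Proof.
move=> u0; apply: le_trans (nneseries_lim_ge k.+1 (fun i _ _ => u0 i)).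
by rewrite big_nat_recr//= leeDr// sume_ge0.
Qed.

Lemma int_indic_series d (T : measurableType d) (R : realType)
    (mu : {measure set T -> \bar R}) (A : nat -> set T) (a m : nat -> R) :
  (forall k, measurable (A k)) -> (forall k, 0 <= a k) ->
  (forall k, mu (A k) <= (m k)%:E)%E ->
  (\int[mu]_x (\sum_(0 <= k <oo) (a k * \1_(A k) x)%:E) <=
    \sum_(0 <= k <oo) (a k * m k)%:E)%E.
Proof.
move=> mA a0 Am; have mI k : measurable_fun setT (fun x => \1_(A k) x : R).
  exact: measurable_indic.
rewrite integral_nneseries//; last 2 first.
- by move=> k; apply/measurable_EFinP; exact: measurable_funM.
- by move=> k x _; rewrite lee_fin mulr_ge0.
apply: lee_nneseries => [k _ _|k _].
  by apply: integral_ge0 => x _; rewrite lee_fin mulr_ge0.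
rewrite ge0_intZ// integral_indic// setIT EFinM.
by rewrite lee_wpmul2l ?lee_fin.
Qed.

Lemma dyadic_le1 (R : realType) (t : R) : 0 < t <= 1 ->
  exists k, 2^-1 ^+ k.+1 < t <= 2^-1 ^+ k.
Proof.
move=> /andP[t0 t1].
have ex : exists k, 2^-1 ^+ k.+1 < t.
  have h : `|2^-1 : R| < 1 by rewrite ger0_norm; lra.
  have /cvgn_epsP/(_ (t / 2) (divr_gt0 t0 (ltr0Sn _ _)))[N] := cvg_geometric 1 h.
  move=> /(_ N.+1 (leqnSn _)); rewrite /geometric /= mul1r subr0 => h2; exists N.
  by rewrite (le_lt_trans (ler_norm _))// (le_lt_trans h2)//; lra.
pose P k := 2^-1 ^+ k.+1 < t.
have := find_ex_minn (ex : exists k, P k) => -[[|k] Pk kmin].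
  by exists 0%N; rewrite expr0 t1 andbT.
exists k.+1; rewrite -[X in X && _]/(P k.+1) Pk /= leNgt.
by apply/negP => /(kmin k); rewrite ltnn.
Qed.

(** An infinite integral would be read as the real number 0, so finiteness is part of the claim. The
    integrand is dominated by a series of step functions, on dyadic shells near 0 and near
    infinity. *)
Lemma gamma_fun_gt0 (R : realType) (x : R) : 0 < x -> 0 < gamma_fun x.
Proof.
move=> x0; pose mu := @lebesgue_measure R.
pose g (t : R) := t `^ (x - 1) * expR (- t).
have g0 t : 0 <= g t by rewrite mulr_ge0 ?powR_ge0 ?expR_ge0.
have mg : measurable_fun setT g.
  apply: measurable_funM; first exact: measurable_powR.
  by apply: measurableT_comp => //; exact: measurable_funN.
have mgE (D : set R) : measurable_fun D (fun t => (g t)%:E).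
  by apply: measurable_funTS; exact/measurable_EFinP.
have powE t : 0 < t -> t `^ (x - 1) = t `^ x / t.
  move=> t0; rewrite powRB; first by rewrite powRr1 ?ltW.
  by apply/implyP => _; rewrite gt_eqF.
pose z : R := 2^-1 `^ x.
have z01 : 0 <= z < 1.
  have one : (1 : R) `^ x = 1 by rewrite powR1.
  rewrite powR_ge0 /z -[X in _ < X]one gt0_ltr_powR//.
  - by rewrite nnegrE; lra.
  - by rewrite nnegrE; lra.
  - lra.
(* On the shell [2^-(k+1) < t <= 2^-k] the integrand is at most [t^x / t <= (2^-k)^x 2^(k+1)]. Times
   the length [2^-k] this is [2 z^k], summable because [x > 0]. *)
pose a k : R := 2 ^+ k.+1 * z ^+ k.
have a0 k : 0 <= a k by rewrite mulr_ge0 ?exprn_ge0//; lra.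
have ga k t : 2^-1 ^+ k.+1 < t <= 2^-1 ^+ k -> g t <= a k.
  move=> /andP[t1 t2]; have t0 : 0 < t.
    by apply: le_lt_trans t1; rewrite exprn_ge0 ?invr_ge0.
  apply: (@le_trans _ _ (t `^ (x - 1))).
    by rewrite ler_piMr ?powR_ge0// -expR0 ler_expR oppr_le0 ltW.
  rewrite powE// mulrC ler_pM ?powR_ge0 ?invr_ge0 ?(ltW t0)//.
    by rewrite -[leRHS]invrK lef_pV2 ?posrE ?invr_gt0 ?exprn_gt0// -exprVn (ltW t1).
  rewrite /z -powR_mulrn ?powR_ge0// -powRrM mulrC powRrM powR_mulrn ?invr_ge0//.
  by apply: ge0_ler_powR; rewrite ?nnegrE ?exprn_ge0 ?invr_ge0 ?(ltW t0) ?(ltW x0).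
(* For [t >= 1] this gives [t^(x+1) <= t^(n+1)]; as [e^t >= t^(n+1) / (n+1)!], the integrand is at
   most [(n+1)! / t^2], hence at most [b k] once [t >= 2^k]. *)
have [n xn] : exists n : nat, x + 1 <= n.+1%:R.
  exists (Num.truncn (x + 1)); exact/ltW/truncnS_gt.
pose b k : R := (n.+1)`!%:R * 4^-1 ^+ k.
have b0 k : 0 <= b k by rewrite mulr_ge0 ?exprn_ge0//; lra.
have gb k t : 1 <= t -> 2 ^+ k <= t -> g t <= b k.
  move=> t1 tk; have t0 : 0 < t by lra.
  have h : g t <= t ^+ n.+1 / t ^+ 2 * expR (- t).
    rewrite ler_pM2r ?expR_gt0// powE//.
    rewrite (_ : t `^ x = t `^ (x + 1) / t).
      rewrite -mulrA -invfM -expr2 ler_pM2r ?invr_gt0 ?exprn_gt0//.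
      by rewrite -powR_mulrn ?(ltW t0)// ler_powR.
    rewrite powRD; last by apply/implyP => _; rewrite gt_eqF.
    by rewrite powRr1 ?(ltW t0)// mulfK// gt_eqF.
  apply: le_trans h _; rewrite expRN -mulrA -invfM mulrC.
  have := expR_ge1Dxn n (ltW t0) => h1.
  have h2 : t ^+ n.+1 <= (n.+1)`!%:R * expR t.
    by rewrite mulrC -ler_pdivrMr ?ltr0n ?fact_gt0//; lra.
  rewrite mulrC ler_pdivrMr ?mulr_gt0 ?exprn_gt0 ?expR_gt0//.
  apply: le_trans h2 _; rewrite /b -mulrA ler_wpM2l// mulrA ler_peMl ?expR_ge0//.
  rewrite exprVn ler_pdivlMl ?exprn_gt0// mulr1.
  by rewrite (_ : 4 = 2 ^+ 2) -?exprM 1?mulnC ?exprM ?ler_pXn2r ?nnegrE ?exprn_ge0 ?(ltW t0)//; ring.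
pose F (t : R) : \bar R := ((\sum_(0 <= k <oo) (a k * \1_(`[0, 2^-1 ^+ k]%classic) t)%:E) +
   (\sum_(0 <= k <oo) (b k * \1_(`[0, 2 ^+ k.+1]%classic) t)%:E))%E.
have F1 (t : R) : (0 <= \sum_(0 <= k <oo) (a k * \1_(`[0, 2^-1 ^+ k]%classic) t)%:E)%E.
  by apply: nneseries_ge0 => k _ _; rewrite lee_fin mulr_ge0.
have F2 (t : R) : (0 <= \sum_(0 <= k <oo) (b k * \1_(`[0, 2 ^+ k.+1]%classic) t)%:E)%E.
  by apply: nneseries_ge0 => k _ _; rewrite lee_fin mulr_ge0.
have mI (c : R) (D : set R) : measurable D ->
    measurable_fun setT (fun t : R => (c * \1_D t)%:E).
  by move=> mD; apply/measurable_EFinP; apply: measurable_funM.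
have mF1 : measurable_fun setT
    (fun t : R => \sum_(0 <= k <oo) (a k * \1_(`[0, 2^-1 ^+ k]%classic) t)%:E)%E.
  apply: ge0_emeasurable_sum => [k t _ _|k _]; first by rewrite lee_fin mulr_ge0.
  exact: mI.
have mF2 : measurable_fun setT
    (fun t : R => \sum_(0 <= k <oo) (b k * \1_(`[0, 2 ^+ k.+1]%classic) t)%:E)%E.
  apply: ge0_emeasurable_sum => [k t _ _|k _]; first by rewrite lee_fin mulr_ge0.
  exact: mI.
have itvE (c : R) : 0 < c -> (mu `[0%R, c]%classic <= c%:E)%E.
  by move=> c0; rewrite /mu lebesgue_measure_itv /= lte_fin c0 -EFinD subr0.
have gF t : 0 < t -> ((g t)%:E <= F t)%E.
  move=> t0; have [t1|t1] := leP t 1.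
    have [|k kt] := @dyadic_le1 _ t; first by rewrite t0.
    apply: le_trans (leeDl _ (F2 t)).
    apply: le_trans (nneseries_term_le k _); last first.
      by move=> i; rewrite lee_fin mulr_ge0.
    rewrite indicE mem_set ?mulr1 ?lee_fin ?ga//.
    by rewrite /= in_itv/= (ltW t0); case/andP: kt.
  have [|k /andP[k1 k2]] := @dyadic_le1 _ t^-1.
    by rewrite invr_gt0 t0 invf_le1// (ltW t1).
  apply: le_trans (leeDr _ (F1 t)).
  apply: le_trans (nneseries_term_le k _); last first.
    by move=> i; rewrite lee_fin mulr_ge0.
  have tk : 2 ^+ k <= t.
    by rewrite -[leRHS]invrK -[leLHS]invrK lef_pV2 ?posrE ?invr_gt0 ?exprn_gt0// -exprVn.
  rewrite indicE mem_set ?mulr1 ?lee_fin ?gb ?(ltW t1)//.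
  rewrite /= in_itv/= (ltW t0)/=.
  by rewrite -[leRHS]invrK -[leLHS]invrK lef_pV2 ?posrE ?invr_gt0 ?exprn_gt0// -exprVn (ltW k1).
have Foo : (\int[mu]_t F t < +oo)%E.
  rewrite ge0_integralD//; apply: lte_add_pinfty.
    apply: le_lt_trans (@int_indic_series _ _ _ mu _ _ (fun k => 2^-1 ^+ k) _ _ _) _ => //.
      by move=> k; apply: itvE; rewrite exprn_gt0.
    have E k : a k * 2^-1 ^+ k = 2 * z ^+ k.
      rewrite /a exprS mulrAC -(mulrA 2) -exprMn.
      by rewrite divff ?gt_eqF// expr1n mulr1.
    under eq_eseriesr => k _ do rewrite E.
    exact: geometric_eseries_lty.
  apply: le_lt_trans (@int_indic_series _ _ _ mu _ _ (fun k => 2 ^+ k.+1) _ _ _) _ => //.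
    by move=> k; apply: itvE; rewrite exprn_gt0.
  have E k : b k * 2 ^+ k.+1 = (n.+1)`!%:R * 2 * 2^-1 ^+ k.
    rewrite /b exprS.
    have -> : (4^-1 : R) = 2^-1 * 2^-1 by field.
    have h : (2^-1 : R) ^+ k * 2 ^+ k = 1 by rewrite -exprMn mulVf ?expr1n// gt_eqF.
    rewrite exprMn; move: (2^-1 ^+ k) (2 ^+ k) h => y w h.
    by transitivity ((n.+1)`!%:R * 2 * y * (y * w)); [ring|rewrite h mulr1].
  under eq_eseriesr => k _ do rewrite E.
  apply: geometric_eseries_lty; first by rewrite mulr_ge0.
  lra.
pose D : set R := `]0, +oo[%classic.
pose D2 : set R := `[1, 2]%classic.
have mD : measurable D by exact: measurable_itv.
have mD2 : measurable D2 by exact: measurable_itv.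
have goo : (\int[mu]_(t in D) (g t)%:E < +oo)%E.
  apply: le_lt_trans Foo.
  apply: (@le_trans _ _ (\int[mu]_(t in D) F t)%E); last first.
    apply: ge0_subset_integral => //; first exact: emeasurable_funD.
    by move=> t _; rewrite adde_ge0.
  apply: ge0_le_integral => //.
  - by move=> t _; rewrite lee_fin.
  - exact: mgE.
  - by apply: measurable_funTS; exact: emeasurable_funD.
  - by move=> t; rewrite /D /D2 /= in_itv/= andbT; exact: gF.
rewrite /gamma_fun /Rintegral fine_gt0// goo andbT.
(* A lower bound of the integrand on [[1, 2]]: there [t^x / t >= 1/2] and [e^-t >= e^-2]. *)
pose c : R := 2^-1 * expR (-2).
apply: (@lt_le_trans _ _ (\int[mu]_(t in D2) c%:E)%E).
  rewrite integral_cst//= /mu /D2 lebesgue_measure_itv /= lte_fin ifT; last lra.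
  by rewrite -EFinD -EFinM lte_fin !mulr_gt0 ?expR_gt0//; lra.
apply: (@le_trans _ _ (\int[mu]_(t in D2) (g t)%:E)%E).
  apply: ge0_le_integral => //.
  - by move=> t _; rewrite lee_fin mulr_ge0 ?expR_ge0.
  - exact: mgE.
  - move=> t; rewrite /D /D2 /= in_itv/= lee_fin => /andP[t1 t2].
    apply: ler_pM; rewrite ?expR_ge0 ?invr_ge0//; last by rewrite ler_expR; lra.
    rewrite powE; last lra.
    apply: (@le_trans _ _ t^-1); first by rewrite lef_pV2// posrE; lra.
    have one : (1 : R) `^ x = 1 by rewrite powR1.
    rewrite ler_peMl ?invr_ge0//; first lra.
    by rewrite -[X in X <= _]one ge0_ler_powR ?nnegrE//; lra.
apply: ge0_subset_integral => //.
- exact: mgE.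
- by move=> t _; rewrite lee_fin g0.
- by move=> t; rewrite /D /D2 /= !in_itv/= andbT => /andP[t1 _]; lra.
Qed.


(** * Lebesgue measure on [R^d] and on the domain *)

(** The image measure under the translation gives half-open intervals their length, so it is
    Lebesgue measure by uniqueness. *)
Lemma ge0_integral_shift (R : realType) (h : R) (F : R -> \bar R) :
  measurable_fun setT F -> (forall x, 0 <= F x)%E ->
  (\int[@lebesgue_measure R]_x F (x + h)%R = \int[@lebesgue_measure R]_x F x)%E.
Proof.
move=> mF F0.
have mh : measurable_fun setT (fun x : measurableTypeR R => x + h : measurableTypeR R).
  by apply: measurable_funD.
have := @ge0_integral_pushforward _ _ _ _ _ _ mh (@lebesgue_measure R) setT F
  measurableT mF (fun x _ => F0 x).
rewrite preimage_setT => <-.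
apply: eq_measure_integral => A mA _; apply/esym.
apply: (@lebesgue_measure_unique R (pushforward (@lebesgue_measure R) _)) => // _ [[a b] _ <-].
rewrite [RHS](_ : _ = lebesgue_measure `]a - h, b - h]%classic); last first.
  congr lebesgue_measure.
  by apply/seteqP; split => x /=; rewrite !in_itv/= ltrBlDr lerBrDr.
rewrite !lebesgue_measure_itv /= !lte_fin ltrD2r; case: ifPn => // _.
by rewrite -!EFinD; congr (_%:E); ring.
Qed.

(** By induction on the dimension, Tonelli's theorem splitting off the first coordinate. *)
Lemma ge0_integral_rV_shift (R : realType) (d : nat) (h : 'rV[R]_d)
    (F : 'rV[R]_d -> \bar R) :
  measurable_fun setT F -> (forall x, 0 <= F x)%E ->
  (\int[lebesgue_rV R d]_x F (x + h)%R = \int[lebesgue_rV R d]_x F x)%E.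
Proof.
elim: d h F => [|d IH] h F mF F0.
  by apply: eq_integral => x _; congr F; apply/rowP => -[].
have mhd : measurable_fun setT (fun x : 'rV[R]_d.+1 => x + h).
  apply: measurable_fun_rVP => i.
  rewrite (_ : _ \o _ = (fun x => rV_coord i x + h ord0 i)).
    by apply: measurable_funD => //; exact: measurable_rV_coord.
  by apply/funext => x; rewrite /rV_coord /= mxE.
have key (G : 'rV[R]_d.+1 -> \bar R) : measurable_fun setT G ->
    (forall x, 0 <= G x)%E ->
    (\int[lebesgue_rV R d.+1]_x G x =
     \int[@lebesgue_measure R]_a \int[lebesgue_rV R d]_v G (consrV (a, v)))%E.
  move=> mG G0.
  pose m12 : {measure set (measurableTypeR R * 'rV[R]_d) -> \bar R} :=
    (@lebesgue_measure R \x lebesgue_rV R d)%E.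
  have mc : measurable_fun setT (@consrV R d : measurableTypeR R * 'rV[R]_d -> _).
    exact: measurable_consrV.
  have := @ge0_integral_pushforward _ _ _ _ _ _ mc m12 setT G measurableT mG
    (fun x _ => G0 x).
  rewrite preimage_setT => E; apply: etrans E _.
  apply: etrans (@fubini_tonelli1 _ _ _ _ _ (@lebesgue_measure R) (lebesgue_rV R d)
    (G \o @consrV R d) (measurableT_comp mG mc) (fun z => G0 _)) _.
  by [].
rewrite key//; last exact: measurableT_comp mF mhd.
rewrite (key F mF F0).
pose h0 := h ord0 ord0; pose h' : 'rV[R]_d := \row_i h ord0 (lift ord0 i).
have consD a v : consrV (a, v) + h = consrV (a + h0, v + h').
  apply/rowP => i; case: (unliftP ord0 i) => [j ->|->].
    by rewrite mxE !consrVES !mxE.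
  by rewrite mxE !consrVE0.
have mFc : measurable_fun setT (F \o @consrV R d).
  by apply: measurableT_comp => //; exact: measurable_consrV.
have mF2 a : measurable_fun setT (fun v => F (consrV (a, v))).
  by apply: (measurableT_comp mFc); exact: measurable_pair1.
under eq_integral => a _.
  under eq_integral => v _ do rewrite consD.
  rewrite (IH h' (fun v => F (consrV (a + h0, v))))//.
  over.
apply: (@ge0_integral_shift R h0
  (fun a => \int[lebesgue_rV R d]_v F (consrV (a, v)))%E).
  exact: (@measurable_fun_fubini_tonelli_F _ _ _ _ _ (lebesgue_rV R d) (F \o @consrV R d)
    mFc (fun z => F0 _)).
by move=> a; exact: integral_ge0.
Qed.

Lemma measurable_rV_shift (R : realType) (d : nat) (h : 'rV[R]_d) :
  measurable_fun setT (fun x : 'rV[R]_d => x + h).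
Proof.
apply: measurable_fun_rVP => i.
rewrite (_ : _ \o _ = (fun x => rV_coord i x + h ord0 i)).
  by apply: measurable_funD => //; exact: measurable_rV_coord.
by apply/funext => x; rewrite /rV_coord /= mxE.
Qed.

Lemma continuous_measurable_rV (R : realType) (d : nat) (f : 'rV[R]_d -> R) :
  continuous f -> measurable_fun setT f.
Proof.
move=> cf; apply: (measurability _ (RGenOpens.measurableE R)).
move=> _ [_ [a [b ->] <-]]; rewrite setTI.
apply: open_measurable_rV; move/continuousP: cf; apply.
exact: interval_open.
Qed.

(** Cubes instead of Euclidean balls: they are product sets, of volume exactly [(2e)^d]. Boolean, so
    that the relation can enter integrands as a weight 0 or 1. *)
Definition close (R : realType) (d : nat) (e : R) (x y : 'rV[R]_d) : bool :=
  [forall i, `|x ord0 i - y ord0 i| < e].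

Lemma closeC (R : realType) (d : nat) (e : R) (x y : 'rV[R]_d) :
  close e x y = close e y x.
Proof. by apply: eq_forallb => i; rewrite distrC. Qed.

Lemma measurable_fun_close (R : realType) (d : nat) (e : R) :
  measurable_fun setT (fun z : 'rV[R]_d * 'rV[R]_d => close e z.1 z.2).
Proof.
apply: (measurable_fun_bool true); rewrite setTI.
rewrite (_ : _ @^-1` _ = \bigcap_(i in [set: 'I_d])
   ((fun z : 'rV[R]_d * 'rV[R]_d => `|z.1 ord0 i - z.2 ord0 i| < e) @^-1` [set true])).
  apply: fin_bigcap_measurable => // i _; rewrite -[X in measurable X]setTI.
  apply: measurable_fun_ltr => //.
  apply: measurableT_comp => //; apply: measurable_funB.
    exact: (measurableT_comp (@measurable_rV_coord R d i) measurable_fst).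
  exact: (measurableT_comp (@measurable_rV_coord R d i) measurable_snd).
apply/seteqP; split=> z /=; first by move=> /forallP h i _; exact: h.
by move=> h; apply/forallP => i; exact: h.
Qed.

Lemma measurable_close (R : realType) (d : nat) (e : R) (x : 'rV[R]_d) :
  measurable [set y | close e x y].
Proof.
rewrite (_ : [set y | _] = (fun y => close e x y) @^-1` [set true])//.
rewrite -[X in measurable X]setTI.
apply: (measurableT_comp (@measurable_fun_close R d e) (@measurable_pair1 _ _ _ _ x)) => //.
Qed.

Lemma lebesgue_close (R : realType) (d : nat) (e : R) (x : 'rV[R]_d) : 0 < e ->
  lebesgue_rV R d [set y | close e x y] = ((2 * e) ^+ d)%:E.
Proof.
move=> e0.
pose B i : set R := `]x ord0 i - e, x ord0 i + e[%classic.
transitivity (lebesgue_rV R d [set y | forall i, B i (y ord0 i)]).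
  congr (lebesgue_rV R d _); apply/seteqP; split => y /=.
    by move=> /forallP h i; rewrite /B /= in_itv/= -ltr_distlC; exact: h.
  by move=> h; apply/forallP => i; rewrite ltr_distlC; have := h i; rewrite /B /= in_itv.
rewrite lebesgue_rV_box; last by move=> i; exact: measurable_itv.
under eq_bigr => i _.
  rewrite lebesgue_measure_itv /= lte_fin ifT; last lra.
  rewrite -EFinD (_ : _ - _ = 2 * e); last ring.
  over.
by rewrite prodEFin prodr_const card_ord.
Qed.

Lemma ler_coord_norm (R : realType) (d : nat) (x : 'rV[R]_d) (i : 'I_d) :
  `|x ord0 i| <= `|x|.
Proof.
rewrite [leRHS]/Num.norm /= mx_normrE.
by apply/bigmax_geP; right => /=; exists (ord0, i).
Qed.

Section domain_measure.
Context (R : realType) (d : nat) (Omega : lipschitz_domain R d).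

Lemma lebesgue_domain_lty : (lebesgue_rV R d (Omega : set _) < +oo)%E.
Proof.
have [M [Mr OM]] := domain_bounded Omega.
have M1 : M < `|M| + 1 by rewrite (le_lt_trans (ler_norm M))// ltrDl.
have h0 : 0 < `|M| + 2 by rewrite ltr_wpDl.
apply: (@le_lt_trans _ _ (lebesgue_rV R d [set y | close (`|M| + 2) 0 y])).
  apply: le_measure; rewrite ?inE.
  - exact: measurable_domain.
  - exact: measurable_close.
  - move=> y /(OM _ M1) /= yM; apply/forallP => i.
    rewrite mxE sub0r normrN (@le_lt_trans _ _ (`|M| + 1))//; last lra.
    by apply: le_trans yM; exact: ler_coord_norm.
by rewrite lebesgue_close// ltry.
Qed.


(* A copy of [vol Omega] that can carry the structure of a finite measure. *)
Definition volf : set 'rV[R]_d -> \bar R := vol Omega.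

HB.instance Definition _ := Measure.copy volf (vol Omega).

Let volf_fin : fin_num_fun volf.
Proof.
apply: lty_fin_num_fun.
have : (lebesgue_rV R d (setT `&` (Omega : set _)) < +oo)%E.
  by rewrite setTI lebesgue_domain_lty.
by [].
Qed.

HB.instance Definition _ := Measure_isFinite.Build _ _ _ volf volf_fin.

Lemma volE (A : set 'rV[R]_d) :
  vol Omega A = lebesgue_rV R d (A `&` (Omega : set 'rV[R]_d)).
Proof. by []. Qed.

Lemma vol_lty : (vol Omega setT < +oo)%E.
Proof. by rewrite volE setTI; exact: lebesgue_domain_lty. Qed.

Lemma vol_le (A : set 'rV[R]_d) : measurable A -> (vol Omega A <= lebesgue_rV R d A)%E.
Proof.
move=> mA; rewrite volE; apply: le_measure; rewrite ?inE//.
by apply: measurableI => //; exact: measurable_domain.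
Qed.

Lemma ae_domain : {ae vol Omega, forall x, (Omega : set 'rV[R]_d) x}.
Proof.
exists (~` (Omega : set 'rV[R]_d)); split => //.
- by apply: measurableC; exact: measurable_domain.
- by rewrite volE setICl measure0.
Qed.

Lemma integral_vol (F : 'rV[R]_d -> \bar R) : measurable_fun setT F ->
  (forall x, 0 <= F x)%E ->
  (\int[vol Omega]_x F x = \int[lebesgue_rV R d]_(x in (Omega : set 'rV[R]_d)) F x)%E.
Proof.
move=> mF F0.
rewrite (ge0_negligible_integral (D := setT) (N := ~` (Omega : set 'rV[R]_d)))//; last 2 first.
- by apply: measurableC; exact: measurable_domain.
- by rewrite volE setICl measure0.
rewrite setTD setCK; apply: eq_measure_integral => A mA AO.
by rewrite volE setIidl.
Qed.

Lemma integral_vol_le (F : 'rV[R]_d -> \bar R) : measurable_fun setT F ->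
  (forall x, 0 <= F x)%E ->
  (\int[vol Omega]_x F x <= \int[lebesgue_rV R d]_x F x)%E.
Proof.
move=> mF F0; rewrite integral_vol//; apply: ge0_subset_integral => //.
exact: measurable_domain.
Qed.

End domain_measure.

(** * Compactness in measure from a vanishing local oscillation *)

Section double_integral.
Context d (T : measurableType d) (R : realType).
Variable mu : {sigma_finite_measure set T -> \bar R}.

(** Iterated and not over the product, to agree with [gagliardo] by computation; Tonelli's theorem,
    in [dintE], gives access to the product measure. *)
Definition dint (F : T -> T -> R) : \bar R :=
  (\int[mu]_x \int[mu]_y (F x y)%:E)%E.

Definition measurable2 (F : T -> T -> R) :=
  measurable_fun setT (fun z : T * T => F z.1 z.2).

Lemma measurable2_EFin F : measurable2 F ->
  measurable_fun setT (fun z : T * T => (F z.1 z.2)%:E).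
Proof. by move=> mF; apply/measurable_EFinP. Qed.

Lemma dintE F : measurable2 F -> (forall x y, 0 <= F x y) ->
  dint F = (\int[mu \x mu]_z (F z.1 z.2)%:E)%E.
Proof.
move=> mF F0; rewrite (fubini_tonelli1 (fun z => (F z.1 z.2)%:E) (measurable2_EFin mF))//.
by move=> z; rewrite lee_fin.
Qed.

Lemma dintC F : measurable2 F -> (forall x y, 0 <= F x y) ->
  dint F = dint (fun x y => F y x).
Proof.
move=> mF F0; rewrite dintE// (fubini_tonelli2 (fun z => (F z.1 z.2)%:E) (measurable2_EFin mF))//.
by move=> z; rewrite lee_fin.
Qed.

Lemma dint_ge0 F : (forall x y, 0 <= F x y) -> (0 <= dint F)%E.
Proof.
move=> F0; apply: integral_ge0 => x _; apply: integral_ge0 => y _.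
by rewrite lee_fin.
Qed.

Lemma dint_le F G : measurable2 F -> measurable2 G ->
  (forall x y, 0 <= F x y <= G x y) -> (dint F <= dint G)%E.
Proof.
move=> mF mG FG; rewrite !dintE//; last 2 first.
- by move=> x y; have /andP[/le_trans h /h] := FG x y.
- by move=> x y; have /andP[] := FG x y.
exact: ge0_le_int.
Qed.

Lemma dintD F G : measurable2 F -> measurable2 G ->
  (forall x y, 0 <= F x y) -> (forall x y, 0 <= G x y) ->
  dint (fun x y => F x y + G x y) = (dint F + dint G)%E.
Proof.
move=> mF mG F0 G0; rewrite !dintE//; last 2 first.
- exact: measurable_funD.
- by move=> x y; rewrite addr_ge0.
exact: ge0_intD.
Qed.

Lemma dintZ F k : 0 <= k -> measurable2 F -> (forall x y, 0 <= F x y) ->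
  dint (fun x y => k * F x y) = (k%:E * dint F)%E.
Proof.
move=> k0 mF F0; rewrite !dintE//; last 2 first.
- exact: measurable_funM.
- by move=> x y; rewrite mulr_ge0.
exact: ge0_intZ.
Qed.

Lemma dint_lin F G k l : 0 <= k -> 0 <= l -> measurable2 F -> measurable2 G ->
  (forall x y, 0 <= F x y) -> (forall x y, 0 <= G x y) ->
  dint (fun x y => k * F x y + l * G x y) = (k%:E * dint F + l%:E * dint G)%E.
Proof.
move=> k0 l0 mF mG F0 G0; rewrite dintD ?dintZ//.
- exact: measurable_funM.
- exact: measurable_funM.
- by move=> x y; rewrite mulr_ge0.
- by move=> x y; rewrite mulr_ge0.
Qed.

Lemma dint_le_lin F G H k l : 0 <= k -> 0 <= l ->
  measurable2 F -> measurable2 G -> measurable2 H ->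
  (forall x y, 0 <= F x y) -> (forall x y, 0 <= G x y) -> (forall x y, 0 <= H x y) ->
  (forall x y, F x y <= k * G x y + l * H x y) ->
  (dint F <= k%:E * dint G + l%:E * dint H)%E.
Proof.
move=> k0 l0 mF mG mH F0 G0 H0 FGH; rewrite -dint_lin//; apply: dint_le => //.
  by apply: measurable_funD; exact: measurable_funM.
by move=> x y; rewrite F0 FGH.
Qed.

Lemma measurable2_fst (w : T -> R) : measurable_fun setT w ->
  measurable2 (fun x _ => w x).
Proof. by move=> mw; exact: (measurableT_comp mw measurable_fst). Qed.

Lemma measurable2_snd (w : T -> R) : measurable_fun setT w ->
  measurable2 (fun _ y => w y).
Proof. by move=> mw; exact: (measurableT_comp mw measurable_snd). Qed.

Lemma measurable2_inner F x : measurable2 F -> measurable_fun setT (F x).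
Proof. by move=> mF; exact: (measurableT_comp mF (@measurable_pair1 _ _ _ _ x)). Qed.

Lemma measurable_inner_int F : measurable2 F -> (forall x y, 0 <= F x y) ->
  measurable_fun setT (fun x => \int[mu]_y (F x y)%:E)%E.
Proof.
move=> mF F0.
apply: (@measurable_fun_fubini_tonelli_F _ _ _ _ _ mu _ (measurable2_EFin mF)).
by move=> z; rewrite lee_fin.
Qed.

End double_integral.

(** * The local oscillation and its bounds *)

Section oscillation.
Context (R : realType) (d : nat).
Variable mu : {sigma_finite_measure set 'rV[R]_d -> \bar R}.
Hypothesis mu_close : forall e (x : 'rV[R]_d), 0 < e ->
  (mu [set y | close e x y] <= ((2 * e) ^+ d)%:E)%E.
Implicit Types (u v w : 'rV[R]_d -> R).

(** Not divided by the volume of the cubes: compactness asks that it be small compared with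
    [(2e)^d], uniformly along the sequence. *)
Definition Dq (e : R) w : \bar R :=
  dint mu (fun x y => (close e x y)%:R * (w x - w y) ^+ 2).

Lemma measurable2_close e : measurable2 (fun x y : 'rV[R]_d => (close e x y)%:R : R).
Proof.
rewrite /measurable2 (_ : (fun z => _) = (fun z : 'rV[R]_d * 'rV[R]_d =>
  if close e z.1 z.2 then 1 else 0)); last by apply/funext => z; case: close.
by apply: measurable_fun_ifT => //; exact: measurable_fun_close.
Qed.

Lemma measurable2_diff w : measurable_fun setT w ->
  measurable2 (fun x y => w x - w y).
Proof.
by move=> mw; apply: measurable_funB; [exact: measurable2_fst|exact: measurable2_snd].
Qed.

Lemma measurable2_Dq e w : measurable_fun setT w ->
  measurable2 (fun x y => (close e x y)%:R * (w x - w y) ^+ 2).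
Proof.
move=> mw; apply: measurable_funM; first exact: measurable2_close.
by apply: measurable_funX; exact: measurable2_diff.
Qed.

Lemma Dq_ge0 e w x y : 0 <= (close e x y)%:R * (w x - w y) ^+ 2.
Proof. by rewrite mulr_ge0// sqr_ge0. Qed.

Lemma DqD e u v : measurable_fun setT u -> measurable_fun setT v ->
  (Dq e (fun x => u x + v x)%R <= 2%:E * Dq e u + 2%:E * Dq e v)%E.
Proof.
move=> mu_ mv; have mX w := @measurable2_Dq e w; have X0 := @Dq_ge0 e.
have mu2 := mX u mu_; have mv2 := mX v mv.
have mD := mX (fun x => u x + v x) (measurable_funD mu_ mv).
have n2 : 0 <= 2 :> R by [].
apply: (dint_le_lin mu n2 n2 mD mu2 mv2
  (X0 (fun x => u x + v x)) (X0 u) (X0 v)) => x y.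
case: close; rewrite ?mul0r ?mulr0 ?addr0// !mul1r.
by have := sqr_ge0 ((u x - u y) - (v x - v y)); nra.
Qed.

(** No gain over [e^d]: this bound is meant for remainders that are small in L^2 without being
    smooth. *)
Lemma Dq_L2 e w : 0 < e -> measurable_fun setT w ->
  (Dq e w <= (4 * (2 * e) ^+ d)%:E * sqint mu w)%E.
Proof.
move=> e0 mw.
pose F x y : R := (close e x y)%:R * w x ^+ 2.
have mF : measurable2 F.
  apply: measurable_funM; first exact: measurable2_close.
  by apply: measurable_funX; exact: measurable2_fst.
have F0 x y : 0 <= F x y by rewrite mulr_ge0// sqr_ge0.
have mF' : measurable2 (fun x y => F y x).
  rewrite /F; apply: measurable_funM.
    rewrite (_ : (fun z => _) = (fun z : 'rV[R]_d * 'rV[R]_d => (close e z.1 z.2)%:R)).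
      exact: measurable2_close.
    by apply/funext => z; rewrite closeC.
  by apply: measurable_funX; exact: measurable2_snd.
have FE : (dint mu F <= ((2 * e) ^+ d)%:E * sqint mu w)%E.
  rewrite /sqint -ge0_intZ; last 3 first.
  - by rewrite exprn_ge0// mulr_ge0// ltW.
  - by move=> x; exact: sqr_ge0.
  - exact: measurable_funX.
  apply: ge0_le_integral => //.
  - by move=> x _; apply: integral_ge0 => y _; rewrite lee_fin.
  - exact: measurable_inner_int.
  - by apply/measurable_EFinP; apply: measurable_funM => //; exact: measurable_funX.
  move=> x _.
  under eq_integral do rewrite /F mulrC.
  rewrite ge0_intZ ?sqr_ge0//; last exact: measurable2_inner (measurable2_close e).
  rewrite [((2 * e) ^+ d * _)%R]mulrC [leRHS]EFinM lee_wpmul2l ?lee_fin ?sqr_ge0//.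
  rewrite (_ : (fun y => _) = (fun y => (\1_[set y | close e x y] y)%:E)); last first.
    apply/funext => y; rewrite indicE; congr ((nat_of_bool _)%:R%:E).
    by apply/idP/idP => [h|/set_mem//]; exact: mem_set.
  by rewrite integral_indic ?setIT//; [exact: mu_close|exact: measurable_close].
apply: (@le_trans _ _ (2%:E * dint mu F + 2%:E * dint mu F)%E).
  (* From [(a - b)^2 <= 2 a^2 + 2 b^2]; by symmetry the terms in [w x] and in [w y] have the same
     integral. *)
  rewrite {2}(dintC mu mF F0).
  have n2 : 0 <= 2 :> R by [].
  apply: (dint_le_lin mu n2 n2 (measurable2_Dq e mw) mF mF' (Dq_ge0 e w) F0 (fun x y => F0 y x)) => x y.
  rewrite /F (closeC e y x).
  case: close; rewrite ?mul0r ?mulr0 ?addr0// !mul1r.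
  by have := sqr_ge0 (w x + w y); nra.
rewrite -ge0_muleDl// -EFinD EFinM -muleA.
rewrite (_ : 2 + 2 = 4); last ring.
by rewrite lee_wpmul2l.
Qed.

Lemma enorm_ge0 (x : 'rV[R]_d) : 0 <= enorm x.
Proof. exact: sqrtr_ge0. Qed.

Lemma enorm_eq0 (x : 'rV[R]_d) : enorm x = 0 -> x = 0.
Proof.
move=> /eqP; rewrite sqrtr_eq0 => h; apply/rowP => i; rewrite mxE.
have : x ord0 i ^+ 2 <= 0.
  apply: le_trans h; rewrite (bigD1 i)//= lerDl sumr_ge0// => j _.
  exact: sqr_ge0.
by rewrite le_eqVlt ltNge sqr_ge0 orbF sqrf_eq0 => /eqP.
Qed.

Lemma close_enorm e (x y : 'rV[R]_d) : 0 <= e -> close e x y ->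
  enorm (x - y) <= e * Num.sqrt d%:R.
Proof.
move=> e0 /forallP h; rewrite -[e in leRHS]ger0_norm// -sqrtr_sqr -sqrtrM ?sqr_ge0//.
apply: ler_wsqrtr.
apply: (@le_trans _ _ (\sum_(i < d) e ^+ 2)).
  apply: ler_sum => i _; rewrite !mxE -(real_normK (num_real (_ - _))).
  by rewrite ler_pXn2r ?nnegrE//; exact: ltW.
by rewrite sumr_const card_ord mulr_natr.
Qed.

Lemma measurable2_enorm : measurable2 (fun x y : 'rV[R]_d => enorm (x - y)).
Proof.
apply: (measurableT_comp (f := @Num.sqrt R)).
  by apply: continuous_measurable_fun; exact: sqrt_continuous.
apply: measurable_sum => i; apply: measurable_funX.
rewrite (_ : (fun z => _) = (fun z : 'rV[R]_d * 'rV[R]_d =>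
   rV_coord i z.1 - rV_coord i z.2)); last by apply/funext => z; rewrite !mxE.
apply: measurable_funB.
  exact: (measurableT_comp (@measurable_rV_coord R d i) measurable_fst).
exact: (measurableT_comp (@measurable_rV_coord R d i) measurable_snd).
Qed.

Definition gkern (s : R) w (x y : 'rV[R]_d) : R :=
  (w x - w y) * (w x - w y) / enorm (x - y) `^ (d%:R + 2 * s).

Lemma gkern_ge0 s w x y : 0 <= gkern s w x y.
Proof. by rewrite divr_ge0 ?powR_ge0// -expr2 sqr_ge0. Qed.

Lemma measurable2_gkern s w : measurable_fun setT w -> measurable2 (gkern s w).
Proof.
move=> mw; apply: measurable_funM.
  by apply: measurable_funM; exact: measurable2_diff.
rewrite (_ : (fun z => _) = (fun z : 'rV[R]_d * 'rV[R]_d =>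
  enorm (z.1 - z.2) `^ (- (d%:R + 2 * s)))); last first.
  by apply/funext => z; rewrite powRN.
exact: (measurableT_comp (measurable_powR _) measurable2_enorm).
Qed.

Lemma gagliardoE s w : gagliardo mu s w w = dint mu (gkern s w).
Proof. by []. Qed.

(** Within a cube [|x - y| <= e sqrt d], so the weight of the Gagliardo kernel is at least
    [(e sqrt d)^-(d + 2s)]. The gain over [e^d] is the factor [e^(2s)]. *)
Lemma Dq_gag e s w : 0 < e -> 0 < s -> measurable_fun setT w ->
  (Dq e w <= ((e * Num.sqrt d%:R) `^ (d%:R + 2 * s))%:E * gagliardo mu s w w)%E.
Proof.
move=> e0 s0 mw; rewrite gagliardoE.
rewrite -(dintZ mu (powR_ge0 _ _) (measurable2_gkern s mw) (gkern_ge0 s w)).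
apply: dint_le; first exact: measurable2_Dq.
  by apply: measurable_funM => //; exact: measurable2_gkern.
move=> x y; rewrite Dq_ge0 /=; have [xy|] := boolP (close e x y); last first.
  by move=> _; rewrite mul0r mulr_ge0 ?powR_ge0 ?gkern_ge0.
rewrite mul1r; have [->|nxy] := eqVneq x y.
  by rewrite subrr expr0n mulr_ge0 ?powR_ge0 ?gkern_ge0.
have n0 : 0 < enorm (x - y).
  rewrite lt_neqAle enorm_ge0 andbT eq_sym; apply: contra nxy => /eqP/enorm_eq0.
  by move/eqP; rewrite subr_eq0.
have p0 : 0 < d%:R + 2 * s by rewrite ltr_wpDl// mulr_gt0.
rewrite /gkern -expr2 mulrCA ler_peMr ?sqr_ge0//.
rewrite ler_pdivlMr ?powR_gt0// mul1r ge0_ler_powR ?nnegrE ?enorm_ge0//.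
- exact: ltW.
- by rewrite mulr_ge0 ?sqrtr_ge0// ltW.
- by apply: close_enorm => //; exact: ltW.
Qed.

End oscillation.

Lemma int_cvg0 d (T : measurableType d) (R : realType)
    (mu : {measure set T -> \bar R}) (f : nat -> T -> R) :
  (mu setT < +oo)%E -> (forall k, measurable_fun setT (f k)) ->
  (forall k x, 0 <= f k x <= 1) ->
  {ae mu, forall x, f k x @[k --> \oo] --> (0 : R)} ->
  forall e : R, 0 < e -> exists N, forall k, (N <= k)%N ->
    (\int[mu]_x (f k x)%:E <= e%:E)%E.
Proof.
move=> mu_fin mf f01 f0 e e0.
have [|||||_ _ h] := @dominated_convergence _ _ _ mu setT measurableT
    (fun k x => (f k x)%:E) (cst 0%E) (cst 1%E) _ _ _ _ _.
- by move=> k; exact/measurable_EFinP.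
- by [].
- apply: filterS f0 => x h _; apply: cvg_EFin => //; exact: nearW.
- apply/integrableP; split => //.
  rewrite (eq_integral (cst 1%E)); last by move=> x _; rewrite /= normr1.
  by rewrite integral_cst// mul1e.
- apply: aeW => x k _ /=; have /andP[? ?] := f01 k x.
  by rewrite lee_fin ger0_norm.
rewrite integral_cst// mul0e in h.
have I0 k : (0 <= \int[mu]_x (f k x)%:E)%E.
  by apply: integral_ge0 => x _; rewrite lee_fin; have /andP[] := f01 k x.
have Ifin k : (\int[mu]_x (f k x)%:E)%E \is a fin_num.
  rewrite ge0_fin_numE//; apply: le_lt_trans mu_fin.
  rewrite -[leRHS]mul1e -(integral_cst _ measurableT).
  exact: ge0_le_int.
have {}h : (fun k => fine (\int[mu]_x (f k x)%:E)%E) @ \oo --> (0 : R).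
  exact: fine_cvg h.
have /cvgn_epsP/(_ e e0)[N NP] := h.
exists N => k /NP; rewrite subr0 => /(le_trans (ler_norm _)) hk.
by rewrite -(fineK (Ifin k)) lee_fin.
Qed.

Lemma Lfun2_bounded d (T : measurableType d) (R : realType)
    (mu : {measure set T -> \bar R}) (f : T -> R) (M : R) :
  (mu setT < +oo)%E -> measurable_fun setT f -> (forall x, `|f x| <= M) ->
  f \in Lfun mu 2%:E.
Proof.
move=> mu_fin mf fM; apply/Lfun2P; split => //.
apply: (@le_lt_trans _ _ (\int[mu]_x (cst (M ^+ 2) x)%:E)%E).
  apply: ge0_le_int => // [x|]; last exact: measurable_funX.
  rewrite sqr_ge0 -(real_normK (num_real (f x))) ler_pXn2r ?nnegrE//=.
  by rewrite (le_trans _ (fM x)).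
rewrite [X in (X < _)%E](_ : _ = \int[mu]_x (cst (M ^+ 2)%:E x))%E//.
by rewrite integral_cst// lte_mul_pinfty// lee_fin sqr_ge0.
Qed.

Section ip_functional.
Context d (T : measurableType d) (R : realType).
Variable mu : {measure set T -> \bar R}.
Local Notation V := (LfunType mu (lee1n 2)).

Lemma ip_le (u v : T -> R) t : u \in Lfun mu 2%:E -> v \in Lfun mu 2%:E -> 0 < t ->
  `|ip mu u v| <= t * ip mu u u + ip mu v v / t.
Proof.
move=> uL vL t0.
exact: (@form_le R V (fun v w => ip mu v w) (fun v w => ipC mu v w)
  (fun v w z => ipDl (LfunP v) (LfunP w) (LfunP z))
  (fun a v w => ipZl _ (LfunP v) (LfunP w)) (fun v => ip_ge0 mu v)
  (Lfun_Sub (lee1n 2) uL) (Lfun_Sub (lee1n 2) vL) t t0).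
Qed.

Lemma ip_para (u v : T -> R) : u \in Lfun mu 2%:E -> v \in Lfun mu 2%:E ->
  ip mu (fun x => u x - v x) (fun x => u x - v x) =
  2 * ip mu u u + 2 * ip mu v v - 4 * ip mu (fun x => 2^-1 * (u x + v x))
    (fun x => 2^-1 * (u x + v x)).
Proof.
move=> uL vL.
exact: (@form_vmid R V (fun v w => ip mu v w) (fun v w => ipC mu v w)
  (fun v w z => ipDl (LfunP v) (LfunP w) (LfunP z))
  (fun a v w => ipZl _ (LfunP v) (LfunP w))
  (Lfun_Sub (lee1n 2) uL) (Lfun_Sub (lee1n 2) vL)).
Qed.

Variables (h : T -> R) (hL : h \in Lfun mu 2%:E).

Definition ip_with (v : V) : R := ip mu v h.

Lemma ip_with_linear : linear_for *%R ip_with.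
Proof.
move=> a u v; rewrite /ip_with -(ipZl a (LfunP u) hL) -(ipDl (Lfun2Z a (LfunP u)) (LfunP v) hL).
by [].
Qed.

HB.instance Definition _ := GRing.isLinear.Build R V R *%R ip_with ip_with_linear.

(** Taking [t = 1 / |v|] in [ip_le] gives the constant [1 + ip h h]. *)
Lemma ip_with_bounded : bounded_functional
  (fun v : V => fine ('N[mu]_2%:E [EFin \o v])%E) ip_with.
Proof.
exists (1 + ip mu h h) => v; rewrite Lfun2_norm /ip_with.
have hh := ip_ge0 mu h; have vv := ip_ge0 mu v.
have [v0|v0] := eqVneq (Num.sqrt (ip mu v v)) 0.
  rewrite v0 mulr0; apply/ler_addgt0Pl => e e0; rewrite addr0.
  (* When the seminorm of [v] is zero, only the term [ip h h / t] is left, and a large [t] makes it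
     smaller than any [e]. *)
  have t0 : 0 < (1 + ip mu h h) / e by rewrite divr_gt0// ltr_pwDl.
  apply: le_trans (ip_le (LfunP v) hL t0) _.
  have -> : ip mu v v = 0.
    by apply/eqP; rewrite eq_le vv andbT -sqrtr_eq0 v0.
  rewrite mulr0 add0r invf_div mulrA ler_pdivrMr; last by rewrite ltr_pwDl.
  by rewrite mulrDr mulr1 mulrC lerDr ltW.
have n0 : 0 < Num.sqrt (ip mu v v) by rewrite lt_neqAle eq_sym v0 sqrtr_ge0.
have t0 : 0 < (Num.sqrt (ip mu v v))^-1 by rewrite invr_gt0.
apply: le_trans (ip_le (LfunP v) hL t0) _.
rewrite -[X in _ * X + _](sqr_sqrtr vv) expr2 mulrA mulVf// mul1r invrK.
by rewrite mulrDl mul1r.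
Qed.

End ip_functional.

(** * Almost everywhere convergence from averages over cubes *)

Section compactness.
Context (R : realType) (d : nat).
Variable mu : {finite_measure set 'rV[R]_d -> \bar R}.
Hypothesis mu_close : forall e (x : 'rV[R]_d), 0 < e ->
  (mu [set y | close e x y] <= ((2 * e) ^+ d)%:E)%E.
Hypothesis mu_close_ae : {ae mu, forall x, exists2 e0, 0 < e0 & forall e,
  0 < e < e0 -> mu [set y | close e x y] = ((2 * e) ^+ d)%:E}.

Let mu_fin : (mu setT < +oo)%E.
Proof. by rewrite -ge0_fin_numE// fin_num_measure. Qed.

Let kx e (x : 'rV[R]_d) := fun y => (close e x y)%:R : R.

Let mkx e x : measurable_fun setT (kx e x).
Proof. exact: (measurable2_inner (F := fun x y => (close e x y)%:R) x (measurable2_close e)). Qed.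

Let kx_int e x : (\int[mu]_y (kx e x y)%:E)%E = mu [set y | close e x y].
Proof.
rewrite /kx (_ : (fun y => _) = (fun y => (\1_[set y | close e x y] y)%:E)); last first.
  apply/funext => y; rewrite indicE; congr ((nat_of_bool _)%:R%:E).
  by apply/idP/idP => [h|/set_mem//]; exact: mem_set.
by rewrite integral_indic ?setIT//; exact: measurable_close.
Qed.

Let kxL e x : kx e x \in Lfun mu 2%:E.
Proof.
apply: (Lfun2_bounded (M := 1)) => // y.
by rewrite /kx; case: close; rewrite ?normr0 ?normr1.
Qed.

Let avg e f x := ip mu f (kx e x).

Let mavg e f : f \in Lfun mu 2%:E -> measurable_fun setT (avg e f).
Proof.
move=> fL; have mf := Lfun2_measurable fL.
have mF : measurable2 (fun x y => f y * kx e x y).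
  by apply: measurable_funM; [exact: measurable2_snd|exact: measurable2_close].
have mfine : measurable_fun setT (@fine R) by exact: fine_measurable.
apply: (measurableT_comp (f := @fine R)
  (g := fubini_F mu (fun z => (f z.2 * kx e z.1 z.2)%:E))) => //.
apply: (@measurable_fubini_F _ _ _ _ _ mu mu (fun z => (f z.2 * kx e z.1 z.2)%:E)).
apply/integrable12ltyP; first exact/measurable_EFinP.
have f1 : (\int[mu]_y (`|f y|)%:E < +oo)%E.
  have /Lfun_subset12 := fL; rewrite fin_num_measure// => /(_ isT).
  by move=> /Lfun1_integrable/integrableP[].
apply: (@le_lt_trans _ _ (\int[mu]_x (\int[mu]_y (`|f y|)%:E))%E); last first.
  by rewrite integral_cst// lte_mul_pinfty// ?integral_ge0// ge0_fin_numE ?integral_ge0.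
apply: ge0_le_integral => //.
- by move=> x _; apply: integral_ge0 => y _; exact: abse_ge0.
- apply: (@measurable_inner_int _ _ _ mu (fun x y => `|f y * kx e x y|)).
    exact: measurableT_comp mF.
  by [].
move=> x _; apply: ge0_le_int => [y||].
- by rewrite normr_ge0 normrM /kx /=; case: close; rewrite ?normr1 ?normr0 ?mulr1 ?mulr0.
- apply: (measurableT_comp (f := @Num.norm R R)) => //=.
  by apply: measurable_funM => //; exact: mkx.
- exact: measurableT_comp.
Qed.

Let osc e f x := (\int[mu]_y (kx e x y * (f x - f y) ^+ 2)%:E)%E.

Let osc_ge0 e f x : (0 <= osc e f x)%E.
Proof. by apply: integral_ge0 => y _; rewrite lee_fin mulr_ge0// sqr_ge0. Qed.

Let mosc e f : measurable_fun setT f -> measurable_fun setT (osc e f).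
Proof.
move=> mf; apply: (@measurable_inner_int _ _ _ mu
  (fun x y => kx e x y * (f x - f y) ^+ 2)) => [|x y].
  exact: measurable2_Dq.
by rewrite mulr_ge0// sqr_ge0.
Qed.

(** The difference is the average of [f x - f y] over the cube, because the cube has full measure
    [(2e)^d]; then [|z| <= t + z^2 / t] brings in the squared oscillation. *)
Let avg_dist e f x t : 0 < e -> 0 < t -> f \in Lfun mu 2%:E ->
  mu [set y | close e x y] = ((2 * e) ^+ d)%:E ->
  ((`|f x - avg e f x / (2 * e) ^+ d|)%:E <=
    t%:E + ((t * (2 * e) ^+ d)^-1)%:E * osc e f x)%E.
Proof.
move=> e0 t0 fL muE; set m := (2 * e) ^+ d.
have m0 : 0 < m by rewrite /m exprn_gt0// mulr_gt0.
have mf := Lfun2_measurable fL.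
have cL : cst (f x) \in Lfun mu 2%:E.
  exact: (Lfun2_bounded (M := `|f x|)).
have dL := Lfun2B cL fL.
have E : m * f x - avg e f x = ip mu (fun y => f x - f y) (kx e x).
  have := ipDl dL fL (kxL e x).
  rewrite (_ : (fun y => cst (f x) y - f y + f y) = (fun y => f x * 1)); last first.
    by apply/funext => y /=; rewrite subrK mulr1.
  have c1L : cst 1 \in Lfun mu 2%:E.
    by apply: (Lfun2_bounded (M := 1)) => // y; rewrite normr1.
  have /= -> := ipZl (f x) c1L (kxL e x).
  have -> : ip mu (fun=> 1) (kx e x) = m.
    rewrite /ip /Rintegral (eq_integral (fun y => (kx e x y)%:E)).
      by rewrite kx_int muE.
    by move=> y _; rewrite mul1r.
  by move=> h; rewrite mulrC h addrK.
have -> : f x - avg e f x / m = (m * f x - avg e f x) / m.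
  by rewrite mulrBl mulrAC divff ?gt_eqF// mul1r.
rewrite normrM (gtr0_norm (x := m^-1)) ?invr_gt0// E.
have h1 : ((`|ip mu (fun y => f x - f y) (kx e x)|)%:E <=
    (t * m)%:E + (t^-1)%:E * osc e f x)%E.
  apply: (@le_trans _ _ (\int[mu]_y (`|(f x - f y) * kx e x y|)%:E)%E).
    rewrite -[leRHS]fineK; last first.
      have /integrableP[_ h] := Lfun2_mul_integrable dL (kxL e x).
      by rewrite ge0_fin_numE ?integral_ge0.
    rewrite lee_fin; apply: le_normr_Rintegral => //.
    exact: Lfun2_mul_integrable dL (kxL e x).
  have mk2 : measurable_fun setT (fun y => kx e x y * (f x - f y) ^+ 2).
    apply: measurable_funM => //; apply: measurable_funX; exact: measurable_funB.
  have k0 y : 0 <= kx e x y * (f x - f y) ^+ 2 by rewrite mulr_ge0// sqr_ge0.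
  have -> : (t * m)%:E = (\int[mu]_y (t * kx e x y)%:E)%E.
    rewrite ge0_intZ//; first by rewrite kx_int muE EFinM.
    exact: ltW.
  rewrite /osc -ge0_intZ ?invr_ge0 ?(ltW t0)// -ge0_intD//; last 4 first.
  - by move=> y; rewrite mulr_ge0// ltW.
  - by move=> y; rewrite mulr_ge0 ?invr_ge0 ?(ltW t0).
  - exact: measurable_funM.
  - exact: measurable_funM.
  apply: ge0_le_int => [y||].
  - rewrite normr_ge0 normrM /kx /=; case: close; rewrite ?normr1 ?normr0 ?mulr1 ?mulr0 ?mul0r ?mulr0 ?addr0// mul1r.
    set z := f x - f y; rewrite -(real_normK (num_real z)).
    rewrite -(ler_pM2l t0) mulrDr mulrA divff ?gt_eqF// mul1r.
    have := sqr_ge0 (t - `|z|); have := normr_ge0 z; nra.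
  - apply: (measurableT_comp (f := @Num.norm R R)) => //=.
    apply: measurable_funM => //; exact: measurable_funB.
  - by apply: measurable_funD; exact: measurable_funM.
rewrite EFinM muleC.
apply: (@le_trans _ _ (m^-1%:E * ((t * m)%:E + t^-1%:E * osc e f x))%E).
  by rewrite lee_wpmul2l// lee_fin invr_ge0 ltW.
rewrite ge0_muleDr; last 2 first.
- by rewrite lee_fin mulr_ge0 ?(ltW t0) ?(ltW m0).
- by rewrite mule_ge0 ?osc_ge0// lee_fin invr_ge0 ltW.
rewrite muleA -!EFinM mulrCA mulVf ?gt_eqF// mulr1.
by rewrite (mulrC m^-1 t^-1) -invfM.
Qed.

(** Elsewhere the cube lacks part of its volume, and the average, normalized by [(2e)^d], cannot be
    compared with the value at [x]. *)
Let good e : set 'rV[R]_d := [set x | mu [set y | close e x y] = ((2 * e) ^+ d)%:E].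

Let mgood e : measurable (good e).
Proof.
rewrite /good.
have m1 : measurable_fun setT (fun x => mu [set y | close e x y]).
  rewrite (_ : (fun x => _) = (fun x => \int[mu]_y (kx e x y)%:E)%E).
    by apply: (@measurable_inner_int _ _ _ mu (kx e)) => //; exact: measurable2_close.
  by apply/funext => x; rewrite kx_int.
have := m1 measurableT [set ((2 * e) ^+ d)%:E] (emeasurable_set1 _).
by rewrite setTI.
Qed.

Let bad n x : R := \1_(~` good n.+1%:R^-1) x.

Let bad_cvg (eta : R) : 0 < eta -> exists N, forall n, (N <= n)%N ->
  (\int[mu]_x (bad n x)%:E <= eta%:E)%E.
Proof.
apply: int_cvg0 => //.
- by move=> k; apply: measurable_indic; exact: measurableC (mgood _).
- by move=> k x; rewrite /bad indicE; case: (_ \in _); rewrite ?lexx ler01.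
apply: filterS mu_close_ae => x [e0 e00 h]; apply/cvgn_epsP => e ee.
have [N _ NP] := near_infty_natSinv_lt (PosNum e00).
exists N => n Nn; rewrite /bad indicE memNset ?subrr ?normr0 ?ltW//.
apply; apply: h; rewrite invr_gt0 ltr0n /=; exact: NP.
Qed.

(** The sequence is Cauchy in measure: each function is close to its averages by the oscillation
    bound, and the averages converge pointwise to those of the weak limit [l], since averaging at
    [x] is an inner product with the indicator of a cube. *)
Lemma compact_in_measure (w : nat -> 'rV[R]_d -> R) (M : R) :
  (forall k, w k \in Lfun mu 2%:E) -> (forall k, ip mu (w k) (w k) <= M) ->
  (forall c : R, 0 < c -> exists2 e0, 0 < e0 & forall e, 0 < e < e0 ->
    forall k, (Dq mu e (w k) <= ((2 * e) ^+ d * c)%:E)%E) ->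
  exists2 phi, incr phi & exists2 g, measurable_fun setT g &
    {ae mu, forall x, w (phi k) x @[k --> \oo] --> (g x : R)}.
Proof.
move=> wL wM wD.
have [psi hpsi [l [wl _]]] := @L2_weak_subseq _ _ _ mu mu_fin
  (fun k => Lfun_Sub (lee1n 2) (wL k)) M wM.
have lL := LfunP l.
pose v k := w (psi k).
have vL k : v k \in Lfun mu 2%:E by exact: wL.
have mv k := Lfun2_measurable (vL k).
suff [phi hphi [g mg h]] : exists2 phi, incr phi & exists2 g, measurable_fun setT g &
    {ae mu, forall x, v (phi k) x @[k --> \oo] --> (g x : R)}.
  by exists (psi \o phi); [exact: incr_comp|exists g].
apply: ae_subseq => // eta eta0.
have avg_cvg e x : avg e (v k) x @[k --> \oo] --> (avg e l x : R).
  have h := wl _ (ip_with_bounded (kxL e x)).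
  exact h.
pose M0 := fine (mu setT) + 1.
have muE : mu setT = (fine (mu setT))%:E by rewrite fineK// fin_num_measure.
have M00 : 0 < M0 by rewrite /M0 ltr_wpDl// fine_ge0.
(* The budget is [eta/5] for the bad points, [eta/10] for each of the two averages, [eta/5] for the
   constant [2 t], and [eta/5] for each of the two oscillations. *)
pose t := eta / 10 / M0; have t0 : 0 < t by rewrite /t !divr_gt0.
have c0 : 0 < t * (eta / 5) by rewrite mulr_gt0// divr_gt0.
have [e0 e00 eD] := wD _ c0.
have [N1 N1P] := bad_cvg (divr_gt0 eta0 (ltr0Sn R 4)).
have [N2 _ N2P] := near_infty_natSinv_lt (PosNum e00).
pose n := maxn N1 N2; pose e : R := n.+1%:R^-1.
have ee : 0 < e < e0.
  by rewrite /e invr_gt0 ltr0n /=; apply: (N2P n); exact: leq_maxr.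
have /andP[e_gt0 _] := ee.
pose m := (2 * e) ^+ d.
have m0 : 0 < m by rewrite /m exprn_gt0// mulr_gt0.
(* Truncated at 1, so that dominated convergence applies without any bound on the averages. *)
pose a k x := Num.min 1 `|(avg e (v k) x - avg e l x) / m|.
have ma k : measurable_fun setT (a k).
  apply: measurable_minr => //; apply: (measurableT_comp (f := @Num.norm R R)) => //.
  by apply: measurable_funM => //; apply: measurable_funB; exact: mavg.
have a01 k x : 0 <= a k x <= 1.
  by rewrite /a le_min ler01 normr_ge0 ge_min lexx.
have [N3 N3P] : exists N, forall k, (N <= k)%N ->
    (\int[mu]_x (a k x)%:E <= (eta / 10)%:E)%E.
  apply: int_cvg0 => //; last by rewrite divr_gt0.
  apply: aeW => x; apply/cvgn_epsP => z z0.
  have /cvgn_epsP/(_ (z * m) (mulr_gt0 z0 m0))[N NP] := avg_cvg e x.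
  exists N => k /NP h; rewrite subr0 ger0_norm; last by case/andP: (a01 k x).
  rewrite /a ge_min; apply/orP; right.
  by rewrite normrM (gtr0_norm (x := m^-1)) ?invr_gt0// ler_pdivrMr.
exists N3 => i j Ni Nj.
pose c := (t * m)^-1.
have c_ge0 : 0 <= c by rewrite invr_ge0 mulr_ge0// ltW.
pose h1 x : R := bad n x + (a i x + a j x) + 2 * t.
have h10 x : 0 <= h1 x.
  have /andP[? _] := a01 i x; have /andP[? _] := a01 j x.
  by rewrite /h1 !addr_ge0// mulr_ge0// ltW.
have mbad : measurable_fun setT (bad n).
  by apply: measurable_indic; exact: measurableC.
have mh1 : measurable_fun setT h1.
  by do 2 apply: measurable_funD => //; exact: measurable_funD.
(* Where the point is bad or a truncation is active, [h1] alone is at least 1; elsewhere this is the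
   triangle inequality through both averages and the average of [l]. *)
have pw x : ((Num.min 1 `|v i x - v j x|)%:E <=
    (h1 x)%:E + (c%:E * osc e (v i) x + c%:E * osc e (v j) x))%E.
  have rest0 : (0 <= c%:E * osc e (v i) x + c%:E * osc e (v j) x)%E.
    by rewrite adde_ge0// mule_ge0.
  have [gx|ngx] := pselect (good e x); last first.
    rewrite -[leLHS]adde0 leeD// lee_fin ge_min; apply/orP; left.
    have /andP[? _] := a01 i x; have /andP[? _] := a01 j x.
    rewrite /h1 /bad indicE mem_set//=; have := ltW t0; lra.
  have di := avg_dist e_gt0 t0 (vL i) gx; have dj := avg_dist e_gt0 t0 (vL j) gx.
  rewrite -/m -/c in di dj.
  set Oi := (c%:E * _)%E in di *; set Oj := (c%:E * osc e (v j) x)%E in dj *.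
  have Oi0 : (0 <= Oi)%E by rewrite mule_ge0.
  have Oj0 : (0 <= Oj)%E by rewrite mule_ge0.
  move: di dj Oi0 Oj0; case: Oi => [oi||] //; case: Oj => [oj||] // di dj oi0 oj0;
    [|by rewrite /= leey..].
  move: di dj oi0 oj0; rewrite -!EFinD !lee_fin => di dj oi0 oj0.
  have b0 : 0 <= bad n x by rewrite /bad.
  have /andP[ai0 _] := a01 i x; have /andP[aj0 _] := a01 j x.
  rewrite /h1; have [ai1|ai1] := leP 1 `|(avg e (v i) x - avg e l x) / m|.
    have : a i x = 1 by rewrite /a; exact/min_idPl.
    move=> ->; rewrite ge_min; apply/orP; left; have := ltW t0; lra.
  have aiE : a i x = `|(avg e (v i) x - avg e l x) / m|.
    by rewrite /a; apply/min_idPr; exact: ltW.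
  have [aj1|aj1] := leP 1 `|(avg e (v j) x - avg e l x) / m|.
    have : a j x = 1 by rewrite /a; exact/min_idPl.
    move=> ->; rewrite ge_min; apply/orP; left; have := ltW t0; lra.
  have ajE : a j x = `|(avg e (v j) x - avg e l x) / m|.
    by rewrite /a; apply/min_idPr; exact: ltW.
  rewrite ge_min; apply/orP; right.
  have -> : v i x - v j x = (v i x - avg e (v i) x / m) + (avg e (v i) x - avg e l x) / m
     - ((v j x - avg e (v j) x / m) + (avg e (v j) x - avg e l x) / m).
    by rewrite !mulrBl; ring.
  apply: le_trans (ler_normB _ _) _.
  have := ler_normD (v i x - avg e (v i) x / m) ((avg e (v i) x - avg e l x) / m).
  have := ler_normD (v j x - avg e (v j) x / m) ((avg e (v j) x - avg e l x) / m).
  rewrite -aiE -ajE; lra.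
have mO k : measurable_fun setT (fun x => c%:E * osc e (v k) x)%E.
  by apply: measurable_funeM; exact: mosc.
apply: (@le_trans _ _ (\int[mu]_x ((h1 x)%:E + (c%:E * osc e (v i) x + c%:E * osc e (v j) x)))%E).
  apply: ge0_le_integral => //.
  - apply/measurable_EFinP; apply: measurable_minr => //.
    by apply: (measurableT_comp (f := @Num.norm R R)) => //; exact: measurable_funB.
  - by apply: emeasurable_funD; [exact/measurable_EFinP|exact: emeasurable_funD].
have O0 k x : (0 <= c%:E * osc e (v k) x)%E by rewrite mule_ge0.
rewrite ge0_integralD//; last 4 first.
- by move=> x _; rewrite lee_fin.
- exact/measurable_EFinP.
- by move=> x _; rewrite adde_ge0.
- exact: emeasurable_funD.
rewrite ge0_integralD// !ge0_integralZl_EFin//; last 2 first.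
- exact: mosc.
- exact: mosc.
have OD k : (c%:E * \int[mu]_x osc e (v k) x <= (eta / 5)%:E)%E.
  apply: (@le_trans _ _ (c%:E * (m * (t * (eta / 5)))%:E)%E).
    by rewrite lee_wpmul2l//; exact: (eD e ee (psi k)).
  rewrite -EFinM lee_fin /c (_ : m * (t * (eta / 5)) = t * m * (eta / 5)); last ring.
  by rewrite mulKf// gt_eqF// mulr_gt0.
have H1 : (\int[mu]_x (h1 x)%:E <= (eta / 5 + (eta / 10 + eta / 10) + eta / 5)%:E)%E.
  have b0 x : 0 <= bad n x by rewrite /bad.
  rewrite /h1 ge0_intD//; last 3 first.
  - by move=> x; have /andP[? _] := a01 i x; have /andP[? _] := a01 j x; rewrite !addr_ge0.
  - by move=> _; rewrite mulr_ge0// ltW.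
  - by apply: measurable_funD => //; exact: measurable_funD.
  rewrite ge0_intD//; last 2 first.
  - by move=> x; have /andP[? _] := a01 i x; have /andP[? _] := a01 j x; rewrite addr_ge0.
  - exact: measurable_funD.
  rewrite ge0_intD//; last 2 first.
  - by move=> x; have /andP[] := a01 i x.
  - by move=> x; have /andP[] := a01 j x.
  rewrite !EFinD; apply: leeD; first apply: leeD.
  - by apply: N1P; exact: leq_maxl.
  - by apply: leeD; exact: N3P.
  rewrite [X in (X <= _)%E](_ : _ = \int[mu]_x (cst (2 * t)%:E x))%E//.
  have muM : (mu setT <= M0%:E)%E by rewrite muE lee_fin lerDl.
  rewrite integral_cst//; apply: (@le_trans _ _ ((2 * t)%:E * M0%:E)%E).
    by apply: lee_wpmul2l; [rewrite lee_fin mulr_ge0 ?(ltW t0)|exact: muM].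
  rewrite -EFinM lee_fin.
  have -> : 2 * t * M0 = eta / 5 by rewrite /t; field; rewrite gt_eqF.
  by [].
apply: (le_trans (leeD H1 (leeD (OD i) (OD j)))).
by rewrite -!EFinD lee_fin; lra.
Qed.

End compactness.

(** * The Gagliardo energy *)

Lemma fine_para (R : realType) (A B C D : \bar R) :
  (A < +oo)%E -> (B < +oo)%E -> (C < +oo)%E -> (D < +oo)%E ->
  (0 <= A)%E -> (0 <= B)%E -> (0 <= C)%E -> (0 <= D)%E ->
  (C + 4%:E * D = 2%:E * A + 2%:E * B)%E ->
  fine C = 2 * fine A + 2 * fine B - 4 * fine D.
Proof.
move: A B C D => [a||] [b||] [c||] [e||] //= _ _ _ _ _ _ _ _.
by rewrite -!EFinM -!EFinD => -[E]; lra.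
Qed.

Lemma energy_para (R : realType) (c q1 q2 q3 q4 i1 i2 i3 i4 g1 g2 g3 g4 : R) :
  q1 = i1 + c * g1 -> q2 = i2 + c * g2 -> q3 = i3 + c * g3 -> q4 = i4 + c * g4 ->
  i3 = 2 * i1 + 2 * i2 - 4 * i4 -> g3 = 2 * g1 + 2 * g2 - 4 * g4 ->
  q3 = 2 * q1 + 2 * q2 - 4 * q4.
Proof. by move=> -> -> -> -> -> ->; ring. Qed.

Lemma para_mid_le (R : realType) (q1 q2 q3 q4 C : R) :
  q3 = 2 * q1 + 2 * q2 - 4 * q4 -> 0 <= q3 -> q1 <= C -> q2 <= C -> q4 <= C.
Proof. by move=> -> *; lra. Qed.

Lemma lty_2D (R : realType) (A B : \bar R) : (A < +oo)%E -> (B < +oo)%E ->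
  (2%:E * A + 2%:E * B < +oo)%E.
Proof. by move=> ? ?; rewrite lte_add_pinfty// lte_mul_pinfty. Qed.

Section volf_close.
Context (R : realType) (d : nat) (Omega : lipschitz_domain R d).

Lemma volf_close e (x : 'rV[R]_d) : 0 < e ->
  (volf Omega [set y | close e x y] <= ((2 * e) ^+ d)%:E)%E.
Proof.
by move=> e0; rewrite -(lebesgue_close x e0); exact: vol_le (measurable_close e x).
Qed.

Lemma volf_close_ae : {ae volf Omega, forall x, exists2 e0, 0 < e0 & forall e,
  0 < e < e0 -> volf Omega [set y | close e x y] = ((2 * e) ^+ d)%:E}.
Proof.
apply: filterS (ae_domain Omega) => x Ox.
have : nbhs x (Omega : set 'rV[R]_d).
  by apply: open_nbhs_nbhs; split => //; exact: domain_open.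
move=> /nbhs_ballP[r /= r0 rO].
exists r => // e /andP[e0 er].
rewrite -(lebesgue_close x e0); congr (lebesgue_rV R d _).
apply/setIidPl => y /= /forallP h; apply: rO; split => // i j.
rewrite ord1 -ball_normE /ball_/=; exact: lt_trans (h j) er.
Qed.

End volf_close.

Section gagliardo_energy.
Context (R : realType) (d : nat).
Variable mu : {sigma_finite_measure set 'rV[R]_d -> \bar R}.
Variable s : R.
Implicit Types (u v w : 'rV[R]_d -> R).

Local Notation gag w := (gagliardo mu s w w).

Lemma gag_ge0 w : (0 <= gag w)%E.
Proof. by rewrite gagliardoE; apply: dint_ge0; exact: gkern_ge0. Qed.

Lemma gagD_le u v : measurable_fun setT u -> measurable_fun setT v ->
  (gag (fun x => u x + v x)%R <= 2%:E * gag u + 2%:E * gag v)%E.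
Proof.
move=> mu_ mv; have mX w := @measurable2_gkern R d s w; have X0 := @gkern_ge0 R d s.
have m1 := mX u mu_; have m2 := mX v mv.
have n2 : 0 <= 2 :> R by [].
have m3 := mX (fun x => u x + v x) (measurable_funD mu_ mv).
rewrite !gagliardoE.
apply: (dint_le_lin mu n2 n2 m3 m1 m2 (X0 (fun x => u x + v x)) (X0 u) (X0 v)) => x y.
rewrite /gkern !mulrA -mulrDl ler_wpM2r ?invr_ge0 ?powR_ge0//.
by have := sqr_ge0 ((u x - u y) - (v x - v y)); nra.
Qed.

Lemma gagZ a w : measurable_fun setT w ->
  gag (fun x => a * w x) = ((a ^+ 2)%:E * gag w)%E.
Proof.
move=> mw; rewrite !gagliardoE.
rewrite -(dintZ mu (sqr_ge0 a) (measurable2_gkern s mw) (gkern_ge0 s w)).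
apply: eq_integral => x _; apply: eq_integral => y _; congr (_%:E).
by rewrite /gkern; ring.
Qed.

Definition mid u v := fun x => 2^-1 * (u x + v x).

(** Written with sums only, since the energies may be infinite; [fine_para] subtracts once they are
    known to be finite. *)
Lemma gag_para u v : measurable_fun setT u -> measurable_fun setT v ->
  (gag (fun x => u x - v x)%R + 4%:E * gag (mid u v) = 2%:E * gag u + 2%:E * gag v)%E.
Proof.
move=> mu_ mv; have mX w := @measurable2_gkern R d s w; have X0 := @gkern_ge0 R d s.
have m1 := mX u mu_; have m2 := mX v mv.
have m3 : measurable2 (gkern s (fun x => u x - v x)).
  by apply: mX; exact: measurable_funB.
have m4 : measurable2 (gkern s (mid u v)).
  by apply: mX; apply: measurable_funM => //; exact: measurable_funD.
have n2 : 0 <= 2 :> R by []. have n4 : 0 <= 4 :> R by [].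
rewrite !gagliardoE; apply: etrans (dint_lin mu n2 n2 m1 m2 (X0 u) (X0 v)).
rewrite -[X in (X + _)%E]mul1e.
apply: etrans (esym (dint_lin mu ler01 n4 m3 m4 (X0 (fun x => u x - v x)) (X0 (mid u v)))) _.
apply: eq_integral => x _; apply: eq_integral => y _; congr (_%:E).
by rewrite /gkern /mid; move: ((enorm (x - y) `^ (d%:R + 2 * s))^-1) => K; field.
Qed.

Lemma sqint_einf (f : nat -> 'rV[R]_d -> R) (g : 'rV[R]_d -> R) :
  (forall k, measurable_fun setT (f k)) -> measurable_fun setT g ->
  {ae mu, forall x, f k x @[k --> \oo] --> (g x : R)} ->
  (sqint mu g <= limn_einf (fun k => sqint mu (f k)))%E.
Proof.
move=> mf mg fg; apply: (@fatou_ae _ _ _ mu (fun k x => (f k x ^+ 2)%:E) (fun x => (g x ^+ 2)%:E)).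
- by move=> k; apply/measurable_EFinP; exact: measurable_funX.
- by move=> k x; rewrite lee_fin sqr_ge0.
- by apply/measurable_EFinP; exact: measurable_funX.
- by move=> x; rewrite lee_fin sqr_ge0.
apply: filterS fg => x h.
by rewrite (limn_einf_EFin (l := g x ^+ 2))//; exact: cvgM.
Qed.

Lemma gag_einf (f : nat -> 'rV[R]_d -> R) (g : 'rV[R]_d -> R) :
  (forall k, measurable_fun setT (f k)) -> measurable_fun setT g ->
  {ae mu, forall x, f k x @[k --> \oo] --> (g x : R)} ->
  (gag g <= limn_einf (fun k => gag (f k)))%E.
Proof.
move=> mf mg fg; have X0 := @gkern_ge0 R d s.
have mX w := @measurable2_gkern R d s w.
apply: (@fatou_ae _ _ _ mu (fun k x => \int[mu]_y (gkern s (f k) x y)%:E)%E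
  (fun x => \int[mu]_y (gkern s g x y)%:E)%E).
- by move=> k; apply: measurable_inner_int; [exact: mX|exact: X0].
- by move=> k x; apply: integral_ge0 => y _; rewrite lee_fin.
- by apply: measurable_inner_int; [exact: mX|exact: X0].
- by move=> x; apply: integral_ge0 => y _; rewrite lee_fin.
have fg' := fg; apply: filterS fg' => x fgx.
apply: (@fatou_ae _ _ _ mu (fun k y => (gkern s (f k) x y)%:E) (fun y => (gkern s g x y)%:E)).
- by move=> k; apply/measurable_EFinP; apply: measurable2_inner; exact: mX.
- by move=> k y; rewrite lee_fin.
- by apply/measurable_EFinP; apply: measurable2_inner; exact: mX.
- by move=> y; rewrite lee_fin.
apply: filterS fg => y fgy; rewrite (limn_einf_EFin (l := gkern s g x y))//.
apply: cvgM; last exact: cvg_cst.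
by apply: cvgM; apply: cvgB.
Qed.

Opaque gagliardo.

Hypothesis c_gt0 : 0 < frac_const d s.

Lemma HsP w : Hs mu s w <-> [/\ measurable_fun setT w, (sqint mu w < +oo)%E &
  (gag w < +oo)%E].
Proof. by rewrite /Hs /L2 /=; split=> [[/Lfun2P[? ?]]|[? ? ?]]; split => //; apply/Lfun2P. Qed.

Definition Hsq w : R := Hs_ip mu s w w.

Lemma HsqE w : Hsq w = ip mu w w + frac_const d s / 2 * fine (gag w).
Proof. by []. Qed.

Lemma Hsq_ge0 w : 0 <= Hsq w.
Proof.
have c2 : 0 <= frac_const d s / 2 by apply: mulr_ge0; [exact: ltW|].
rewrite HsqE; apply: addr_ge0; first exact: ip_ge0.
by apply: mulr_ge0 => //; exact/fine_ge0/gag_ge0.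
Qed.

Lemma HsD u v : Hs mu s u -> Hs mu s v -> Hs mu s (fun x => u x + v x).
Proof.
move=> [uL ug] [vL vg]; split; first exact: Lfun2D.
exact: le_lt_trans (gagD_le (Lfun2_measurable uL) (Lfun2_measurable vL)) (lty_2D ug vg).
Qed.

Lemma HsZ a u : Hs mu s u -> Hs mu s (fun x => a * u x).
Proof.
move=> [uL ug]; split; first exact: Lfun2Z.
rewrite /=; have := gagZ a (Lfun2_measurable uL) => /= ->.
by rewrite lte_mul_pinfty// lee_fin sqr_ge0.
Qed.

Lemma HsB u v : Hs mu s u -> Hs mu s v -> Hs mu s (fun x => u x - v x).
Proof.
move=> hu hv; have := HsD hu (HsZ (-1) hv).
rewrite (_ : (fun x => u x + -1 * v x) = (fun x => u x - v x))//.
by apply/funext => x; rewrite mulN1r.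
Qed.

Lemma Hs_mid u v : Hs mu s u -> Hs mu s v -> Hs mu s (mid u v).
Proof. by move=> hu hv; apply: HsZ; exact: HsD. Qed.

Lemma gag_0 : gag (fun=> 0) = 0%E.
Proof.
rewrite gagliardoE /dint (eq_integral (cst 0%E)) ?integral0// => x _.
rewrite (eq_integral (cst 0%E)) ?integral0// => y _.
by rewrite /gkern subrr mul0r mul0r.
Qed.

Lemma Hs_0 : Hs mu s (fun=> 0).
Proof. by split; [exact: Lfun2_0|rewrite /= gag_0]. Qed.

Lemma Hsq_para u v : Hs mu s u -> Hs mu s v ->
  Hsq (fun x => u x - v x) = 2 * Hsq u + 2 * Hsq v - 4 * Hsq (mid u v).
Proof.
move=> hu hv; have [bL bg] := HsB hu hv; have [mL mg] := Hs_mid hu hv.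
case: hu => uL ug; case: hv => vL vg.
have E := gag_para (Lfun2_measurable uL) (Lfun2_measurable vL).
have {}E := fine_para ug vg bg mg (gag_ge0 _) (gag_ge0 _) (gag_ge0 _) (gag_ge0 _) E.
have E2 : ip mu (fun x => u x - v x) (fun x => u x - v x) =
  2 * ip mu u u + 2 * ip mu v v - 4 * ip mu (mid u v) (mid u v) := ip_para uL vL.
exact: (energy_para (HsqE u) (HsqE v) (HsqE (fun x => u x - v x)) (HsqE (mid u v)) E2 E).
Qed.

Lemma Hsq_mid_le u v C : Hs mu s u -> Hs mu s v -> Hsq u <= C -> Hsq v <= C ->
  Hsq (mid u v) <= C.
Proof.
move=> hu hv uC vC.
exact: (para_mid_le (Hsq_para hu hv) (Hsq_ge0 _) uC vC).
Qed.

(** Balls of the space are closed under almost everywhere convergence; lower semicontinuity of the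
    norm will be read off from this by varying [C]. *)
Lemma Hs_fatou (f : nat -> 'rV[R]_d -> R) (g : 'rV[R]_d -> R) (C : R) :
  (forall k, Hs mu s (f k)) -> (forall k, Hsq (f k) <= C) ->
  measurable_fun setT g ->
  {ae mu, forall x, f k x @[k --> \oo] --> (g x : R)} ->
  Hs mu s g /\ Hsq g <= C.
Proof.
move=> fH fC mg fg; set c := frac_const d s / 2.
have c0 : 0 < c by apply: mulr_gt0 => //; rewrite invr_gt0.
have ip0 k := ip_ge0 mu (f k).
have fg0 k : 0 <= fine (gag (f k)) by exact/fine_ge0/gag_ge0.
have aC k : ip mu (f k) (f k) + c * fine (gag (f k)) <= C by exact: fC.
(* Along a subsequence both parts of the norm converge, so their limits [A] and [B], which bound the
   parts for [g], combine to at most [C]. *)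
pose a (j : nat) k := if j is 0%N then ip mu (f k) (f k) else fine (gag (f k)).
have [phi hphi phiP] : exists2 phi, incr phi &
    forall j, exists l : R, a j (phi k) @[k --> \oo] --> l.
  apply: (@bounded_subseq _ a (fun j => if j is 0%N then C else C / c)) => -[|j] k /=.
    rewrite ger0_norm//; apply: le_trans (aC k).
    by rewrite lerDl mulr_ge0// ltW.
  rewrite ger0_norm// ler_pdivlMr// mulrC; apply: le_trans (aC k).
  by rewrite lerDr.
have [A hA] := phiP 0%N; have [B hB] := phiP 1%N.
rewrite /= in hA hB.
have mf k : measurable_fun setT (f k) by have [/Lfun2_measurable] := fH k.
have fgphi : {ae mu, forall x, f (phi k) x @[k --> \oo] --> (g x : R)}.
  by apply: filterS fg => x h; exact: incr_cvg hphi h.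
have gA : (sqint mu g <= A%:E)%E.
  apply: le_trans (sqint_einf (fun k => mf (phi k)) mg fgphi) _.
  rewrite -(limn_einf_EFin hA) le_eqVlt; apply/orP; left; apply/eqP.
  congr limn_einf; apply/funext => k; apply: ip_sqint; exact: (fH _).1.
have gB : (gag g <= B%:E)%E.
  apply: le_trans (gag_einf (fun k => mf (phi k)) mg fgphi) _.
  rewrite -(limn_einf_EFin hB) le_eqVlt; apply/orP; left; apply/eqP.
  congr limn_einf; apply/funext => k.
  by rewrite fineK// ge0_fin_numE ?gag_ge0//; exact: (fH _).2.
have gH : Hs mu s g.
  apply/HsP; split => //.
    by rewrite (le_lt_trans gA)// ltry.
  by rewrite (le_lt_trans gB)// ltry.
split => //.
have ABC : A + c * B <= C.
  have h : (a 0%N (phi k) + c * a 1%N (phi k)) @[k --> \oo] --> A + c * B.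
    by apply: cvgD => //; apply: cvgM => //; exact: cvg_cst.
  rewrite -(cvg_lim _ h)//; apply: limr_le; first by apply/cvg_ex; exists (A + c * B).
  by apply: nearW => k; exact: aC.
apply: le_trans ABC; rewrite HsqE; apply: lerD.
  by rewrite -lee_fin -ip_sqint//; exact: gH.1.
rewrite ler_wpM2l ?(ltW c0)// -lee_fin fineK// ge0_fin_numE ?gag_ge0//.
exact: gH.2.
Qed.

End gagliardo_energy.

(** * Test functions *)

Lemma sq_sum_le (R : realType) (d : nat) (a : 'I_d -> R) :
  (\sum_i a i) ^+ 2 <= d%:R * \sum_i a i ^+ 2.
Proof.
rewrite expr2 mulr_suml.
have -> : d%:R * \sum_i a i ^+ 2 = \sum_i \sum_j (a i ^+ 2 + a j ^+ 2) / 2.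
  rewrite [RHS](eq_bigr (fun i => d%:R * (a i ^+ 2 / 2) + (\sum_j a j ^+ 2) / 2)); last first.
    move=> i _; under eq_bigr do rewrite mulrDl; rewrite big_split/=.
    by rewrite sumr_const card_ord mulr_natl mulr_suml.
  rewrite big_split /= sumr_const card_ord -mulr_sumr -mulr_suml -mulr_natl.
  set S := \sum_i _; lra.
apply: ler_sum => i _; rewrite mulr_sumr; apply: ler_sum => j _.
have := sqr_ge0 (a i - a j); nra.
Qed.

(** With [x = |g 1 - g 0|], integrate [|y| <= x/2 + y^2 / (2x)] at [y = g' t] over the unit interval
    and absorb [x/2]. The indicator lets the integral range over the whole line, ready for Tonelli's
    theorem. *)
Lemma ftc_sq (R : realType) (g g' : R -> R) :
  (forall t : R, is_derive t (1 : R) g (g' t)) -> continuous g' ->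
  (((g 1 - g 0) ^+ 2)%:E <=
    \int[@lebesgue_measure R]_t (g' t ^+ 2 * \1_(`[0%R, 1%R]%classic) t)%:E)%E.
Proof.
move=> dg cg'; set mu := @lebesgue_measure R; set D : set R := `[0, 1]%classic.
have mD : measurable D by exact: measurable_itv.
have muD : mu D = 1%E by rewrite /mu /D lebesgue_measure_itv /= lte_fin ltr01 sube0.
have mg' : measurable_fun setT g' by exact: continuous_measurable_fun.
have cg : continuous g.
  move=> t; apply: differentiable_continuous; apply/derivable1_diffP.
  by have [] := dg t.
have E : (\int[mu]_(t in D) (g' t)%:E = (g 1)%:E - (g 0)%:E)%E.
  apply: continuous_FTC2 => //.
  - by apply: continuous_subspaceT; exact: cg'.
  - split.
    + by move=> t _; have [] := dg t.
    + by apply: cvg_at_right_filter; exact: cg.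
    + by apply: cvg_at_left_filter; exact: cg.
  - by move=> t _; rewrite derive1E; have [_ ->] := dg t.
pose I := (\int[mu]_(t in D) (g' t ^+ 2)%:E)%E.
have IE : (\int[mu]_t (g' t ^+ 2 * \1_D t)%:E = I)%E.
  rewrite /I [RHS]integral_mkcond; apply: eq_integral => t _.
  rewrite patchE indicE; case: (t \in D); first by rewrite mulr1.
  by rewrite mulr0.
rewrite IE; pose x := `|g 1 - g 0|.
rewrite -(real_normK (num_real (g 1 - g 0))) -/x.
have x0 : 0 <= x by exact: normr_ge0.
have I0 : (0 <= I)%E by apply: integral_ge0 => t _; rewrite lee_fin sqr_ge0.
have [->|xn0] := eqVneq x 0; first by rewrite expr0n.
have {x0}xp : 0 < x by rewrite lt_neqAle eq_sym xn0.
have h : (x%:E <= (x / 2)%:E + ((2 * x)^-1)%:E * I)%E.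
  have -> : x%:E = `|\int[mu]_(t in D) (g' t)%:E|%E by rewrite E -EFinB.
  apply: le_trans (le_abse_integral _ _ _) _ => //.
    by apply/measurable_EFinP; exact: measurable_funTS.
  have -> : (x / 2)%:E = (\int[mu]_(t in D) (cst (x / 2)%:E t))%E.
    by rewrite integral_cst// -[LHS]mule1; congr (_ * _)%E; exact/esym/muD.
  have mX : measurable_fun D (fun t => (g' t ^+ 2)%:E).
    by apply/measurable_EFinP; apply: measurable_funTS; exact: measurable_funX.
  rewrite -ge0_integralZl_EFin//; last 2 first.
  - by move=> t _; rewrite lee_fin sqr_ge0.
  - by rewrite invr_ge0 mulr_ge0// ltW.
  rewrite -ge0_integralD//; last 3 first.
  - by move=> t _; rewrite lee_fin divr_ge0// ltW.
  - by move=> t _; rewrite mule_ge0// lee_fin ?sqr_ge0// invr_ge0 mulr_ge0// ltW.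
  - by apply: measurable_funeM.
  apply: ge0_le_integral => //.
  - by apply/measurable_EFinP; apply: measurable_funTS; exact: measurableT_comp.
  - by apply: emeasurable_funD => //; exact: measurable_funeM.
  move=> t _ /=; rewrite -EFinM -EFinD lee_fin.
  rewrite -(real_normK (num_real (g' t))); move: (normr_ge0 (g' t)).
  move: `|g' t| => y y0; rewrite -(ler_pM2l xp) mulrDr mulrA invfM.
  rewrite (_ : x * (2^-1 / x) = 2^-1); last by field.
  have := sqr_ge0 (x - y); nra.
move: (I) h I0 => [i||] //; last by move=> *; rewrite leey.
rewrite -EFinM -EFinD !lee_fin => h i0.
have {}h : x * x <= x * (x / 2 + (2 * x)^-1 * i) by rewrite ler_pM2l.
rewrite mulrDr [x * (_^-1 * i)]mulrA invfM (_ : x * (2^-1 / x) = 2^-1) in h; last by field.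
rewrite expr2; lra.
Qed.

Lemma int_indic01 (R : realType) (G : \bar R) :
  (\int[@lebesgue_measure R]_t ((\1_(`[0%R, 1%R]%classic) t)%:E * G) = G)%E.
Proof.
set mu := @lebesgue_measure R; set D : set R := `[0, 1]%classic.
transitivity (\int[mu]_(t in D) cst G t)%E.
  rewrite [RHS]integral_mkcond; apply: eq_integral => t _.
  by rewrite patchE indicE; case: (t \in D); rewrite ?mul1e ?mul0e.
rewrite integral_cst//; last exact: measurable_itv.
have muD : mu D = 1%E by rewrite /mu /D lebesgue_measure_itv /= lte_fin ltr01 sube0.
by rewrite -[RHS]mule1; congr (_ * _)%E; exact: muD.
Qed.

Section smooth_functions.
Context (R : realType) (d : nat).
Implicit Types (u v z : 'rV[R]_d -> R) (a : R).

Lemma smooth_differentiable z x : smooth z -> differentiable z x.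
Proof. by move=> /(_ [::]). Qed.

Lemma smooth_partial z i : smooth z -> smooth (partial i z).
Proof. by move=> sz l x; have := sz (rcons l i) x; rewrite foldr_rcons. Qed.

Lemma smooth_continuous z : smooth z -> continuous z.
Proof. by move=> sz x; apply: differentiable_continuous; exact: smooth_differentiable. Qed.

Lemma smooth_measurable z : smooth z -> measurable_fun setT z.
Proof. by move=> sz; apply: continuous_measurable_rV; exact: smooth_continuous. Qed.

Definition dir_derive z (h x : 'rV[R]_d) : R := \sum_i h ord0 i * partial i z x.

Lemma dir_deriveE z (h x : 'rV[R]_d) : smooth z -> 'D_h z x = dir_derive z h x.
Proof.
move=> sz; have dz := smooth_differentiable x sz.
rewrite deriveE// {1}(row_sum_delta h) linear_sum; apply: eq_bigr => i _.
by rewrite linearZ /= /partial deriveE.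
Qed.

Lemma is_derive_line z (h x : 'rV[R]_d) (t : R) : smooth z ->
  is_derive t (1 : R) (fun t : R => z (x + t *: h)) (dir_derive z h (x + t *: h)).
Proof.
move=> sz; have dz := smooth_differentiable (x + t *: h) sz.
have dv := diff_derivable (v := h) dz.
have EF : (fun k : R => k^-1 *: (((fun t => z (x + t *: h)) \o shift t) (k *: (1 : R)) - z (x + t *: h)))
   = (fun k : R => k^-1 *: ((z \o shift (x + t *: h)) (k *: h) - z (x + t *: h))).
  apply/funext => k /=; congr (_ *: (z _ - _)).
  by rewrite [k%:A]mulr1 scalerDl addrCA addrC -addrA.
split; first by rewrite /derivable EF.
by rewrite -dir_deriveE// /derive EF.
Qed.

Lemma smoothD u v : smooth u -> smooth v -> smooth (fun x => u x + v x).
Proof.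
move=> su sv l.
have [Eu Ed] : foldr (@partial R d) (fun x => u x + v x) l =
    (fun x => foldr (@partial R d) u l x + foldr (@partial R d) v l x) /\ True.
  split => //; elim: l => [//|i l /= ->].
  apply/funext => x; rewrite /partial; apply: deriveD.
    exact/diff_derivable/su.
  exact/diff_derivable/sv.
by move=> x; rewrite Eu; apply: differentiableD; [exact: su|exact: sv].
Qed.

Lemma smoothZ a u : smooth u -> smooth (fun x => a * u x).
Proof.
move=> su l.
have Eu : foldr (@partial R d) (fun x => a * u x) l =
    (fun x => a * foldr (@partial R d) u l x).
  elim: l => [//|i l /= ->].
  apply/funext => x; rewrite /partial.
  exact: (deriveZ a (diff_derivable (su l x))).
by move=> x; rewrite Eu; apply: differentiableZ; exact: su.
Qed.

Lemma partialD i u v : smooth u -> smooth v ->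
  partial i (fun x => u x + v x) = (fun x => partial i u x + partial i v x).
Proof.
move=> su sv; apply/funext => x; rewrite /partial; apply: deriveD.
  exact: (diff_derivable (su [::] x)).
exact: (diff_derivable (sv [::] x)).
Qed.

Lemma partialZ i a u : smooth u ->
  partial i (fun x => a * u x) = (fun x => a * partial i u x).
Proof.
move=> su; apply/funext => x; rewrite /partial.
exact: (deriveZ a (diff_derivable (su [::] x))).
Qed.

Lemma smooth0 : smooth (fun _ : 'rV[R]_d => 0 : R).
Proof.
move=> l; have E : foldr (@partial R d) (fun=> 0) l = (fun=> 0).
  by elim: l => [//|i l /= ->]; apply/funext => x; exact: derive_cst.
by move=> x; rewrite E; exact: differentiable_cst.
Qed.

Lemma smooth_dir_derive z (h : 'rV[R]_d) : smooth z -> smooth (dir_derive z h).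
Proof.
move=> sz; rewrite /dir_derive; elim: (index_enum _) => [|i r IH].
  rewrite (_ : (fun x => _) = (fun=> 0)); first exact: smooth0.
  by apply/funext => x; rewrite big_nil.
rewrite (_ : (fun x => _) = (fun x => h ord0 i * partial i z x +
    \sum_(j <- r) h ord0 j * partial j z x)); last first.
  by apply/funext => x; rewrite big_cons.
by apply: smoothD => //; apply: smoothZ; exact: smooth_partial.
Qed.

Definition grad_sq z x : R := \sum_i partial i z x ^+ 2.

Lemma grad_sq_ge0 z x : 0 <= grad_sq z x.
Proof. by apply: sumr_ge0 => i _; exact: sqr_ge0. Qed.

Lemma measurable_grad_sq z : smooth z -> measurable_fun setT (grad_sq z).
Proof.
move=> sz; apply: measurable_sum => i; apply: measurable_funX.
exact: (smooth_measurable (smooth_partial i sz)).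
Qed.

Lemma dir_derive_sq_le z (h x : 'rV[R]_d) (e : R) : (forall i, `|h ord0 i| <= e) ->
  dir_derive z h x ^+ 2 <= d%:R * e ^+ 2 * grad_sq z x.
Proof.
move=> he; apply: le_trans (sq_sum_le _) _.
rewrite -mulrA ler_wpM2l// mulr_sumr; apply: ler_sum => i _.
rewrite exprMn ler_wpM2r ?sqr_ge0// -(real_normK (num_real (h ord0 i))).
by rewrite ler_pXn2r ?nnegrE// (le_trans _ (he i)).
Qed.

(** Apply [ftc_sq] on the segment from [x] to [x + h], exchange the integrals, and remove the shift
    [t *: h] by translation invariance. The factor [d] comes from bounding [h] by coordinates. *)
Lemma shift_diff_le z (h : 'rV[R]_d) (e : R) : smooth z ->
  (forall i, `|h ord0 i| <= e) ->
  (\int[lebesgue_rV R d]_x ((z x - z (h + x)) ^+ 2)%:E <=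
    (d%:R * e ^+ 2)%:E * \int[lebesgue_rV R d]_x (grad_sq z x)%:E)%E.
Proof.
move=> sz he; set leb := lebesgue_rV R d; set mu := @lebesgue_measure R.
have mz := smooth_measurable sz.
have mdir : measurable_fun setT (dir_derive z h).
  apply: measurable_sum => i; apply: measurable_funM => //.
  exact: (smooth_measurable (smooth_partial i sz)).
pose D : set R := `[0, 1]%classic.
have mD : measurable D by exact: measurable_itv.
pose F (p : 'rV[R]_d * measurableTypeR R) : \bar R :=
  (dir_derive z h (p.1 + p.2 *: h) ^+ 2 * \1_D p.2)%:E.
have mline : measurable_fun setT
    (fun p : 'rV[R]_d * measurableTypeR R => p.1 + p.2 *: h).
  apply: measurable_fun_rVP => i.
  rewrite (_ : _ \o _ = (fun p => rV_coord i p.1 + p.2 * h ord0 i)); last first.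
    by apply/funext => p; rewrite /rV_coord /= !mxE.
  apply: measurable_funD.
    exact: (measurableT_comp (@measurable_rV_coord R d i) measurable_fst).
  by apply: measurable_funM => //; exact: measurable_snd.
have mF : measurable_fun setT F.
  apply/measurable_EFinP; apply: measurable_funM.
    apply: measurable_funX; exact: measurableT_comp mdir mline.
  by apply: (measurableT_comp (f := \1_D : measurableTypeR R -> R)).
have F0 p : (0 <= F p)%E by rewrite lee_fin mulr_ge0// sqr_ge0.
apply: (@le_trans _ _ (\int[leb]_x \int[mu]_t F (x, t))%E).
  apply: ge0_le_integral => //.
  - by move=> x _; rewrite lee_fin sqr_ge0.
  - apply/measurable_EFinP; apply: measurable_funX; apply: measurable_funB => //.
    apply: (measurableT_comp mz).
    rewrite (_ : +%R h = (fun x : 'rV[R]_d => x + h)); first exact: measurable_rV_shift.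
    by apply/funext => x; rewrite addrC.
  - exact: (@measurable_fun_fubini_tonelli_F _ _ _ _ _ mu F mF F0).
  move=> x _.
  have := @ftc_sq R (fun t => z (x + t *: h)) (fun t => dir_derive z h (x + t *: h)).
  have -> : (z x - z (h + x)) ^+ 2 = (z (x + 1 *: h) - z (x + 0 *: h)) ^+ 2.
    by rewrite scale1r scale0r addr0 (addrC h) -sqrrN opprB.
  apply; first by move=> t; exact: is_derive_line.
  have cline : continuous (fun t : R => x + t *: h).
    move=> t; apply: cvgD; first exact: cvg_cst.
    by apply: cvgZr_tmp; exact: cvg_id.
  by move=> t; apply: continuous_comp; [exact: cline|exact: (smooth_continuous (smooth_dir_derive h sz))].
have [/= E1 E2] : (\int[leb]_x \int[mu]_t F (x, t) =
   \int[mu]_t \int[leb]_x F (x, t))%E /\ True.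
  split => //; exact: (@fubini_tonelli _ _ _ _ _ leb mu F mF F0).
rewrite E1.
pose G := (\int[leb]_x (dir_derive z h x ^+ 2)%:E)%E.
have mdir2 : measurable_fun setT (fun x => (dir_derive z h x ^+ 2)%:E).
  by apply/measurable_EFinP; exact: measurable_funX.
have GE (t : R) : (\int[leb]_x F (x, t) = (\1_D t)%:E * G)%E.
  have ms : measurable_fun setT (fun x : 'rV[R]_d => dir_derive z h (x + t *: h) ^+ 2).
    exact: measurable_funX 2 (measurableT_comp mdir (measurable_rV_shift (t *: h))).
  have -> : (\int[leb]_x F (x, t) =
      \int[leb]_x (\1_D t * dir_derive z h (x + t *: h) ^+ 2)%:E)%E.
    by apply: eq_integral => x _; rewrite /F mulrC.
  rewrite (ge0_intZ leb _ (fun x => sqr_ge0 (dir_derive z h (x + t *: h))) ms); last first.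
    by rewrite indicE.
  have sh := @ge0_integral_rV_shift R d (t *: h) (fun x => (dir_derive z h x ^+ 2)%:E)
    mdir2 (fun x => sqr_ge0 (dir_derive z h x)).
  rewrite -/leb -/G in sh; move: sh.
  by move: (\int[leb]_x _)%E G => A B ->.
have G0 : (0 <= G)%E by apply: integral_ge0 => x _; rewrite lee_fin sqr_ge0.
under eq_integral do rewrite GE.
rewrite int_indic01 -ge0_intZ//; last 3 first.
- by rewrite mulr_ge0// sqr_ge0.
- exact: grad_sq_ge0.
- exact: measurable_grad_sq.
apply: ge0_le_int => [x||].
- by rewrite sqr_ge0 dir_derive_sq_le.
- exact: measurable_funX.
- by apply: measurable_funM => //; exact: measurable_grad_sq.
Qed.

End smooth_functions.

Lemma close_shift (R : realType) (d : nat) (e : R) (x h : 'rV[R]_d) :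
  close e x (h + x) = close e 0 h.
Proof.
rewrite /close; apply: eq_forallb => i.
by rewrite !mxE sub0r opprD addrCA addrN addr0.
Qed.

Lemma measurable2_swap d (T : measurableType d) (R : realType) (F : T -> T -> R) :
  measurable2 F -> measurable2 (fun x y => F y x).
Proof. by move=> mF; exact: (measurableT_comp mF (@measurable_swap _ _ T T)). Qed.

Section test_functions.
Context (R : realType) (d : nat) (Omega : lipschitz_domain R d).
Implicit Types (u v z w : 'rV[R]_d -> R) (a e : R).
Local Notation leb := (lebesgue_rV R d).
Local Notation test := (test_function (Omega : set 'rV[R]_d)).
Local Notation vol := (volf Omega).

Lemma domain_norm_le : exists2 M : R, 0 < M &
  forall x : 'rV[R]_d, (Omega : set _) x -> `|x| <= M.
Proof.
have [M [Mr OM]] := domain_bounded Omega.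
have M1 : M < `|M| + 1 by rewrite (le_lt_trans (ler_norm M))// ltrDl.
by exists (`|M| + 1); [rewrite ltr_wpDl|move=> x Ox; exact: OM M1 x Ox].
Qed.

Lemma test_off z x : test z -> ~ (Omega : set _) x -> z x = 0.
Proof. by move=> [_ [K [_ KO K0]]] Ox; apply: K0 => /KO. Qed.

Lemma test_smooth z : test z -> smooth z.
Proof. by case. Qed.

Lemma test_measurable z : test z -> measurable_fun setT z.
Proof. by move=> [sz _]; exact: smooth_measurable. Qed.

Lemma test0 : test (fun=> 0).
Proof. by split; [exact: smooth0|exists set0; split => //; exact: compact0]. Qed.

Lemma testD u v : test u -> test v -> test (fun x => u x + v x).
Proof.
move=> [su [K [cK KO K0]]] [sv [L [cL LO L0]]]; split; first exact: smoothD.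
exists (K `|` L); split; first exact: compactU.
  by move=> x [/KO|/LO].
by move=> x /not_orP[Kx Lx]; rewrite K0// L0// addr0.
Qed.

Lemma testZ a u : test u -> test (fun x => a * u x).
Proof.
move=> [su [K [cK KO K0]]]; split; first exact: smoothZ.
by exists K; split => // x Kx; rewrite K0// mulr0.
Qed.

Lemma test_partial i z : test z -> test (partial i z).
Proof.
move=> [sz [K [cK KO K0]]]; split; first exact: smooth_partial.
exists K; split => // x Kx.
have oK : open (~` K).
  by apply: closed_openC; apply: compact_closed => //; exact: norm_hausdorff.
have nz : \near x, z x = cst (0 : R) x.
  have : nbhs x (~` K) by apply: open_nbhs_nbhs; split.
  by apply: filterS => y Ky; exact: K0.
by rewrite /partial (near_eq_derive (delta_mx ord0 i) nz) derive_cst.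
Qed.

Lemma test_le z : test z -> exists M, forall x, `|z x| <= M.
Proof.
move=> [sz [K [cK _ K0]]].
have czK : {within K, continuous z}.
  by apply: continuous_subspaceT; exact: smooth_continuous.
have [M [_ MK]] := compact_bounded (continuous_compact czK cK).
have M1 : M < `|M| + 1 by rewrite (le_lt_trans (ler_norm M))// ltrDl.
exists (`|M| + 1) => x; have [Kx|Kx] := pselect (K x).
  by apply: MK M1 _ _; exists x.
by rewrite K0// normr0 addr_ge0.
Qed.

Lemma test_L2 z : test z -> z \in Lfun vol 2%:E.
Proof.
move=> tz; have [M zM] := test_le tz.
exact: (Lfun2_bounded (vol_lty Omega) (test_measurable tz) zM).
Qed.

Lemma sqint_leb w : measurable_fun setT w ->
  (forall x, ~ (Omega : set _) x -> w x = 0) -> sqint leb w = sqint vol w.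
Proof.
move=> mw w0; rewrite [RHS]integral_vol//; last 2 first.
- by apply/measurable_EFinP; exact: measurable_funX.
- by move=> x; rewrite lee_fin sqr_ge0.
rewrite [RHS]integral_mkcond; apply: eq_integral => x _.
rewrite patchE; case: ifPn => // /negP; rewrite inE => Ox.
by rewrite w0// expr0n.
Qed.

Definition grad_ip z : R := \sum_i ip vol (partial i z) (partial i z).

Lemma grad_ip_ge0 z : 0 <= grad_ip z.
Proof. by apply: sumr_ge0 => i _; exact: ip_ge0. Qed.

Lemma int_grad_sq z : test z -> (\int[leb]_x (grad_sq z x)%:E = (grad_ip z)%:E)%E.
Proof.
move=> tz; have tp i := test_partial i tz.
under eq_integral do rewrite /grad_sq -sumEFin.
rewrite ge0_integral_sum//; last 2 first.
- by move=> i; apply/measurable_EFinP; apply: measurable_funX; exact: test_measurable.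
- by move=> i x _; rewrite lee_fin sqr_ge0.
rewrite /grad_ip -sumEFin; apply: eq_bigr => i _.
rewrite -(ip_sqint (test_L2 (tp i))); apply: sqint_leb; first exact: test_measurable.
by move=> x; exact: test_off.
Qed.

Lemma test_shift_le z (h : 'rV[R]_d) e : test z -> (forall i, `|h ord0 i| <= e) ->
  (\int[leb]_x ((z x - z (h + x)) ^+ 2)%:E <= (d%:R * e ^+ 2 * grad_ip z)%:E)%E.
Proof.
move=> tz he; apply: le_trans (shift_diff_le (test_smooth tz) he) _.
by rewrite (int_grad_sq tz) -EFinM.
Qed.

(* Translate the domain off itself along a coordinate axis. *)
Lemma poincare : (0 < d)%N -> exists2 P, 0 < P & forall z, test z ->
  ip vol z z <= P * grad_ip z.
Proof.
move=> d0; have [M M0 OM] := domain_norm_le.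
(* Points of the domain have coordinates of size at most [M], so a shift by [2 M + 1] moves them
   beyond [M] and out of the domain. *)
pose i0 := Ordinal d0; pose e := 2 * M + 1.
have e0 : 0 < e by rewrite addr_gt0// mulr_gt0.
exists (d%:R * e ^+ 2) => [|z tz]; first by rewrite mulr_gt0 ?ltr0n// exprn_gt0.
pose h : 'rV[R]_d := e *: delta_mx ord0 i0.
have he i : `|h ord0 i| <= e.
  by rewrite !mxE/=; case: (i == i0); rewrite ?mulr1 ?mulr0 ?normr0 ?(gtr0_norm e0)// ltW.
have zh x : (Omega : set _) x -> z (h + x) = 0.
  move=> Ox; apply: (test_off tz) => /OM.
  have := OM _ Ox; move: (ler_coord_norm x i0) (ler_coord_norm (h + x) i0).
  have -> : (h + x) ord0 i0 = e + x ord0 i0 by rewrite /h !mxE !eqxx mulr1.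
  move=> h1 h2 h3 h4.
  have := le_trans h1 h3; have := le_trans h2 h4.
  move: (x ord0 i0) => t; rewrite !ler_norml /e => /andP[_ +] /andP[+ _]; lra.
have mz := test_measurable tz.
have mzh : measurable_fun setT (fun x : 'rV[R]_d => z (h + x)).
  apply: (measurableT_comp mz); rewrite (_ : +%R h = (fun x : 'rV[R]_d => x + h)).
    exact: measurable_rV_shift.
  by apply/funext => x; rewrite addrC.
rewrite -lee_fin; apply: le_trans (test_shift_le tz he).
rewrite -(ip_sqint (test_L2 tz)).
have mD : measurable_fun setT (fun x => (z x - z (h + x)) ^+ 2).
  by apply: measurable_funX; exact: measurable_funB.
have D0 x : (0 <= ((z x - z (h + x)) ^+ 2)%:E)%E by rewrite lee_fin sqr_ge0.
apply: le_trans (integral_vol_le Omega (proj2 (measurable_EFinP _ _) mD) D0).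
rewrite le_eqVlt; apply/orP; left; apply/eqP.
apply: ae_eq_int => //.
- by move=> x; exact: sqr_ge0.
- exact: measurable_funX.
by apply: filterS (ae_domain Omega) => x Ox; rewrite zh// subr0.
Qed.

Lemma dint_vol_le (F : 'rV[R]_d -> 'rV[R]_d -> R) : measurable2 F ->
  (forall x y, 0 <= F x y) -> (dint vol F <= dint leb F)%E.
Proof.
move=> mF F0; have F0' x y : (0 <= (F x y)%:E)%E by rewrite lee_fin.
have mFx x : measurable_fun setT (fun y => (F x y)%:E).
  by apply/measurable_EFinP; exact: measurable2_inner.
apply: (@le_trans _ _ (\int[vol]_x \int[leb]_y (F x y)%:E)%E).
  apply: ge0_le_integral => //.
  - by move=> x _; exact: integral_ge0.
  - exact: (measurable_inner_int vol mF F0).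
  - exact: (measurable_inner_int leb mF F0).
  - by move=> x _; exact: (integral_vol_le Omega (mFx x) (F0' x)).
apply: (integral_vol_le Omega (measurable_inner_int leb mF F0)).
by move=> x; exact: integral_ge0.
Qed.

(** Substitute [y = h + x] and integrate [test_shift_le] over the cube of all [h]; the gain over
    [e^d] is the factor [e^2]. *)
Lemma Dq_test_le e z : 0 < e -> test z ->
  (Dq vol e z <= ((2 * e) ^+ d * (d%:R * e ^+ 2) * grad_ip z)%:E)%E.
Proof.
move=> e0 tz; have mz := test_measurable tz.
have mF := measurable2_Dq e mz.
apply: le_trans (dint_vol_le mF (Dq_ge0 e z)) _.
pose G (x h : 'rV[R]_d) : R := (close e 0 h)%:R * (z x - z (h + x)) ^+ 2.
have mzh : measurable2 (fun x h : 'rV[R]_d => z (h + x)).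
  apply: (measurableT_comp mz); apply: measurable_fun_rVP => i.
  rewrite (_ : _ \o _ = (fun p : 'rV[R]_d * 'rV[R]_d => rV_coord i p.2 + rV_coord i p.1)).
    apply: measurable_funD.
      exact: (measurableT_comp (@measurable_rV_coord R d i) measurable_snd).
    exact: (measurableT_comp (@measurable_rV_coord R d i) measurable_fst).
  by apply/funext => p; rewrite /rV_coord /= !mxE.
have mc : measurable_fun setT (fun h : 'rV[R]_d => (close e 0 h)%:R : R).
  exact: (@measurable2_inner _ _ R (fun x y : 'rV[R]_d => (close e x y)%:R) 0
    (@measurable2_close R d e)).
have mG : measurable2 G.
  apply: measurable_funM; first exact: (measurable2_snd mc).
  apply: measurable_funX; apply: measurable_funB; first exact: (measurable2_fst mz).
  exact: mzh.
have mGs : measurable2 (fun h x => G x h) by exact: measurable2_swap mG.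
have G0 x h : 0 <= G x h by rewrite mulr_ge0// sqr_ge0.
have -> : dint leb (fun x y => (close e x y)%:R * (z x - z y) ^+ 2) = dint leb G.
  apply: eq_integral => x _.
  have m1 : measurable_fun setT (fun y => ((close e x y)%:R * (z x - z y) ^+ 2)%:E).
    by apply/measurable_EFinP; exact: measurable2_inner x mF.
  have := ge0_integral_rV_shift x m1 (fun y => Dq_ge0 e z x y).
  move=> /esym ->; apply: eq_integral => h _; rewrite /G; by rewrite close_shift.
rewrite (dintC leb mG G0) /dint.
have cE : (\int[leb]_h ((close e 0 h)%:R : R)%:E = ((2 * e) ^+ d)%:E)%E.
  rewrite -(lebesgue_close (0 : 'rV[R]_d) e0).
  rewrite -[RHS]mul1e -integral_cst//; last exact: measurable_close.
  rewrite [RHS]integral_mkcond; apply: eq_integral => h _.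
  rewrite patchE; have -> : (h \in [set y | close e 0 y]) = close e 0 h.
    by apply/idP/idP; rewrite inE.
  by case: close.
pose c := d%:R * e ^+ 2 * grad_ip z.
have c0 : 0 <= c.
  by apply: mulr_ge0 (grad_ip_ge0 z); apply: mulr_ge0 => //; exact: sqr_ge0.
have -> : ((2 * e) ^+ d * (d%:R * e ^+ 2) * grad_ip z)%:E =
    (\int[leb]_h (c * (close e 0 h)%:R)%:E)%E.
  rewrite (ge0_intZ leb c0 _ mc); last by move=> h.
  by rewrite cE -EFinM; congr (_%:E); rewrite /c -mulrA [LHS]mulrC.
apply: ge0_le_integral => //.
- by move=> h _; apply: integral_ge0 => x _; rewrite lee_fin.
- exact: (@measurable_inner_int _ _ R leb (fun h x : 'rV[R]_d => G x h) mGs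
    (fun h x => G0 x h)).
- by apply/measurable_EFinP; exact: measurable_funM.
move=> h _; have mD : measurable_fun setT (fun x => (z x - z (h + x)) ^+ 2).
  apply: measurable_funX; apply: measurable_funB => //.
  exact: (measurableT_comp mzh (@measurable_pair2 _ _ _ _ h)).
have hc0 : 0 <= (close e 0 h)%:R :> R by [].
have := ge0_intZ leb hc0 (fun x => sqr_ge0 (z x - z (h + x))) mD.
rewrite /G => ->; case: (boolP (close e 0 h)) => [/forallP ch|_]; last first.
  by rewrite mul0e mulr0.
rewrite mul1e mulr1; apply: (test_shift_le tz) => i.
by have := ch i; rewrite mxE sub0r normrN; exact: ltW.
Qed.

End test_functions.

(** The ratio is [2^(2s - 2)]: the kernel grows by [2^(d + 2s)] from shell to shell, while the
    oscillation of a test function shrinks by [2^-(d + 2)]. Here [s < 1] makes the energy of test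
    functions finite. *)
Lemma dyadic_ratio_lt1 (R : realType) (d : nat) (s : R) : s < 1 ->
  0 <= (2^-1 : R) `^ (- (d%:R + 2 * s)) * 2^-1 ^+ d * 2^-1 ^+ 2 < 1.
Proof.
move=> s1; rewrite !mulr_ge0 ?powR_ge0//=.
have r0 : (2^-1 : R) != 0 by rewrite invr_eq0.
rewrite -!powR_mulrn// -!powRD ?r0 ?implybT//.
rewrite (_ : - _ + _ + _ = 2 - 2 * s); last by ring.
suff : (2^-1 : R) `^ (2 - 2 * s) < 1 `^ (2 - 2 * s) by rewrite powR1.
apply: gt0_ltr_powR; rewrite ?nnegrE//.
  lra.
by rewrite invf_lt1// ltr1n.
Qed.

Lemma powR_expn (R : realType) (a t : R) k : 0 <= a -> (a ^+ k) `^ t = (a `^ t) ^+ k.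
Proof. by move=> a0; rewrite -(powR_mulrn k a0) -(powR_mulrn k (powR_ge0 a t)) powRAC. Qed.

Lemma coord_le_enorm (R : realType) (d : nat) (x : 'rV[R]_d) i : `|x ord0 i| <= enorm x.
Proof.
rewrite -sqrtr_sqr; apply: ler_wsqrtr; rewrite (bigD1 i)//= lerDl.
by apply: sumr_ge0 => j _; exact: sqr_ge0.
Qed.

Lemma shell_identity (R : comPzRingType) (q h n g : R) (d k : nat) :
  q ^+ k.+1 * ((4 * h ^+ k) ^+ d * (n * (2 * h ^+ k) ^+ 2) * g) =
  q * (4 ^+ d * (n * 4)) * g * (q * h ^+ d * h ^+ 2) ^+ k.
Proof.
rewrite !exprMn (exprAC h k d) exprS.
by move: ((h ^+ d) ^+ k) (h ^+ k) (q ^+ k) (4 ^+ d) => *; ring.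
Qed.

Section test_gagliardo.
Context (R : realType) (d : nat) (Omega : lipschitz_domain R d).
Local Notation test := (test_function (Omega : set 'rV[R]_d)).
Local Notation vol := (volf Omega).

(* Dyadic shells: on [2^-(k+1) < |x - y| <= 2^-k] the kernel is at most the k-th term. *)
Lemma gkern_le_series (s : R) (z : 'rV[R]_d -> R) x y : 0 < s ->
  ((gkern s z x y)%:E <= \sum_(0 <= k <oo) (((2^-1 : R) `^ (- (d%:R + 2 * s)) ^+ k.+1 *
    ((close (2 * 2^-1 ^+ k) x y)%:R * (z x - z y) ^+ 2))%R)%:E +
    ((z x - z y) ^+ 2)%:E)%E.
Proof.
move=> s0; set D := d%:R + 2 * s.
pose a k : \bar R := ((2^-1 : R) `^ (- D) ^+ k.+1 *
    ((close (2 * 2^-1 ^+ k) x y)%:R * (z x - z y) ^+ 2))%:E.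
change ((gkern s z x y)%:E <= \sum_(0 <= k <oo) a k + ((z x - z y) ^+ 2)%:E)%E.
have D0 : 0 < D by rewrite ltr_wpDl// mulr_gt0.
have a0 k : (0 <= a k)%E.
  by rewrite lee_fin mulr_ge0 ?exprn_ge0 ?powR_ge0// mulr_ge0// sqr_ge0.
have S0 : (0 <= \sum_(0 <= k <oo) a k)%E by apply: nneseries_ge0 => k _ _; exact: a0.
have z0 : (0 <= ((z x - z y) ^+ 2)%:E)%E by rewrite lee_fin sqr_ge0.
have [xy|xy] := eqVneq (enorm (x - y)) 0.
  have -> : x = y by apply/eqP; rewrite -subr_eq0; apply/eqP; exact: enorm_eq0.
  by rewrite /gkern subrr !mul0r adde_ge0.
have t0 : 0 < enorm (x - y) by rewrite lt_neqAle eq_sym xy enorm_ge0.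
(* Beyond distance 1 the kernel weight is at most 1, which accounts for the last summand of the
   bound. *)
have [t1|t1] := leP (enorm (x - y)) 1; last first.
  apply: (@le_trans _ _ ((z x - z y) ^+ 2)%:E); last by rewrite leeDr.
  rewrite lee_fin /gkern -expr2 ler_piMr ?sqr_ge0// invf_le1 ?powR_gt0//.
  have : (1 : R) `^ D <= enorm (x - y) `^ D.
    by apply: ge0_ler_powR; rewrite ?nnegrE ?enorm_ge0// ltW.
  by rewrite powR1.
have t01 : 0 < enorm (x - y) <= 1 by rewrite t0 t1.
have [k /andP[k1 k2]] := dyadic_le1 t01.
apply: (@le_trans _ _ (a k)); last first.
  apply: le_trans (nneseries_term_le k a0) _.
  by rewrite leeDl.
(* The radius is doubled because [close] is strict, whereas the shell contains its outer
   boundary. *)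
have ck : close (2 * 2^-1 ^+ k) x y.
  apply/forallP => i; have := coord_le_enorm (x - y) i; rewrite !mxE => h.
  apply: le_lt_trans (le_trans h k2) _.
  by rewrite ltr_pMl ?ltr1n// exprn_gt0// invr_gt0.
rewrite /a ck mul1r lee_fin /gkern -expr2 mulrC ler_wpM2r ?sqr_ge0//.
rewrite -powR_expn ?invr_ge0// powRN lef_pV2 ?posrE ?powR_gt0 ?exprn_gt0 ?invr_gt0//.
by apply: ge0_ler_powR; rewrite ?nnegrE ?enorm_ge0 ?exprn_ge0 ?invr_ge0// ltW.
Qed.

(** The norm used to define [Hs0] reads an infinite energy as zero, so the parallelogram estimates
    for differences with test functions need this first. *)
Lemma gag_test_lty (s : R) z : 0 < s -> s < 1 -> test z ->
  (gagliardo vol s z z < +oo)%E.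
Proof.
move=> s0 s1 tz; have mz := test_measurable tz.
set q : R := 2^-1 `^ (- (d%:R + 2 * s)).
pose e k : R := 2 * 2^-1 ^+ k.
have e0 k : 0 < e k by rewrite mulr_gt0// exprn_gt0// invr_gt0.
have q0 : 0 <= q by exact: powR_ge0.
pose P k x y : R := q ^+ k.+1 * ((close (e k) x y)%:R * (z x - z y) ^+ 2).
have mP k : measurable2 (P k) by apply: measurable_funM => //; exact: measurable2_Dq.
have P0 k x y : 0 <= P k x y.
  by apply: mulr_ge0; [exact: exprn_ge0|exact: Dq_ge0].
pose N (x y : 'rV[R]_d) : R := (z x - z y) ^+ 2.
have mN : measurable2 N by apply: measurable_funX; exact: measurable2_diff.
have N0 x y : 0 <= N x y by exact: sqr_ge0.
rewrite gagliardoE dintE; last 2 first.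
- exact: measurable2_gkern.
- exact: gkern_ge0.
have mS : measurable_fun setT (fun p : 'rV[R]_d * 'rV[R]_d =>
    (\sum_(0 <= k <oo) (P k p.1 p.2)%:E)%E).
  apply: ge0_emeasurable_sum => [k p _ _|k _]; first by rewrite lee_fin.
  exact: measurable2_EFin.
apply: (@le_lt_trans _ _ (\int[vol \x vol]_p
    (\sum_(0 <= k <oo) (P k p.1 p.2)%:E + (N p.1 p.2)%:E))%E).
  apply: ge0_le_integral => //.
  - by move=> p _; rewrite lee_fin; exact: gkern_ge0.
  - exact: (measurable2_EFin (measurable2_gkern s mz)).
  - by apply: emeasurable_funD => //; exact: measurable2_EFin.
  - by move=> p _; exact: gkern_le_series.
rewrite ge0_integralD//; last 3 first.
- by move=> p _; apply: nneseries_ge0 => k _ _; rewrite lee_fin.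
- by move=> p _; rewrite lee_fin.
- exact: measurable2_EFin.
rewrite integral_nneseries//; last 2 first.
- by move=> k; exact: measurable2_EFin.
- by move=> k p _; rewrite lee_fin.
rewrite -(dintE _ mN N0); apply: lte_add_pinfty.
  pose c : R := q * (4 ^+ d * (d%:R * 4)) * grad_ip Omega z.
  have c0 : 0 <= c.
    apply: mulr_ge0; last exact: grad_ip_ge0.
    by apply: mulr_ge0 => //; rewrite !mulr_ge0// exprn_ge0.
  apply: le_lt_trans (geometric_eseries_lty c0 (dyadic_ratio_lt1 d s1)).
  apply: lee_nneseries => [k _ _|k _].
    by apply: integral_ge0 => p _; rewrite lee_fin.
  rewrite -(dintE _ (mP k) (P0 k)) /P dintZ//; last 3 first.
  - exact: exprn_ge0.
  - exact: measurable2_Dq.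
  - exact: Dq_ge0.
  have qk : (0 <= (q ^+ k.+1)%:E)%E by rewrite lee_fin exprn_ge0.
  apply: le_trans (lee_wpmul2l qk (Dq_test_le (e0 k) tz)) _.
  rewrite -EFinM lee_fin -/q /c /e le_eqVlt; apply/orP; left; apply/eqP.
  rewrite (_ : 2 * (2 * 2^-1 ^+ k) = 4 * 2^-1 ^+ k :> R); last by ring.
  exact: shell_identity.
have [M zM] := test_le tz.
pose B : R := (2 * M) ^+ 2.
have h : (dint vol N <= dint vol (fun _ _ => B))%E.
  apply: dint_le => [//||x y]; first exact: measurable_cst.
  rewrite N0 /N /B -(real_normK (num_real (_ - _))).
  rewrite ler_pXn2r ?nnegrE//.
    by apply: le_trans (ler_normB _ _) _; rewrite (mulrDl 1 1 M) mul1r lerD.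
  by rewrite mulr_ge0// (le_trans _ (zM 0)).
apply: le_lt_trans h _.
have B0 : (0 <= B%:E)%E by rewrite lee_fin sqr_ge0.
have fin := vol_lty Omega.
have E (c : \bar R) : (0 <= c)%E -> (c < +oo)%E -> (\int[vol]_x c < +oo)%E.
  by move=> c0 cf; rewrite integral_cst// lte_mul_pinfty// ge0_fin_numE.
apply: (E); last by apply: (E) => //; rewrite ltry.
by apply: integral_ge0.
Qed.

End test_gagliardo.

(** * Compactness and closedness for the Gagliardo spaces *)

Lemma frac_const_gt0 (R : realType) (d : nat) (s : R) : 0 < s -> s < 1 ->
  0 < frac_const d s.
Proof.
move=> s0 s1; apply: divr_gt0.
  apply: mulr_gt0; first by rewrite mulr_gt0// powR_gt0.
  by apply: gamma_fun_gt0; rewrite ltr_wpDr// divr_ge0.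
by rewrite mulr_gt0 ?powR_gt0 ?pi_gt0//; apply: gamma_fun_gt0; rewrite subr_gt0.
Qed.

Lemma small_power (R : realType) (K c t : R) : 0 <= K -> 0 < c -> 0 < t ->
  exists2 e0 : R, 0 < e0 & forall e, 0 < e < e0 -> K * e `^ t <= c.
Proof.
move=> K0 c0 t0; have K1 : 0 < K + 1 by rewrite ltr_wpDl.
exists ((c / (K + 1)) `^ t^-1); first by rewrite powR_gt0// divr_gt0.
move=> e /andP[e0 ee].
have : e `^ t <= ((c / (K + 1)) `^ t^-1) `^ t.
  by apply: ge0_ler_powR; rewrite ?nnegrE ?powR_ge0// ltW.
rewrite -powRrM mulVf ?gt_eqF// powRr1 ?divr_ge0// ?(ltW c0) ?(ltW K1)//.
rewrite ler_pdivlMr// => h; apply: le_trans h.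
by rewrite mulrC ler_wpM2l ?powR_ge0// lerDl.
Qed.

(** Intervals around [l] are stable under midpoints, so the hull sequence inherits the pointwise
    limit. *)
Lemma hull_cvg (R : realType) (d : nat) (w z : nat -> 'rV[R]_d -> R) (x : 'rV[R]_d) (l : R) :
  (forall n, mid_hull (@mid R d) (tail w n) (z n)) ->
  w k x @[k --> \oo] --> l -> z n x @[n --> \oo] --> l.
Proof.
move=> zw /cvgn_epsP wl; apply/cvgn_epsP => e e0; have [N hN] := wl e e0.
exists N => n Nn; pose B : set ('rV[R]_d -> R) := [set v | `|v x - l| <= e].
apply: (@mid_hull_sub _ (@mid R d) (tail w n) B _ _ (z n) (zw n)) => [_ [k nk <-]|u v] /=.
  by apply: hN; exact: leq_trans nk.
rewrite /B /= /mid !ler_norml => /andP[? ?] /andP[? ?]; apply/andP; split; lra.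
Qed.

Lemma para_le (R : realType) (q1 q2 q3 q4 : R) :
  q3 = 2 * q1 + 2 * q2 - 4 * q4 -> 0 <= q4 -> q3 <= 2 * q1 + 2 * q2.
Proof. by move=> -> *; lra. Qed.

Lemma para_sym (R : realType) (q1 q2 q3 q3' q4 : R) :
  q3 = 2 * q1 + 2 * q2 - 4 * q4 -> q3' = 2 * q2 + 2 * q1 - 4 * q4 -> q3 = q3'.
Proof. by move=> -> ->; ring. Qed.

Lemma two_quarters_le (R : realType) (a b e : R) :
  a <= e / 4 -> b <= e / 4 -> 2 * a + 2 * b <= e.
Proof. by move=> *; lra. Qed.

Section domain_closedness.
Context (R : realType) (d : nat) (Omega : lipschitz_domain R d) (s : R).
Hypotheses (s_gt0 : 0 < s) (s_lt1 : s < 1).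
Local Notation leb := (lebesgue_rV R d).
Local Notation vol := (volf Omega).
Local Notation test := (test_function (Omega : set 'rV[R]_d)).
Implicit Types (u v w : 'rV[R]_d -> R).

Let c_gt0 : 0 < frac_const d s := frac_const_gt0 d s_gt0 s_lt1.

Lemma compact_power (w : nat -> 'rV[R]_d -> R) (M K t : R) : 0 <= K -> 0 < t ->
  (forall k, w k \in Lfun vol 2%:E) -> (forall k, ip vol (w k) (w k) <= M) ->
  (forall e k, 0 < e -> (Dq vol e (w k) <= ((2 * e) ^+ d * (K * e `^ t))%:E)%E) ->
  exists2 phi, incr phi & exists2 g, measurable_fun setT g &
    {ae vol, forall x, w (phi k) x @[k --> \oo] --> (g x : R)}.
Proof.
move=> K0 t0 wL wM wD; apply: (compact_in_measure (volf_close_ae Omega) wL wM).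
move=> c c0; have [e0 e00 he0] := small_power K0 c0 t0.
exists e0 => // e ee k; have /andP[e1 _] := ee.
apply: le_trans (wD e k e1) _; rewrite lee_fin ler_wpM2l ?he0//.
by rewrite exprn_ge0// mulr_ge0// ltW.
Qed.

Lemma Hs_compact (w : nat -> 'rV[R]_d -> R) C :
  (forall k, Hs vol s (w k)) -> (forall k, Hsq vol s (w k) <= C) ->
  exists2 phi, incr phi & exists2 g, measurable_fun setT g &
    {ae vol, forall x, w (phi k) x @[k --> \oo] --> (g x : R)}.
Proof.
move=> wH wC; set c := frac_const d s / 2.
have c0 : 0 < c by apply: mulr_gt0 => //; rewrite invr_gt0.
have ip0 k := ip_ge0 vol (w k).
have fg0 k : 0 <= fine (gagliardo vol s (w k) (w k)) by exact/fine_ge0/gag_ge0.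
have aC k : ip vol (w k) (w k) + c * fine (gagliardo vol s (w k) (w k)) <= C.
  exact: wC.
have C0 : 0 <= C by apply: le_trans (aC 0%N); rewrite addr_ge0// mulr_ge0// ltW.
(* The power [2^-d] converts the [e^d] of [Dq_gag] into the [(2e)^d] that [compact_power] asks for;
   [C / c] bounds the Gagliardo energy. *)
pose K := 2 `^ (- d%:R) * Num.sqrt d%:R `^ (d%:R + 2 * s) * (C / c).
have K0 : 0 <= K.
  by apply: mulr_ge0; [rewrite mulr_ge0 ?powR_ge0|rewrite divr_ge0// ltW].
apply: (compact_power (M := C) K0 (t := 2 * s)) => [|k|k|e k e0].
- by rewrite mulr_gt0.
- exact: (wH k).1.
- by apply: le_trans (aC k); rewrite lerDl mulr_ge0// ltW.
have [mw _ gk] := (HsP _ _ _).1 (wH k).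
apply: le_trans (Dq_gag vol e0 s_gt0 mw) _.
have gf : gagliardo vol s (w k) (w k) \is a fin_num by rewrite ge0_fin_numE// gag_ge0.
rewrite -(fineK gf) -EFinM lee_fin.
have -> : (2 * e) ^+ d * (K * e `^ (2 * s)) =
    (e * Num.sqrt d%:R) `^ (d%:R + 2 * s) * (C / c).
  rewrite powRM ?sqrtr_ge0// ?(ltW e0)// powRD; last first.
    by apply/implyP => _; rewrite gt_eqF.
  rewrite powR_mulrn ?(ltW e0)// /K powRN powR_mulrn// exprMn.
  have : (2 : R) ^+ d != 0 by rewrite expf_neq0.
  move: (2 ^+ d) (e ^+ d) (e `^ _) (_ `^ _) (C / c) => a *; field => //.
rewrite ler_wpM2l ?powR_ge0// ler_pdivlMr// mulrC; apply: le_trans (aC k).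
by rewrite lerDr.
Qed.

Lemma Hsq_distC u v : Hs vol s u -> Hs vol s v ->
  Hsq vol s (fun x => u x - v x) = Hsq vol s (fun x => v x - u x).
Proof.
move=> hu hv; have E : mid v u = mid u v by apply/funext => x; rewrite /mid addrC.
have E1 := Hsq_para hu hv; have := Hsq_para hv hu; rewrite E => E2.
exact: para_sym E1 E2.
Qed.

Lemma HsqB_le u v : Hs vol s u -> Hs vol s v ->
  Hsq vol s (fun x => u x - v x) <= 2 * Hsq vol s u + 2 * Hsq vol s v.
Proof.
move=> hu hv; exact: para_le (Hsq_para hu hv) (Hsq_ge0 vol c_gt0 (mid u v)).
Qed.

Lemma test_Hs z : test z -> Hs vol s z.
Proof. by move=> tz; split; [exact: test_L2|exact: gag_test_lty]. Qed.

Lemma Hs0_Hs w : Hs0 Omega s w -> Hs vol s w.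
Proof. by case. Qed.

Lemma Hs0_test w e : Hs0 Omega s w -> 0 < e ->
  exists2 v, test v & Hsq vol s (fun x => w x - v x) <= e.
Proof. by move=> [_ h] /h[v tv hv]; exists v => //; exact: ltW hv. Qed.

Lemma Hs0I w : Hs vol s w ->
  (forall e, 0 < e -> exists2 v, test v & Hsq vol s (fun x => w x - v x) <= e) ->
  Hs0 Omega s w.
Proof.
move=> hw h; split => // e e0; have e2 : 0 < e / 2 by rewrite divr_gt0.
have [v tv hv] := h _ e2; exists v => //; apply: le_lt_trans hv _.
by rewrite ltr_pdivrMr// ltr_pMr// ltr1n.
Qed.

Lemma Hs0_mid u v : Hs0 Omega s u -> Hs0 Omega s v -> Hs0 Omega s (mid u v).
Proof.
move=> hu hv; have Hu := Hs0_Hs hu; have Hv := Hs0_Hs hv.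
apply: (Hs0I (Hs_mid Hu Hv)) => e e0.
have [a ta ha] := Hs0_test hu e0; have [b tb hb] := Hs0_test hv e0.
exists (mid a b); first exact: testZ (testD ta tb).
rewrite (_ : (fun x => _) = mid (fun x => u x - a x) (fun x => v x - b x)).
  exact: (Hsq_mid_le c_gt0 (HsB Hu (test_Hs ta)) (HsB Hv (test_Hs tb)) ha hb).
by apply/funext => x; rewrite /mid; ring.
Qed.

Lemma Hs_closed (w : nat -> 'rV[R]_d -> R) g C :
  (forall k, Hs vol s (w k)) -> (forall k, Hsq vol s (w k) <= C) ->
  measurable_fun setT g -> {ae vol, forall x, w k x @[k --> \oo] --> (g x : R)} ->
  Hs vol s g /\ Hsq vol s g <= C.
Proof. by move=> wH wC mg wg; exact: (Hs_fatou c_gt0 wH wC mg wg). Qed.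

(** The sequence need not converge in norm, but midpoint hulls of its tails are Cauchy in [H^s] and
    stay in the space. Fatou's lemma bounds the distance of one of them to [g], and a test function
    near that hull element is then near [g]. *)
Lemma Hs0_closed (w : nat -> 'rV[R]_d -> R) g C :
  (forall k, Hs0 Omega s (w k)) -> (forall k, Hsq vol s (w k) <= C) ->
  measurable_fun setT g -> {ae vol, forall x, w k x @[k --> \oo] --> (g x : R)} ->
  Hs0 Omega s g /\ Hsq vol s g <= C.
Proof.
move=> wH wC mg wg.
have [gH gC] := Hs_closed (fun k => Hs0_Hs (wH k)) wC mg wg.
split; last exact: gC.
apply: (Hs0I gH) => e e0.
have [z [zw zc]] := @mazur_cauchy R _ (@mid R d) (Hs0 Omega s) (Hsq vol s)
  (fun u v => Hsq vol s (fun x => u x - v x)) w C Hs0_mid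
  (fun u _ => Hsq_ge0 vol c_gt0 u) (fun u v _ _ => Hsq_ge0 vol c_gt0 _)
  (fun u v hu hv => Hsq_para (Hs0_Hs hu) (Hs0_Hs hv)) wH wC.
have zH n : Hs0 Omega s (z n).
  by apply: (mid_hull_sub _ Hs0_mid (zw n)) => _ [k _ <-]; exact: wH.
have e4 : 0 < e / 4 by rewrite divr_gt0.
have [N hN] := zc _ e4.
have zNm m : measurable_fun setT (z m) by have [] := (HsP _ _ _).1 (Hs0_Hs (zH m)).
have [gN1 gN2] : Hs vol s (fun x => g x - z N x) /\ Hsq vol s (fun x => g x - z N x) <= e / 4.
  apply: (Hs_fatou c_gt0 (f := fun m x => z (m + N)%N x - z N x)).
  - by move=> k; apply: HsB; exact: Hs0_Hs.
  - by move=> k; apply: hN => //; exact: leq_addl.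
  - exact: measurable_funB.
  apply: filterS wg => x /(hull_cvg zw) hx; apply: cvgB; last exact: cvg_cst.
  by rewrite (cvg_shiftn N (fun n => z n x)).
have [v tv hv] := Hs0_test (zH N) e4; exists v => //.
have Hv := test_Hs tv; have HN := Hs0_Hs (zH N).
rewrite (_ : (fun x => _) = (fun x => (g x - z N x) - (v x - z N x))); last first.
  by apply/funext => x; ring.
have Hd := HsB Hv HN.
apply: le_trans (HsqB_le gN1 Hd) _.
apply: two_quarters_le gN2 (le_trans _ hv).
by rewrite (Hsq_distC Hv HN).
Qed.

Lemma ae_vol_leb (P : 'rV[R]_d -> Prop) : {ae vol, forall x, P x} ->
  {ae leb, forall x, (Omega : set _) x -> P x}.
Proof.
move=> [N [mN N0 PN]]; exists (N `&` (Omega : set _)); split => //.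
  by apply: measurableI => //; exact: measurable_domain.
by move=> x /not_implyP[Ox Px]; split => //; exact: PN.
Qed.

Lemma tildeHs_Hs w : tildeHs Omega s w -> Hs vol s w /\ Hsq vol s w <= Hsq leb s w.
Proof.
move=> [wH _]; have [mw wL wg] := (HsP _ _ _).1 wH.
have mw2 : measurable_fun setT (fun x => (w x ^+ 2)%:E).
  by apply/measurable_EFinP; exact: measurable_funX.
have L : (sqint vol w <= sqint leb w)%E.
  by apply: (integral_vol_le Omega mw2) => x; rewrite lee_fin sqr_ge0.
have G : (gagliardo vol s w w <= gagliardo leb s w w)%E.
  by rewrite !gagliardoE; apply: dint_vol_le; [exact: measurable2_gkern|exact: gkern_ge0].
have wV : Hs vol s w.
  by apply/HsP; split => //; [exact: le_lt_trans L wL|exact: le_lt_trans G wg].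
split => //; rewrite !HsqE; apply: lerD.
  by rewrite -lee_fin -!ip_sqint//; [exact: wH.1|exact: wV.1].
apply: ler_wpM2l; first by rewrite divr_ge0// ltW.
by apply: fine_le => //; rewrite ge0_fin_numE ?gag_ge0//; exact: wV.2.
Qed.

(** Off the domain all terms and [g] vanish almost everywhere, so convergence on the domain extends
    to the whole space, where the norm lives. *)
Lemma tildeHs_closed (w : nat -> 'rV[R]_d -> R) (g : 'rV[R]_d -> R) C :
  (forall k, tildeHs Omega s (w k)) -> (forall k, Hsq leb s (w k) <= C) ->
  measurable_fun setT g -> (forall x, ~ (Omega : set _) x -> g x = 0) ->
  {ae vol, forall x, w k x @[k --> \oo] --> (g x : R)} ->
  tildeHs Omega s g /\ Hsq leb s g <= C.
Proof.
move=> wH wC mg g0 wg.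
have wg' : {ae leb, forall x, w k x @[k --> \oo] --> (g x : R)}.
  have w0 := ae_foralln (fun k => (wH k).2).
  apply: filterS2 w0 (ae_vol_leb wg) => x w0 wgx.
  have [/wgx//|Ox] := pselect ((Omega : set _) x).
  rewrite g0// (_ : (fun k => w k x) = fun=> 0); first exact: cvg_cst.
  by apply/funext => k; exact: w0.
have [gH gC] := Hs_fatou c_gt0 (fun k => (wH k).1) wC mg wg'.
by split => //; split => //; apply: aeW => x; exact: g0.
Qed.

End domain_closedness.

(** * Spectral spaces *)

Section orthonormal.
Context d (T : measurableType d) (R : realType).
Variable mu : {measure set T -> \bar R}.
Local Notation L2 := (Lfun mu 2%:E).
Implicit Types (u v w h : T -> R) (f : nat -> T -> R) (c : nat -> R).

Definition lincomb c f N : T -> R := fun x => \sum_(n < N) c n * f n x.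

Lemma lincomb0 c f : lincomb c f 0 = fun=> 0.
Proof. by apply/funext => x; rewrite /lincomb big_ord0. Qed.

Lemma lincombS c f N : lincomb c f N.+1 = fun x => lincomb c f N x + c N * f N x.
Proof. by apply/funext => x; rewrite /lincomb big_ord_recr. Qed.

Lemma Lfun2_lincomb c f N : (forall n, f n \in L2) -> lincomb c f N \in L2.
Proof.
move=> fL; elim: N => [|N IH]; first by rewrite lincomb0; exact: Lfun2_0.
by rewrite lincombS; apply: Lfun2D => //; exact: Lfun2Z.
Qed.

Lemma ip0l h : ip mu (fun=> 0) h = 0.
Proof.
rewrite /ip /Rintegral (eq_integral (cst 0%E)) ?integral0// => x _.
by rewrite mul0r.
Qed.

Lemma ip_lincombl c f N h : (forall n, f n \in L2) -> h \in L2 ->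
  ip mu (lincomb c f N) h = \sum_(n < N) c n * ip mu (f n) h.
Proof.
move=> fL hL; elim: N => [|N IH]; first by rewrite lincomb0 big_ord0 ip0l.
have fcL : lincomb c f N \in L2 by exact: Lfun2_lincomb.
by rewrite lincombS big_ord_recr/= ipDl ?ipZl ?IH//; exact: Lfun2Z.
Qed.

Lemma ip_lincomb2 c f N : (forall n, f n \in L2) ->
  ip mu (lincomb c f N) (lincomb c f N) =
  \sum_(m < N) \sum_(n < N) c m * (c n * ip mu (f m) (f n)).
Proof.
move=> fL; have cL := Lfun2_lincomb c N fL.
rewrite ip_lincombl//; apply: eq_bigr => m _.
rewrite ipC ip_lincombl// mulr_sumr; apply: eq_bigr => n _.
by rewrite ipC.
Qed.

Lemma sum_diag c (l : nat -> R) N :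
  \sum_(m < N) \sum_(n < N) c m * (c n * (l n * (m == n :> nat)%:R)) =
  \sum_(n < N) l n * c n ^+ 2 :> R.
Proof.
apply: eq_bigr => m _; rewrite (bigD1 m)//= eqxx mulr1 big1 ?addr0.
  by rewrite mulrA mulrC expr2.
move=> n nm; rewrite (_ : (_ == _) = false) ?mulr0//.
by apply/negbTE; rewrite eq_sym.
Qed.

Lemma ipDD u v : u \in L2 -> v \in L2 ->
  ip mu (fun x => u x + v x) (fun x => u x + v x) =
  ip mu u u + 2 * ip mu u v + ip mu v v.
Proof.
move=> uL vL; have uvL := Lfun2D uL vL.
rewrite ipDl// (ipC _ u (fun x => _)) (ipC _ v (fun x => _)) !ipDl// (ipC _ v u).
by move: (ip mu u u) (ip mu u v) (ip mu v v) => *; ring.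
Qed.

Lemma ipZZ a u : u \in L2 ->
  ip mu (fun x => a * u x) (fun x => a * u x) = a ^+ 2 * ip mu u u.
Proof.
by move=> uL; rewrite ipZl ?(ipC _ u) ?ipZl ?mulrA//; exact: Lfun2Z.
Qed.

Lemma ipBB u v : u \in L2 -> v \in L2 ->
  ip mu (fun x => u x - v x) (fun x => u x - v x) =
  ip mu u u - 2 * ip mu u v + ip mu v v.
Proof.
move=> uL vL; have nvL := Lfun2Z (-1) vL.
have -> : (fun x => u x - v x) = (fun x => u x + -1 * v x).
  by apply/funext => x; rewrite mulN1r.
rewrite ipDD// ipZZ// (ipC _ u) ipZl// (ipC _ v u).
by move: (ip mu u u) (ip mu u v) (ip mu v v) => *; ring.
Qed.

(** Sharper than [ip_le] by a factor 2: [weak_ip_le] uses it at [t = 1] and would lose the exact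
    constant otherwise. *)
Lemma ip_le2 u v t : u \in L2 -> v \in L2 -> 0 < t ->
  2 * ip mu u v <= t * ip mu u u + t^-1 * ip mu v v.
Proof.
move=> uL vL t0; have := ip_ge0 mu (fun x => t * u x - v x).
rewrite ipBB ?ipZZ ?ipZl//; last exact: Lfun2Z.
move: (ip mu u u) (ip mu u v) (ip mu v v) => a b c h.
rewrite -(ler_pM2l t0) mulrDr [t * (_^-1 * _)]mulrA divff ?gt_eqF//.
nra.
Qed.

Lemma ipD_le u v : u \in L2 -> v \in L2 ->
  ip mu (fun x => u x + v x) (fun x => u x + v x) <= 2 * ip mu u u + 2 * ip mu v v.
Proof.
move=> uL vL; rewrite ipDD//; have := ip_le2 uL vL ltr01.
by move: (ip mu u u) (ip mu u v) (ip mu v v) => *; lra.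
Qed.

Lemma ipB_le u v : u \in L2 -> v \in L2 ->
  ip mu (fun x => u x - v x) (fun x => u x - v x) <= 2 * ip mu u u + 2 * ip mu v v.
Proof.
move=> uL vL; have := ipD_le uL (Lfun2Z (-1) vL); rewrite ipZZ// sqrrN expr1n mul1r.
by under [X in ip mu X X]eq_fun do rewrite mulN1r.
Qed.

Variable phi : nat -> T -> R.
Hypothesis phiL : forall n, phi n \in L2.
Hypothesis phi_on : forall m n, ip mu (phi m) (phi n) = (m == n)%:R.

Definition coef w n : R := ip mu w (phi n).

Definition rest w N : T -> R := fun x => w x - lincomb (coef w) phi N x.

Lemma ip_lincomb_on c N : ip mu (lincomb c phi N) (lincomb c phi N) = \sum_(n < N) c n ^+ 2.
Proof.
rewrite ip_lincomb2//.
under eq_bigr do under eq_bigr do rewrite phi_on -[(_ == _)%:R]mul1r.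
by have /= -> := sum_diag c (fun=> 1) N; apply: eq_bigr => n _; rewrite mul1r.
Qed.

Lemma restL w N : w \in L2 -> rest w N \in L2.
Proof. by move=> wL; apply: Lfun2B => //; exact: Lfun2_lincomb. Qed.

Lemma bessel w N : w \in L2 ->
  ip mu (rest w N) (rest w N) = ip mu w w - \sum_(n < N) coef w n ^+ 2.
Proof.
move=> wL; have cL := Lfun2_lincomb (coef w) N phiL.
rewrite ipBB// ip_lincomb_on ipC ip_lincombl//.
under eq_bigr do rewrite ipC -expr2.
by set S := \sum_(n < N) _; lra.
Qed.

Lemma rest_le w N : w \in L2 -> ip mu (rest w N) (rest w N) <= ip mu w w.
Proof.
by move=> wL; rewrite bessel// lerBlDr lerDl sumr_ge0// => n _; exact: sqr_ge0.
Qed.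

Lemma coefD u v n : u \in L2 -> v \in L2 ->
  coef (fun x => u x + v x) n = coef u n + coef v n.
Proof. by move=> uL vL; exact: ipDl. Qed.

Lemma coefZ a u n : u \in L2 -> coef (fun x => a * u x) n = a * coef u n.
Proof. by move=> uL; exact: ipZl. Qed.

Lemma restD u v N : u \in L2 -> v \in L2 ->
  rest (fun x => u x + v x) N = fun x => rest u N x + rest v N x.
Proof.
move=> uL vL; apply/funext => x; rewrite /rest /lincomb.
under eq_bigr do rewrite coefD// mulrDl.
by rewrite big_split/=; ring.
Qed.

Lemma restZ a u N : u \in L2 ->
  rest (fun x => a * u x) N = fun x => a * rest u N x.
Proof.
move=> uL; apply/funext => x; rewrite /rest /lincomb.
under eq_bigr do rewrite coefZ// -mulrA.
by rewrite -mulr_sumr mulrBr.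
Qed.

End orthonormal.

(** Lets the error of an approximation by test functions, or of a truncated expansion, tend to zero
    in a final estimate. *)
Lemma ler_eps (R : realType) (x A B : R) : 0 <= B ->
  (forall e, 0 < e -> x <= A + B * e) -> x <= A.
Proof.
move=> B0 h; rewrite leNgt; apply/negP => Ax.
have B1 : 0 < B + 1 by rewrite ltr_wpDl.
have e0 : 0 < (x - A) / (B + 1) by rewrite divr_gt0// subr_gt0.
have := h _ e0; have : B * ((x - A) / (B + 1)) < x - A.
  by rewrite mulrA ltr_pdivrMr// mulrC ltr_pM2l ?subr_gt0// ltrDl.
by move: (B * _) => t; lra.
Qed.

Lemma split_bound (R : realType) (E n a g b G : R) :
  0 <= E -> 0 <= n -> b <= a -> g <= 2 * G + 2 * a ->
  2 * (E * n * g) + 2 * (4 * E * b) <= E * (4 * n * G + (8 + 4 * n) * a).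
Proof.
move=> E0 n0 ba gG.
have h1 : n * g <= n * (2 * G + 2 * a) by rewrite ler_wpM2l.
have h2 : E * (2 * (n * g) + 8 * b) <= E * (2 * (n * (2 * G + 2 * a)) + 8 * a).
  by rewrite ler_wpM2l//; lra.
by apply: le_trans (le_trans _ h2) _; rewrite le_eqVlt; apply/orP; left; apply/eqP; ring.
Qed.

Lemma four_quarters_le (R : realType) (a b a1 b1 a2 b2 e : R) :
  a <= 2 * a1 + 2 * a2 -> b <= 2 * b1 + 2 * b2 ->
  a1 + b1 <= e / 4 -> a2 + b2 <= e / 4 -> a + b <= e.
Proof. by move=> *; lra. Qed.

Lemma poincare_bound (R : realType) (P a b c g e : R) : 0 <= P ->
  a <= P * c -> b <= e -> c <= 2 * g + 2 * e ->
  2 * a + 2 * b <= 4 * P * g + (2 + 4 * P) * e.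
Proof.
move=> P0 ac be cg; have : P * c <= P * (2 * g + 2 * e) by rewrite ler_wpM2l.
by rewrite mulrDr mulrCA [P * (2 * e)]mulrCA; move: (P * c) => t; nra.
Qed.

(** * Approximation by test functions together with gradients *)

Section gradient_approximation.
Context (R : realType) (d : nat) (Omega : lipschitz_domain R d).
Local Notation vol := (volf Omega).
Local Notation test := (test_function (Omega : set 'rV[R]_d)).
Local Notation L2 := (Lfun vol 2%:E).
Implicit Types (v w z : 'rV[R]_d -> R) (G H : 'I_d -> 'rV[R]_d -> R).

Definition gip G H : R := \sum_i ip vol (G i) (H i).

(** The approximation property contained in [H10]. It passes to linear combinations, so estimates
    known for test functions reach finite sums of eigenfunctions. *)
Definition grad_approx v G :=
  [/\ v \in L2, forall i, G i \in L2 &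
    forall e, 0 < e -> exists2 z, test z &
      ip vol (fun x => v x - z x) (fun x => v x - z x) +
      gip (fun i x => G i x - partial i z x) (fun i x => G i x - partial i z x) <= e].

Lemma H10_grad_approx v G : H10 Omega v G -> grad_approx v G.
Proof.
move=> [[vL GL _] h]; split => // e /h[z tz hz].
by exists z => //; exact: ltW hz.
Qed.

Lemma gip_ge0 G : 0 <= gip G G.
Proof. by apply: sumr_ge0 => i _; exact: ip_ge0. Qed.

Lemma gipD_le G H : (forall i, G i \in L2) -> (forall i, H i \in L2) ->
  gip (fun i x => G i x + H i x) (fun i x => G i x + H i x) <= 2 * gip G G + 2 * gip H H.
Proof.
move=> GL HL; rewrite /gip !mulr_sumr -big_split/=; apply: ler_sum => i _.
exact: ipD_le.
Qed.

Lemma gipB_le G H : (forall i, G i \in L2) -> (forall i, H i \in L2) ->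
  gip (fun i x => G i x - H i x) (fun i x => G i x - H i x) <= 2 * gip G G + 2 * gip H H.
Proof.
move=> GL HL; rewrite /gip !mulr_sumr -big_split/=; apply: ler_sum => i _.
exact: ipB_le.
Qed.

Lemma gipZZ a G : (forall i, G i \in L2) ->
  gip (fun i x => a * G i x) (fun i x => a * G i x) = a ^+ 2 * gip G G.
Proof. by move=> GL; rewrite /gip mulr_sumr; apply: eq_bigr => i _; exact: ipZZ. Qed.

Lemma grad_approx_le v G e : grad_approx v G -> 0 < e ->
  exists2 z, test z & ip vol (fun x => v x - z x) (fun x => v x - z x) <= e /\
    grad_ip Omega z <= 2 * gip G G + 2 * e.
Proof.
move=> [vL GL h] /h[z tz hz]; exists z => //.
set D := fun i x => G i x - partial i z x in hz.
have pL i : partial i z \in L2 by exact: test_L2 (test_partial i tz).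
have DL i : D i \in L2 by exact: Lfun2B.
have h1 := gip_ge0 D.
have h2 := ip_ge0 vol (fun x => v x - z x).
split; first by apply: le_trans hz; rewrite lerDl.
have E : grad_ip Omega z = gip (fun i x => G i x - D i x) (fun i x => G i x - D i x).
  apply: eq_bigr => i _; rewrite (_ : (fun x => _) = partial i z)//.
  by apply/funext => x; rewrite /D; ring.
rewrite E; apply: le_trans (gipB_le GL DL) _.
rewrite lerD2l ler_pM2l//; apply: le_trans hz.
by rewrite lerDr.
Qed.

(** The inequality holds for an approximating test function; splitting [v] and then its gradient
    costs a factor 2 each, hence the 4. *)
Lemma grad_approx_poincare P v G : 0 <= P ->
  (forall z, test z -> ip vol z z <= P * grad_ip Omega z) ->
  grad_approx v G -> ip vol v v <= 4 * P * gip G G.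
Proof.
move=> P0 hP vG; have [vL GL _] := vG.
apply: (@ler_eps _ _ _ (2 + 4 * P)) => [|e e0]; first by rewrite addr_ge0// mulr_ge0.
have [z tz [hz gz]] := grad_approx_le vG e0.
have zL := test_L2 tz.
have := ipD_le zL (Lfun2B vL zL).
rewrite (_ : (fun x => z x + (v x - z x)) = v); last first.
  by apply/funext => x; rewrite addrC subrK.
move=> h; apply: le_trans h _; exact: poincare_bound (hP _ tz) hz gz.
Qed.

(** Split [v] into a test function, bounded by [Dq_test_le], and a remainder small in L^2, bounded
    by [Dq_L2]; then let the remainder vanish. *)
Lemma grad_approx_Dq e v G : 0 < e -> grad_approx v G ->
  (Dq vol e v <= ((2 * e) ^+ d * (4 * d%:R * e ^+ 2 * gip G G))%:E)%E.
Proof.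
move=> e0 vG; have [vL GL _] := vG; have mv := Lfun2_measurable vL.
have E0 : 0 <= (2 * e) ^+ d by rewrite exprn_ge0// mulr_ge0// ltW.
set n : R := d%:R * e ^+ 2.
have n0 : 0 <= n by rewrite mulr_ge0// sqr_ge0.
have key a : 0 < a -> (Dq vol e v <= ((2 * e) ^+ d * (4 * n * gip G G + (8 + 4 * n) * a))%:E)%E.
  move=> a0; have [z tz [hz gz]] := grad_approx_le vG a0.
  have zL := test_L2 tz; have mz := test_measurable tz.
  have dL := Lfun2B vL zL; have md := Lfun2_measurable dL.
  have vE : v = fun x => z x + (v x - z x) by apply/funext => x; rewrite addrC subrK.
  rewrite {1}vE; apply: le_trans (DqD vol e mz md) _.
  have h1 := Dq_test_le e0 tz.
  have h2 := Dq_L2 (volf_close Omega) e0 md.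
  rewrite (ip_sqint dL) -EFinM in h2.
  have two : (0 <= 2%:E :> \bar R)%E by rewrite lee_fin.
  apply: le_trans (leeD (lee_wpmul2l two h1) (lee_wpmul2l two h2)) _.
  rewrite -!EFinM -EFinD lee_fin -/n; exact: split_bound.
have Gf : 0 <= gip G G := gip_ge0 G.
have B0 : 0 <= (2 * e) ^+ d * (8 + 4 * n) by rewrite mulr_ge0// addr_ge0// mulr_ge0.
have fin : Dq vol e v \is a fin_num.
  rewrite ge0_fin_numE; last by apply: dint_ge0; exact: Dq_ge0.
  exact: le_lt_trans (key 1 ltr01) (ltry _).
rewrite -(mulrA 4) -/n -(fineK fin) lee_fin; apply: (ler_eps B0) => a a0.
by have := key a a0; rewrite -(fineK fin) lee_fin mulrDr (mulrA _ _ a).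
Qed.

Lemma grad_approxD u v G H : grad_approx u G -> grad_approx v H ->
  grad_approx (fun x => u x + v x) (fun i x => G i x + H i x).
Proof.
move=> [uL GL hu] [vL HL hv]; split; [exact: Lfun2D|by move=> i; exact: Lfun2D|].
move=> e e0; have e4 : 0 < e / 4 by rewrite divr_gt0.
have [y ty hy] := hu _ e4; have [z tz hz] := hv _ e4.
exists (fun x => y x + z x); first exact: testD.
set D := (fun i x => G i x - partial i y x) in hy.
set D' := (fun i x => H i x - partial i z x) in hz.
have yL i : partial i y \in L2 by exact: test_L2 (test_partial i ty).
have zL i : partial i z \in L2 by exact: test_L2 (test_partial i tz).
have DL i : D i \in L2 by exact: Lfun2B.
have DL' i : D' i \in L2 by exact: Lfun2B.
have dL := Lfun2B uL (test_L2 ty); have dL' := Lfun2B vL (test_L2 tz).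
have E1 : (fun x => u x + v x - (y x + z x)) = (fun x => (u x - y x) + (v x - z x)).
  by apply/funext => x; ring.
have E2 : (fun i x => G i x + H i x - partial i (fun x => y x + z x) x) =
   (fun i x => D i x + D' i x).
  apply/funext => i; apply/funext => x.
  by rewrite (partialD _ (test_smooth ty) (test_smooth tz)) /D /D'; ring.
rewrite E1 E2; have h1 := ipD_le dL dL'; have h2 := gipD_le DL DL'.
exact: four_quarters_le h1 h2 hy hz.
Qed.

Lemma grad_approxZ a u G : grad_approx u G ->
  grad_approx (fun x => a * u x) (fun i x => a * G i x).
Proof.
move=> [uL GL hu]; split; [exact: Lfun2Z|by move=> i; exact: Lfun2Z|].
move=> e e0; have a1 : 0 < a ^+ 2 + 1 by rewrite ltr_wpDl// sqr_ge0.
have e1 : 0 < e / (a ^+ 2 + 1) by rewrite divr_gt0.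
have [z tz hz] := hu _ e1; exists (fun x => a * z x); first exact: testZ.
have zL i : partial i z \in L2 by exact: test_L2 (test_partial i tz).
have E1 : (fun x => a * u x - a * z x) = (fun x => a * (u x - z x)).
  by apply/funext => x; ring.
have E2 : (fun i x => a * G i x - partial i (fun x => a * z x) x) =
   (fun i x => a * (G i x - partial i z x)).
  apply/funext => i; apply/funext => x.
  by rewrite (partialZ _ _ (test_smooth tz)); ring.
have dL := Lfun2B uL (test_L2 tz).
have DL i : (fun x => G i x - partial i z x) \in L2 by exact: Lfun2B.
rewrite E1 E2 ipZZ// (gipZZ a DL) -mulrDr.
apply: le_trans (ler_wpM2l (sqr_ge0 a) hz) _.
by rewrite mulrCA ger_pMr// ler_pdivrMr// mul1r lerDl.
Qed.

Lemma grad_approx0 : grad_approx (fun=> 0) (fun _ _ => 0).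
Proof.
split; [exact: Lfun2_0|by move=> i; exact: Lfun2_0|].
move=> e e0; exists (fun=> 0); first exact: test0.
have E : (fun _ : 'rV[R]_d => 0 - 0 : R) = fun=> 0 by apply/funext => x; rewrite subrr.
rewrite E ip0l add0r /gip big1 ?ltW// => i _.
rewrite (_ : (fun x => _) = fun=> 0) ?ip0l//.
by apply/funext => x; rewrite /partial derive_cst subrr.
Qed.

End gradient_approximation.

Lemma spectral_split (R : realType) (E0 n a2 S1 S2 A C ih ir e : R) :
  a2 * S1 <= A * C -> S2 <= A * C -> ih <= 2 * S2 + 2 * ir -> ir <= e ->
  0 <= E0 -> 0 <= n -> 
  2 * (E0 * (4 * n * a2 * S1)) + 2 * (4 * E0 * ih) <=
  E0 * ((8 * n + 16) * C * A) + E0 * 16 * e.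
Proof.
move=> h1 h2 h3 h4 E00 n0; have h5 : n * (a2 * S1) <= n * (A * C) by rewrite ler_wpM2l.
have h6 : 8 * (n * (a2 * S1)) + 8 * ih <= 8 * (n * (A * C)) + 16 * (A * C) + 16 * e.
  by lra.
apply: le_trans (le_trans _ (ler_wpM2l E00 h6)) _.
  by rewrite le_eqVlt; apply/orP; left; apply/eqP; ring.
by rewrite le_eqVlt; apply/orP; left; apply/eqP; ring.
Qed.

Lemma mid_square_le (R : realType) (a b c : R) : a <= 2 * b + 2 * c ->
  2^-1 ^+ 2 * a <= 2^-1 * (b + c).
Proof. by move=> h; lra. Qed.

(** * Eigenfunction expansions and balls of the spectral space *)

Section spectral.
Context (R : realType) (d : nat) (Omega : lipschitz_domain R d).
Variable E : dirichlet_eigensystem Omega.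
Local Notation vol := (volf Omega).
Local Notation L2 := (Lfun vol 2%:E).
Local Notation phi := (eigenfun E).
Local Notation lam := (eigenval E).
Local Notation coef := (coef vol phi).
Local Notation rest := (rest vol phi).
Implicit Types (u v w : 'rV[R]_d -> R).

(** The weak eigenvalue equation for one eigenfunction, tested with another, makes the gradients
    orthogonal as well. *)
Lemma eigen_grads : exists G : nat -> 'I_d -> 'rV[R]_d -> R,
  (forall n, grad_approx Omega (phi n) (G n)) /\
  forall m n, gip Omega (G m) (G n) = lam m * (m == n)%:R.
Proof.
have h n : exists G, H10 Omega (phi n) G /\ forall z Z, H10 Omega z Z ->
    gip Omega G Z = lam n * ip vol (phi n) z.
  by have [G h1 h2] := eigenP E n; exists G.
have [G hG] := choice h; exists G; split => [n|m n].
  exact: H10_grad_approx (hG n).1.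
by rewrite ((hG m).2 _ _ (hG n).1); congr (_ * _); exact: eigen_orthonormal.
Qed.

Let phiL n : phi n \in L2.
Proof. by have [G [/(_ n)[]]] := eigen_grads. Qed.

Let phi_on m n : ip vol (phi m) (phi n) = (m == n)%:R.
Proof. exact: eigen_orthonormal. Qed.

(** Poincare's inequality for a normalized eigenfunction reads [1 <= 4 P lam n]. A uniform lower
    bound lets the spectral norm control the L^2 norm. *)
Lemma eigenval_ge : (0 < d)%N -> exists2 l0, 0 < l0 & forall n, l0 <= lam n.
Proof.
move=> d0; have [P P0 hP] := poincare Omega d0.
have [G [aG gG]] := eigen_grads.
exists (4 * P)^-1 => [|n]; first by rewrite invr_gt0 mulr_gt0.
have := grad_approx_poincare (ltW P0) hP (aG n).
rewrite phi_on gG eqxx mulr1 => h.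
by rewrite -[leLHS]mul1r ler_pdivrMr ?mulr_gt0// mulrC.
Qed.

Lemma lincomb_grad (G : nat -> 'I_d -> 'rV[R]_d -> R) (c : nat -> R) N :
  (forall n, grad_approx Omega (phi n) (G n)) ->
  (forall m n, gip Omega (G m) (G n) = lam m * (m == n)%:R) ->
  exists2 H, grad_approx Omega (lincomb c phi N) H &
    gip Omega H H = \sum_(n < N) lam n * c n ^+ 2.
Proof.
move=> aG gG; exists (fun i => lincomb c (fun n => G n i) N).
  elim: N => [|N IH].
    rewrite lincomb0 (_ : (fun i => _) = fun _ _ => 0); first exact: grad_approx0.
    by apply/funext => i; rewrite lincomb0.
  rewrite lincombS (_ : (fun i => _) =
    (fun i x => lincomb c (fun n => G n i) N x + c N * G N i x)); last first.
    by apply/funext => i; rewrite lincombS.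
  by apply: grad_approxD => //; exact: grad_approxZ.
have GL i n : G n i \in L2 by have [_ + _] := aG n; exact.
rewrite /gip; under eq_bigr do rewrite (ip_lincomb2 _ _ (GL _)).
rewrite exchange_big/= -(sum_diag c lam N); apply: eq_bigr => m _.
rewrite exchange_big/=; apply: eq_bigr => n _.
rewrite -mulr_sumr -mulr_sumr; congr (_ * (_ * _)).
by apply: etrans (gG m n) _; case: eqP => [->|_]; rewrite ?mulr0.
Qed.

Hypothesis d_gt0 : (0 < d)%N.
Variable s : R.
Hypotheses (s_gt0 : 0 < s) (s_lt1 : s < 1).

Definition psum w N : R := \sum_(n < N) lam n `^ s * coef w n ^+ 2.

(** The elements of squared norm at most [C]. Bounding all partial sums avoids carrying the
    convergence of the series, and each bound involves finitely many coefficients, which suits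
    passing to limits. *)
Definition spectral_ball (C : R) : set ('rV[R]_d -> R) :=
  [set w | [/\ w \in L2, ip vol (rest w N) (rest w N) @[N --> \oo] --> (0 : R) &
    forall N, psum w N <= C]].

Let term_ge0 w n : 0 <= lam n `^ s * coef w n ^+ 2.
Proof. by rewrite mulr_ge0 ?powR_ge0 ?sqr_ge0. Qed.

Let seriesE w : series (fun n => lam n `^ s * eigen_coef E w n ^+ 2) = psum w.
Proof. by apply/funext => N; rewrite /series /= big_mkord. Qed.

Let series2E w :
  series (fun n => lam n `^ s * eigen_coef E w n * eigen_coef E w n) = psum w.
Proof.
by rewrite -seriesE; congr series; apply/funext => n; rewrite expr2 mulrA.
Qed.

Let psum_nd w : nondecreasing_seq (psum w).
Proof.
rewrite -seriesE; apply: nondecreasing_series => n _ _; exact: term_ge0.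
Qed.

Lemma spectral_ballI w C : spectralHs E s w -> spectralHs_ip E s w w <= C ->
  spectral_ball C w.
Proof.
move=> [wL wr wc] wC; split => // N; apply: le_trans wC.
rewrite /spectralHs_ip series2E; apply: nondecreasing_cvgn_le; first exact: psum_nd.
by rewrite -seriesE.
Qed.

Lemma spectral_ballE w C : spectral_ball C w ->
  spectralHs E s w /\ 0 <= spectralHs_ip E s w w <= C.
Proof.
move=> [wL wr wC].
have cv : cvgn (psum w).
  apply: nondecreasing_is_cvgn; first exact: psum_nd.
  by exists C => _ [N _ <-].
split; first by split => //; rewrite seriesE.
rewrite /spectralHs_ip series2E; apply/andP; split; last first.
  by apply: limr_le => //; exact: nearW.
apply: limr_ge => //; apply: nearW => N; apply: sumr_ge0 => n _; exact: term_ge0.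
Qed.

Lemma spectral_ball_ge0 w C : spectral_ball C w -> 0 <= C.
Proof. by move=> [_ _ /(_ 0%N)]; rewrite /psum big_ord0. Qed.

Lemma spectral_ball0 : spectral_ball 0 (fun=> 0).
Proof.
have c0 n : coef (fun=> 0) n = 0 by exact: ip0l.
split; first exact: Lfun2_0.
- rewrite (_ : (fun N => _) = fun=> 0); first exact: cvg_cst.
  apply/funext => N; rewrite (_ : rest _ N = fun=> 0) ?ip0l//.
  apply/funext => x; rewrite /rest /lincomb big1 ?subr0// => n _.
  by rewrite c0 mul0r.
- by move=> N; rewrite /psum big1// => n _; rewrite c0 expr0n mulr0.
Qed.

Let rest_small w C e : spectral_ball C w -> 0 < e ->
  exists N, ip vol (rest w N) (rest w N) <= e.
Proof.
move=> [_ /cvgn_epsP h _] /h[N hN]; exists N.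
by have := hN N (leqnn N); rewrite subr0 ger0_norm// ip_ge0.
Qed.

(** By [bessel] the L^2 norm is the sum of squared coefficients plus a remainder; weighting by
    [lam n / l0 >= 1] to the power [s] only enlarges the sum. *)
Lemma spectral_L2 : exists2 K, 0 <= K &
  forall C w, spectral_ball C w -> ip vol w w <= K * C.
Proof.
have [l0 l00 hl] := eigenval_ge d_gt0.
exists (l0 `^ s)^-1 => [|C w wC]; first by rewrite invr_ge0 powR_ge0.
have [wL _ wp] := wC.
apply: (@ler_eps _ _ _ 1) => // e e0; have [N hN] := rest_small wC e0.
rewrite mul1r; move: hN; rewrite bessel// lerBlDl => h; apply: le_trans h _.
rewrite lerD2r; apply: (@le_trans _ _ ((l0 `^ s)^-1 * psum w N)); last first.
  by rewrite ler_wpM2l// invr_ge0 powR_ge0.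
rewrite mulr_sumr; apply: ler_sum => n _; rewrite mulrA ler_peMl ?sqr_ge0//.
rewrite mulrC ler_pdivlMr ?powR_gt0// mul1r.
have l0n := hl n; have ln : 0 <= lam n by apply: le_trans l0n; exact: ltW.
by apply: ge0_ler_powR; rewrite ?nnegrE// ltW.
Qed.

(* Modes with [lam n * a ^+ 2 <= 1] are controlled by their gradient, the others
   by their L^2 norm. *)
Lemma spectral_Dq C w a : spectral_ball C w -> 0 < a ->
  (Dq vol a w <= ((2 * a) ^+ d * ((8 * d%:R + 16) * C * a `^ (2 * s)))%:E)%E.
Proof.
move=> wC a0; have [wL _ wp] := wC; have C0 := spectral_ball_ge0 wC.
have mw := Lfun2_measurable wL.
have [l0 l00 hl] := eigenval_ge d_gt0.
have lam0 n : 0 < lam n by exact: lt_le_trans l00 (hl n).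
have [G [aG gG]] := eigen_grads.
set E0 := (2 * a) ^+ d.
have E00 : 0 <= E0 by rewrite exprn_ge0// mulr_ge0// ltW.
have as0 : 0 <= a `^ (2 * s) by exact: powR_ge0.
pose low n := lam n * a ^+ 2 <= 1.
pose c1 n := if low n then coef w n else 0.
pose c2 n := if low n then 0 else coef w n.
have tE n : (lam n * a ^+ 2) `^ s = a `^ (2 * s) * lam n `^ s.
  rewrite powRM ?sqr_ge0// ?(ltW (lam0 n))// mulrC; congr (_ * _).
  by rewrite powRrM (powR_mulrn 2)// ltW.
(* For a low mode [t = lam n * a^2] is at most 1, so [t <= t^s]. *)
have b1 n : a ^+ 2 * (lam n * c1 n ^+ 2) <= a `^ (2 * s) * (lam n `^ s * coef w n ^+ 2).
  rewrite /c1; case: ifP => [ln|_]; last by rewrite expr0n/= !mulr0 mulr_ge0.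
  rewrite [leLHS]mulrA [leRHS]mulrA -tE ler_wpM2r ?sqr_ge0// mulrC.
  have t0 : 0 < lam n * a ^+ 2 by rewrite mulr_gt0 ?exprn_gt0.
  rewrite -[leLHS]powRr1 ?(ltW t0)//; apply: ger_powR; last exact: ltW.
  by rewrite t0.
(* For a high mode [t >= 1], so [1 <= t^s]. *)
have b2 n : c2 n ^+ 2 <= a `^ (2 * s) * (lam n `^ s * coef w n ^+ 2).
  rewrite /c2; case: ifPn => [_|ln]; first by rewrite expr0n/= mulr_ge0.
  rewrite mulrA ler_peMl ?sqr_ge0// -tE.
  have t1 : 1 <= lam n * a ^+ 2 by rewrite ltW// ltNge.
  by rewrite -[leLHS](powRr0 (lam n * a ^+ 2)); apply: ler_powR => //; exact: ltW.
have S1 N : a ^+ 2 * (\sum_(n < N) lam n * c1 n ^+ 2) <= a `^ (2 * s) * C.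
  apply: (@le_trans _ _ (a `^ (2 * s) * psum w N)); last exact: ler_wpM2l.
  by rewrite !mulr_sumr; apply: ler_sum => n _.
have S2 N : \sum_(n < N) c2 n ^+ 2 <= a `^ (2 * s) * C.
  apply: (@le_trans _ _ (a `^ (2 * s) * psum w N)); last exact: ler_wpM2l.
  by rewrite !mulr_sumr; apply: ler_sum => n _.
(* Low part plus high part and remainder: [2 * 4 d] comes from the gradient bound of the former, and
   [2 * 4 * 2 = 16] from the L^2 bound of the latter two. *)
have key e : 0 < e ->
    (Dq vol a w <= (E0 * ((8 * d%:R + 16) * C * a `^ (2 * s)) + E0 * 16 * e)%:E)%E.
  move=> e0; have [N hN] := rest_small wC e0.
  have [H aH gH] := lincomb_grad c1 N aG gG.
  set v := lincomb c1 phi N in aH; set h := lincomb c2 phi N.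
  have vL : v \in L2 by exact: Lfun2_lincomb.
  have hL : h \in L2 by exact: Lfun2_lincomb.
  have rL : rest w N \in L2 by exact: restL.
  have rhL := Lfun2D hL rL.
  have wE : w = fun x => v x + (h x + rest w N x).
    apply/funext => x; rewrite /v /h /rest.
    have -> : lincomb (coef w) phi N x = lincomb c1 phi N x + lincomb c2 phi N x.
      rewrite /lincomb -big_split/=; apply: eq_bigr => n _; rewrite -mulrDl /c1 /c2.
      by case: ifP => _; rewrite ?addr0 ?add0r.
    by move: (lincomb c1 phi N x) (lincomb c2 phi N x) => *; ring.
  rewrite {1}wE; apply: le_trans (DqD vol a (Lfun2_measurable vL) (Lfun2_measurable rhL)) _.
  have h1 := grad_approx_Dq a0 aH.
  have h2 := Dq_L2 (volf_close Omega) a0 (Lfun2_measurable rhL).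
  rewrite (ip_sqint rhL) -EFinM in h2.
  have two : (0 <= 2%:E :> \bar R)%E by rewrite lee_fin.
  apply: le_trans (leeD (lee_wpmul2l two h1) (lee_wpmul2l two h2)) _.
  rewrite -!EFinM -EFinD lee_fin -/E0 gH.
  have h3 := ipD_le hL rL; rewrite ip_lincomb_on// in h3.
  exact: (spectral_split (S1 N) (S2 N) h3 hN E00 (ler0n R d)).
have fin : Dq vol a w \is a fin_num.
  rewrite ge0_fin_numE; last by apply: dint_ge0; exact: Dq_ge0.
  exact: le_lt_trans (key 1 ltr01) (ltry _).
have B0 : 0 <= E0 * 16 by rewrite mulr_ge0.
rewrite -(fineK fin) lee_fin; apply: (ler_eps B0) => e e0.
by have := key e e0; rewrite -(fineK fin) lee_fin.
Qed.

Lemma spectral_compact (w : nat -> 'rV[R]_d -> R) C : (forall k, spectral_ball C (w k)) ->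
  exists2 f, incr f & exists2 g, measurable_fun setT g &
    {ae vol, forall x, w (f k) x @[k --> \oo] --> (g x : R)}.
Proof.
move=> wC; have C0 := spectral_ball_ge0 (wC 0%N).
have [K K0 hK] := spectral_L2.
apply: (@compact_power _ _ Omega w (K * C) ((8 * d%:R + 16) * C) (2 * s)).
- by rewrite mulr_ge0// addr_ge0// mulr_ge0.
- by rewrite mulr_gt0.
- by move=> k; have [] := wC k.
- by move=> k; exact: hK.
- by move=> e k e0; exact: spectral_Dq.
Qed.

Lemma spectral_ball_mid C u v : spectral_ball C u -> spectral_ball C v ->
  spectral_ball C (mid u v).
Proof.
move=> [uL ur uC] [vL vr vC]; have uvL := Lfun2D uL vL.
split; first exact: Lfun2Z.
- have b0 N : 0 <= ip vol (rest (mid u v) N) (rest (mid u v) N) <=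
      2^-1 * (ip vol (rest u N) (rest u N) + ip vol (rest v N) (rest v N)).
    rewrite ip_ge0 /mid restZ// restD// ipZZ; last by apply: Lfun2D; exact: restL.
    have := ipD_le (restL phiL N uL) (restL phiL N vL).
    exact: mid_square_le.
  apply: (@squeeze_cvgr _ _ _ _ (fun=> 0) (fun N => 2^-1 *
    (ip vol (rest u N) (rest u N) + ip vol (rest v N) (rest v N)))) => //.
  + exact: nearW.
  + exact: cvg_cst.
  + have := cvgM (cvg_cst (2^-1 : R)) (cvgD ur vr); rewrite addr0 mulr0; exact.
- move=> N; apply: (@le_trans _ _ (2^-1 * (psum u N + psum v N))); last first.
    by move: (uC N) (vC N) => *; lra.
  rewrite /psum -big_split/= mulr_sumr; apply: ler_sum => n _.
  rewrite -mulrDr (mulrCA 2^-1) ler_wpM2l ?powR_ge0//.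
  rewrite /mid coefZ// coefD//; move: (coef u n) (coef v n) => x y.
  by have := sqr_ge0 (x - y); nra.
Qed.

(** Almost everywhere convergence says nothing about coefficients. Midpoint hulls converge to [g] in
    L^2, so their coefficients converge, and the remainders of [g] are controlled through those of a
    single hull element. *)
Lemma spectral_closed (w : nat -> 'rV[R]_d -> R) g C :
  (forall k, spectral_ball C (w k)) -> measurable_fun setT g ->
  {ae vol, forall x, w k x @[k --> \oo] --> (g x : R)} -> spectral_ball C g.
Proof.
move=> wC mg wg; have [K K0 hK] := spectral_L2.
have BL u : spectral_ball C u -> u \in L2 by case.
have midL u v : u \in L2 -> v \in L2 -> mid u v \in L2.
  by move=> uL vL; apply: Lfun2Z; exact: Lfun2D.
have [z [zw zc]] := @mazur_cauchy R _ (@mid R d) (spectral_ball C) (fun u => ip vol u u)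
  (fun u v => ip vol (fun x => u x - v x) (fun x => u x - v x)) w (K * C)
  (@spectral_ball_mid C) (fun u _ => ip_ge0 vol u) (fun u v _ _ => ip_ge0 vol _)
  (fun u v hu hv => ip_para (BL _ hu) (BL _ hv)) wC (fun k => hK C _ (wC k)).
have zC n : spectral_ball C (z n).
  by apply: (mid_hull_sub _ (@spectral_ball_mid C) (zw n)) => _ [k _ <-]; exact: wC.
have zL n : z n \in L2 by exact: BL (zC n).
have zg : {ae vol, forall x, z n x @[n --> \oo] --> (g x : R)}.
  by apply: filterS wg => x; exact: hull_cvg.
have mz n : measurable_fun setT (z n) by exact: Lfun2_measurable.
have gL : g \in L2.
  apply/Lfun2P; split => //.
  apply: (@le_lt_trans _ _ (K * C)%:E); last by rewrite ltry.
  apply: (sqint_fatou mz mg zg) => n; rewrite (ip_sqint (zL n)) lee_fin.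
  exact: hK (zC n).
have gz e : 0 < e -> exists N, forall n, (N <= n)%N ->
    ip vol (fun x => g x - z n x) (fun x => g x - z n x) <= e.
  move=> e0; have [N hN] := zc e e0; exists N => n Nn.
  rewrite -lee_fin -ip_sqint; last exact: Lfun2B.
  apply: (sqint_fatou (f := fun m x => z (m + N)%N x - z n x)).
  - by move=> k; exact: measurable_funB.
  - exact: measurable_funB.
  - apply: filterS zg => x hx; apply: cvgB; last exact: cvg_cst.
    by rewrite (cvg_shiftn N (fun n => z n x)).
  - move=> k; rewrite (ip_sqint (Lfun2B (zL _) (zL _))) lee_fin.
    by apply: hN => //; exact: leq_addl.
have gE n : g = fun x => (g x - z n x) + z n x by apply/funext => x; rewrite subrK.
split => //.
- apply/cvgn_epsP => e e0; have e4 : 0 < e / 4 by rewrite divr_gt0.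
  have [n0 hn0] := gz _ e4; have hn := hn0 n0 (leqnn _).
  have [_ /cvgn_epsP/(_ _ e4)[N hN] _] := zC n0.
  exists N => m Nm; rewrite subr0 ger0_norm ?ip_ge0//.
  have dL := Lfun2B gL (zL n0).
  rewrite (gE n0) restD//; apply: le_trans (ipD_le (restL phiL m dL) (restL phiL m (zL n0))) _.
  (* Taking remainders does not increase the L^2 norm, so this holds for every truncation at
     once. *)
  have h1 := le_trans (rest_le phiL phi_on m dL) hn.
  have := hN m Nm; rewrite subr0 ger0_norm ?ip_ge0// => h2.
  exact: two_quarters_le h1 h2.
- move=> N.
  have cc n : coef (z k) n @[k --> \oo] --> coef g n.
    apply/cvgn_epsP => e e0.
    (* With this weight and squared distance [e^2 / 4], the two terms of [ip_le] are [e / 2] each,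
       as [phi n] is normalized. *)
    have t0 : 0 < 2 / e by rewrite divr_gt0.
    have e2 : 0 < e ^+ 2 / 4 by rewrite divr_gt0// exprn_gt0.
    have [k0 hk0] := gz _ e2; exists k0 => k kk.
    have dL := Lfun2B gL (zL k).
    rewrite distrC (_ : coef g n - coef (z k) n = ip vol (fun x => g x - z k x) (phi n)).
      apply: le_trans (ip_le dL (phiL n) t0) _; rewrite phi_on eqxx.
      apply: (@le_trans _ _ (2 / e * (e ^+ 2 / 4) + 1 / (2 / e))).
        by rewrite lerD2r; apply: ler_wpM2l (ltW t0) _ _ (hk0 k kk).
      by rewrite le_eqVlt; apply/orP; left; apply/eqP; field; rewrite gt_eqF.
    have h := ipDl dL (zL k) (phiL n); rewrite -(gE k) in h.
    by apply/eqP; rewrite subr_eq; apply/eqP; exact: h.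
  have pc : psum (z k) N @[k --> \oo] --> psum g N.
    apply: cvg_big => [|n _]; first exact: add_continuous.
    by apply: cvgM; [exact: cvg_cst|apply: cvgM; exact: cc].
  rewrite -(cvg_lim _ pc)//; apply: limr_le; first by apply/cvg_ex; exists (psum g N).
  by apply: nearW => k; have [_ _] := zC k; exact.
Qed.

End spectral.

(** * Compactness and closedness of the balls of the four spaces *)

Section interface.
Context (R : realType) (d : nat) (Omega : lipschitz_domain R d) (W : frac_space Omega).
Variable s : R.
Hypotheses (d_gt0 : (0 < d)%N) (s_gt0 : 0 < s) (s_lt1 : s < 1).
Local Notation vol := (volf Omega).
Local Notation q w := (frac_ip W s w w).
Implicit Types w : 'rV[R]_d -> R.

Let c_gt0 : 0 < frac_const d s := frac_const_gt0 d s_gt0 s_lt1.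

Lemma frac_L2 w : frac_set W s w -> w \in Lfun vol 2%:E.
Proof.
case: W => [|||e] /=.
- by move=> h; exact: h.1.
- by move=> h; exact: h.1.1.
- by move=> /(tildeHs_Hs s_gt0 s_lt1)[h _]; exact: h.1.
- by move=> [].
Qed.

Lemma frac_ip_ge0 w : frac_set W s w -> 0 <= q w.
Proof.
case: W => [|||e] /=; [by move=> _; exact: (Hsq_ge0 vol c_gt0 w)..| |].
- by move=> _; exact: (Hsq_ge0 (lebesgue_rV R d) c_gt0 w).
- by move=> h; have [_ /andP[]] := spectral_ballE (spectral_ballI h (lexx _)).
Qed.

Lemma frac_set0 : frac_set W s (fun=> 0).
Proof.
case: W => [|||e] /=.
- exact: (Hs_0 vol s).
- apply: Hs0I => [|e e0]; first exact: (Hs_0 vol s).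
  exists (fun=> 0); first exact: test0.
  rewrite (_ : (fun x => _) = fun=> 0); last by apply/funext => x; rewrite subrr.
  rewrite HsqE ip0l add0r (_ : gagliardo _ _ _ _ = 0%E) ?mulr0 ?ltW//.
  exact: gag_0.
- by split; [exact: Hs_0|exact: aeW].
- by have [] := spectral_ballE (spectral_ball0 e s).
Qed.

Lemma frac_compact (w : nat -> 'rV[R]_d -> R) C :
  (forall k, frac_set W s (w k)) -> (forall k, q (w k) <= C) ->
  exists2 phi, incr phi & exists2 g, measurable_fun setT g &
    {ae vol, forall x, w (phi k) x @[k --> \oo] --> (g x : R)}.
Proof.
case: W => [|||e] /= wH wC.
- exact: Hs_compact wH wC.
- exact: Hs_compact (fun k => (wH k).1) wC.
- have h k := tildeHs_Hs s_gt0 s_lt1 (wH k).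
  exact: Hs_compact (fun k => (h k).1) (fun k => le_trans (h k).2 (wC k)).
- exact: (spectral_compact d_gt0 s_gt0 s_lt1 (fun k => spectral_ballI (wH k) (wC k))).
Qed.

(** Convergence is given on the domain alone; the vanishing of [g] outside is what the tilde space,
    made of functions on the whole space, asks in addition. *)
Lemma frac_closed (w : nat -> 'rV[R]_d -> R) (g : 'rV[R]_d -> R) C :
  (forall k, frac_set W s (w k)) -> (forall k, q (w k) <= C) ->
  measurable_fun setT g -> (forall x, ~ (Omega : set _) x -> g x = 0) ->
  {ae vol, forall x, w k x @[k --> \oo] --> (g x : R)} ->
  frac_set W s g /\ q g <= C.
Proof.
case: W => [|||e] /= wH wC mg g0 wg.
- exact: (Hs_closed s_gt0 s_lt1 wH wC mg wg).
- exact: (Hs0_closed s_gt0 s_lt1 wH wC mg wg).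
- exact: (tildeHs_closed s_gt0 s_lt1 wH wC mg g0 wg).
- have := spectral_closed d_gt0 s_gt0 (fun k => spectral_ballI (wH k) (wC k)) mg wg.
  by move=> /spectral_ballE[? /andP[]].
Qed.

End interface.

(** * Existence of a minimizer *)

(** Away from zero the power is [exp(p ln t)], a composition of continuous functions; at a zero
    limit the logarithm fails and monotonicity of the power is used. *)
Lemma powR_norm_cvg (R : realType) (u : nat -> R) (l p : R) : 0 < p ->
  u @ \oo --> l -> `|u n| `^ p @[n --> \oo] --> `|l| `^ p.
Proof.
move=> p0 ul; have nl : `|u n| @[n --> \oo] --> `|l| by exact: cvg_norm.
have [l0|l0] := eqVneq `|l| 0.
  rewrite l0 powR0 ?gt_eqF//; apply/cvgn_epsP => e e0.
  (* If [|u n|] is at most [e^(1/p)], its power is at most [e]. *)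
  rewrite l0 in nl; have e1 : 0 < e `^ p^-1 by exact: powR_gt0.
  have [N hN] := (cvgn_epsP _ _).1 nl _ e1; exists N => n Nn.
  have := hN n Nn; rewrite !subr0 normr_id => h; rewrite ger0_norm ?powR_ge0//.
  have -> : e = (e `^ p^-1) `^ p by rewrite -powRrM mulVf ?gt_eqF// powRr1// ltW.
  by apply: ge0_ler_powR; rewrite ?nnegrE ?powR_ge0// ltW.
have lp : 0 < `|l| by rewrite lt_neqAle eq_sym l0 normr_ge0.
rewrite {2}/powR gt_eqF//.
have h : expR (p * ln `|u n|) @[n --> \oo] --> expR (p * ln `|l|).
  have h1 : ln `|u n| @[n --> \oo] --> ln `|l|.
    exact: (cvg_comp _ _ nl (continuous_ln lp)).
  have h2 : p * ln `|u n| @[n --> \oo] --> p * ln `|l|.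
    by apply: cvgM; [exact: cvg_cst|exact: h1].
  exact: (cvg_comp _ _ h2 (@continuous_expR R _)).
apply: cvg_trans h; apply: near_eq_cvg.
have : \forall n \near \oo, 0 < `|u n| by exact: (cvgr_gt _ nl).
by apply: filterS => n un; rewrite /powR gt_eqF.
Qed.

Lemma powR_le_sqr (R : realType) (t p : R) : 0 < p -> p < 1 -> 0 <= t ->
  t `^ p <= 1 + t ^+ 2.
Proof.
move=> p0 p1 t0; have [t1|t1] := leP t 1.
  apply: (@le_trans _ _ 1); last by rewrite lerDl sqr_ge0.
  have : t `^ p <= 1 `^ p by apply: ge0_ler_powR; rewrite ?nnegrE// ltW.
  by rewrite powR1.
apply: (@le_trans _ _ (t ^+ 2)); last by rewrite lerDr.
rewrite -powR_mulrn//; apply: ler_powR; first exact: ltW.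
by rewrite ltW// (lt_trans p1)// ltr1n.
Qed.

Lemma minimizing_sequence (R : realType) (V : Type) (D : set V) (J : V -> R) (m0 : R) :
  D !=set0 -> (forall v, D v -> m0 <= J v) ->
  exists m, (forall v, D v -> m <= J v) /\
    exists v : nat -> V, forall n, D (v n) /\ J (v n) <= m + n.+1%:R^-1.
Proof.
move=> [v0 Dv0] hJ; pose S := J @` D.
have Sl : has_lbound S by exists m0 => _ [v Dv <-]; exact: hJ.
have Si : has_inf S by split => //; exists (J v0); exists v0.
exists (inf S); split => [v Dv|]; first by apply: ge_inf => //; exists v.
have h n : exists v, D v /\ J v <= inf S + n.+1%:R^-1.
  have e0 : 0 < n.+1%:R^-1 :> R by rewrite invr_gt0.
  by have [_ [v Dv <-] /ltW ?] := inf_adherent e0 Si; exists v.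
by have [v hv] := choice h; exists v.
Qed.

(* Absorbs the affine minorant of f into the quadratic term. *)
Lemma coercive_bound (R : realType) (f g c n2 a K : R) : 0 < a -> 0 <= n2 ->
  g + c <= f -> `|g| <= K * Num.sqrt n2 ->
  c - K ^+ 2 / a + a / 4 * n2 <= f + a / 2 * n2.
Proof.
move=> a0 n0; rewrite -{2 3}(sqr_sqrtr n0); move: (Num.sqrt n2) (sqrtr_ge0 n2) => n n0'.
move=> gf; rewrite ler_norml => /andP[g1 _].
have key : K * n <= K ^+ 2 / a + a / 4 * n ^+ 2.
  have := sqr_ge0 (K - a / 2 * n); rewrite -[_ <= K ^+ 2 / a + _]subr_ge0.
  have -> : K ^+ 2 / a + a / 4 * n ^+ 2 - K * n = (K - a / 2 * n) ^+ 2 / a.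
    by field; rewrite gt_eqF.
  by move=> h; rewrite divr_ge0// ltW.
by move: (K ^+ 2 / a) key => k; move: (K * n) g1 => kn; move: (n ^+ 2) => s; lra.
Qed.

(** * The space-time cylinder *)

Section cylinder.
Context (R : realType) (d : nat) (Omega : lipschitz_domain R d) (T : R).
Hypothesis T_gt0 : 0 < T.
Local Notation cyl := (cyl_vol Omega T).

Lemma cyl_prod (A : set 'rV[R]_d) : measurable A ->
  cyl (setT `*` A) = (T%:E * vol Omega A)%E.
Proof.
pose I : set R := `]0, T[%classic.
have mI : @lebesgue_measure R I = T%:E.
  by rewrite lebesgue_measure_itv/= lte_fin T_gt0 sube0.
move=> mA; transitivity ((@lebesgue_measure R \x lebesgue_rV R d)%E
    (`]0, T[%classic `*` (A `&` (Omega : set 'rV[R]_d)))).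
  rewrite /cyl_vol /mrestr; congr ((_ \x _)%E _).
  apply/seteqP; split=> [[t x] [[_ Ax] [tT Ox]]|[t x] [tT [Ax Ox]]] //.
rewrite product_measure1E//; last by apply: measurableI => //; exact: measurable_domain.
exact: (congr1 (fun m => m * vol Omega A)%E mI).
Qed.

Lemma cyl_lty : (cyl setT < +oo)%E.
Proof.
rewrite -setXTT cyl_prod//; have := vol_lty Omega => h.
by rewrite lte_mul_pinfty// lee_fin ltW.
Qed.

Lemma ae_cyl (P : 'rV[R]_d -> Prop) : {ae vol Omega, forall x, P x} ->
  {ae cyl, forall z, P z.2}.
Proof.
move=> [N [mN N0 PN]]; exists (setT `*` N); split.
- exact: measurableX.
- by rewrite cyl_prod// N0 mule0.
- by move=> [t x] /= Px; split => //; exact: PN.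
Qed.

End cylinder.

Section limits.
Context d (T : measurableType d) (R : realType).
Variable mu : {measure set T -> \bar R}.
Hypothesis mu_fin : (mu setT < +oo)%E.
Local Notation V := (LfunType mu (lee1n 2)).

(* The bound passes to the midpoint hulls of the tails, hence to their strong limit. *)
Lemma limit_dominated (u z : nat -> V) (l : V) (b : nat -> T -> R) (g : T -> R) :
  {ae mu, forall x, forall k, `|u k x| <= b k x} ->
  {ae mu, forall x, b k x @[k --> \oo] --> (g x : R)} ->
  (forall n, mid_hull (@vmid _ _) (tail u n) (z n)) ->
  (forall e : R, 0 < e -> exists N, forall n, (N <= n)%N ->
    (sqint mu (fun x => z n x - l x)%R <= e%:E)%E) ->
  {ae mu, forall x, `|l x| <= g x}.
Proof.
move=> ub bg zu zl.
have zL n : (z n : T -> R) \in Lfun mu 2%:E := LfunP (z n).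
have lL : (l : T -> R) \in Lfun mu 2%:E := LfunP l.
have zlL n := Lfun2B (zL n) lL.
have zc (e : R) : 0 < e -> exists N, forall m n, (N <= m)%N -> (N <= n)%N ->
    (sqint mu (fun x => z m x - z n x)%R <= e%:E)%E.
  move=> e0; have e4 : 0 < e / 4 by rewrite divr_gt0.
  have [N hN] := zl _ e4; exists N => m n Nm Nn.
  have hm := hN m Nm; have hn := hN n Nn.
  have := ipB_le (zlL m) (zlL n).
  rewrite (_ : (fun x => z m x - l x - _) = (fun x => z m x - z n x)); last first.
    by apply/funext => x; ring.
  rewrite (ip_sqint (Lfun2B (zL m) (zL n))) lee_fin.
  rewrite (ip_sqint (zlL m)) lee_fin in hm; rewrite (ip_sqint (zlL n)) lee_fin in hn.
  by move=> h; apply: le_trans h _; exact: two_quarters_le hm hn.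
have mz n := Lfun2_measurable (zL n).
have ml := Lfun2_measurable lL.
have [phi hphi [l' ml' zl']] := sqint_subseq mu_fin mz zc.
(* The almost everywhere limit of a subsequence of the hulls must be identified with their L^2 limit
   [l] before the pointwise bound can be passed on. *)
have E0 : sqint mu (fun x => l' x - l x) = 0%E.
  apply/eqP; rewrite eq_le sqint_ge0 andbT; apply/lee_addgt0Pr => e e0; rewrite add0e.
  have [N hN] := zl _ e0.
  apply: (sqint_fatou (f := fun k x => z (phi (k + N)%N) x - l x)).
  - by move=> k; exact: measurable_funB.
  - exact: measurable_funB.
  - apply: filterS zl' => x hx; apply: cvgB; last exact: cvg_cst.
    by rewrite (cvg_shiftn N (fun n => z (phi n) x)).
  - move=> k; apply: hN; apply: leq_trans (incr_ge _ hphi); exact: leq_addl.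
have lE : {ae mu, forall x, l' x = l x}.
  have md : measurable_fun setT (fun x => ((l' x - l x) ^+ 2)%:E).
    by apply/measurable_EFinP; apply: measurable_funX; exact: measurable_funB.
  have /(ae_eq_integral_abs mu measurableT md) h :
      (\int[mu]_x `|((l' x - l x) ^+ 2)%:E| = 0)%E.
    rewrite -E0; apply: eq_integral => x _.
    by rewrite abse_EFin ger0_norm// sqr_ge0.
  apply: filterS h => x /(_ I) [] /eqP; rewrite sqrf_eq0 subr_eq0 => /eqP //.
apply: filterS2 (filterI ub bg) (filterI zl' lE) => x [ubx bgx] [zlx lx].
rewrite lx in zlx; apply/ler_addgt0Pr => e e0.
have [N hN] := (cvgn_epsP _ _).1 bgx _ e0.
have zn n : (N <= n)%N -> `|z n x| <= g x + e.
  move=> Nn; pose B : set V := [set v | `|(v : T -> R) x| <= g x + e].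
  apply: (@mid_hull_sub _ (@vmid _ _) (tail u n) B _ _ (z n) (zu n)) => [_ [k nk <-]|a c] /=.
    apply: le_trans (ubx k) _; have := hN k (leq_trans Nn nk).
    by rewrite ler_norml => /andP[_ ?]; lra.
  rewrite /B /=; change (`|(a : T -> R) x| <= g x + e -> `|(c : T -> R) x| <= g x + e ->
    `|2^-1 * ((a : T -> R) x + (c : T -> R) x)| <= g x + e).
  by rewrite !ler_norml => /andP[? ?] /andP[? ?]; apply/andP; split; lra.
have cn : `|z (phi n) x| @[n --> \oo] --> `|l x| by exact: cvg_norm.
rewrite -(cvg_lim _ cn)//; apply: limr_le; first by apply/cvg_ex; exists `|l x|.
exists N => // n /= Nn; apply: zn; apply: leq_trans Nn _; exact: incr_ge.
Qed.

(* Test the weak convergence against the limit itself. *)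
Lemma weak_ip_le (u : nat -> V) (l : V) (A : R) :
  weak_cvg (fun v : V => fine ('N[mu]_2%:E [EFin \o v])%E) u l ->
  ip mu (u k) (u k) @[k --> \oo] --> A -> ip mu l l <= A.
Proof.
move=> ul uA; have lL : (l : T -> R) \in Lfun mu 2%:E := LfunP l.
have h : ip mu (u k) l @[k --> \oo] --> ip mu l l := ul _ (ip_with_bounded lL).
have h2 : 2 * ip mu (u k) l @[k --> \oo] --> 2 * ip mu l l.
  by apply: cvgM; [exact: cvg_cst|exact: h].
have h3 : ip mu (u k) (u k) + ip mu l l @[k --> \oo] --> A + ip mu l l.
  by apply: cvgD; [exact: uA|exact: cvg_cst].
suff : 2 * ip mu l l <= A + ip mu l l by move: (ip mu l l) => t; lra.
rewrite -(cvg_lim _ h2)// -(cvg_lim _ h3)//; apply: ler_lim.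
- by apply/cvg_ex; exists (2 * ip mu l l).
- by apply/cvg_ex; exists (A + ip mu l l).
apply: nearW => k; have := ip_le2 (LfunP (u k)) lL ltr01.
by rewrite mul1r invr1 mul1r.
Qed.

Lemma measurable_powR_norm (w : T -> R) (p : R) : measurable_fun setT w ->
  measurable_fun setT (fun x => `|w x| `^ p).
Proof.
move=> mw; apply: (measurableT_comp (measurable_powR p)).
exact: measurableT_comp mw.
Qed.

(** On a finite measure [|w|^p <= 1 + w^2] is integrable. The objective reads an infinite power
    integral as zero, so this is needed to compare its values with Fatou's bound. *)
Lemma powR_norm_lty (w : T -> R) (p : R) : 0 < p -> p < 1 -> w \in Lfun mu 2%:E ->
  (\int[mu]_x (`|w x| `^ p)%:E < +oo)%E.
Proof.
move=> p0 p1 /Lfun2P[mw wL].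
apply: (@le_lt_trans _ _ (\int[mu]_x (1 + w x ^+ 2)%:E)%E).
  apply: ge0_le_int.
  - move=> x; rewrite powR_ge0/= -[w x ^+ 2](real_normK (num_real (w x))).
    exact: powR_le_sqr.
  - exact: measurable_powR_norm.
  - by apply: measurable_funD => //; exact: measurable_funX.
rewrite (@ge0_intD _ _ _ mu (fun=> 1)) //; last 2 first.
- by move=> x; exact: sqr_ge0.
- exact: measurable_funX.
rewrite lte_add_pinfty// integral_cst// mul1e; exact: mu_fin.
Qed.

End limits.

(** [f] has no sign: its lower bound costs [a / 4 * n], which is itself at most [M - m0]. *)
Lemma energy_bounds (R : realType) (f n q P a b g m0 M : R) :
  0 < a -> 0 < b -> 0 < g -> 0 <= n -> 0 <= q -> 0 <= P ->
  m0 + a / 4 * n <= f + a / 2 * n -> f + a / 2 * n + b / 2 * q + g * P <= M ->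
  [/\ n <= (M - m0) * (4 / a), q <= (M - m0) * (2 / b), P <= (M - m0) / g &
    `|f| <= `|M| + `|m0| + (M - m0)].
Proof.
move=> a0 b0 g0 n0 q0 P0 h1 h2.
have an0 : 0 <= a / 4 * n by rewrite mulr_ge0// divr_ge0// ltW.
have bq0 : 0 <= b / 2 * q by rewrite mulr_ge0// divr_ge0// ltW.
have gP0 : 0 <= g * P by rewrite mulr_ge0// ltW.
have M1 := ler_norm M; have m1 := ler_norm (- m0); rewrite normrN in m1.
have an2 : a / 2 * n = 2 * (a / 4 * n) by field.
split.
- have : a / 4 * n <= M - m0 by lra.
  by move=> h; rewrite -(invf_div a 4) ler_pdivlMr ?divr_gt0// mulrC.
- have : b / 2 * q <= M - m0 by lra.
  by move=> h; rewrite -(invf_div b 2) ler_pdivlMr ?divr_gt0// mulrC.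
- by rewrite ler_pdivlMr// mulrC; lra.
rewrite ler_norml; apply/andP; split; last by move: (normr_ge0 m0); lra.
by move: (normr_ge0 M); lra.
Qed.

Theorem theorem3p2 (R : realType) (d : nat) (d_gt0 : (0 < d)%N)
  (Omega : lipschitz_domain R d) (T : R) (T_gt0 : 0 < T)
  (s : R) (s_gt0 : 0 < s) (s_lt1 : s < 1) (W : frac_space Omega)
  (f : U Omega T -> R) (f_ae : ae_invariant f)
  (f_wlsc : weakly_lsc (@U_norm R d Omega T) f)
  (f_min : affinely_minorized (@U_norm R d Omega T) f)
  (f_C1 : frechet_C1 (@U_norm R d Omega T) f)
  (alpha beta gamma : R) (alpha_gt0 : 0 < alpha) (beta_gt0 : 0 < beta)
  (gamma_gt0 : 0 < gamma) (p : R) (p_gt0 : 0 < p) (p_lt1 : p < 1) :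
  exists2 uw, admissible W s uw &
    forall uw', admissible W s uw' ->
      objective W s f alpha beta gamma p uw <=
      objective W s f alpha beta gamma p uw'.
Proof.
pose cyl := cyl_vol Omega T.
have [L [K LK] [c Lf]] := f_min.
pose n2 (u : U Omega T) := ip cyl u u.
have n20 u : 0 <= n2 u by exact: ip_ge0.
have nE u : U_norm u = Num.sqrt (n2 u) by exact: Lfun2_norm.
pose q w := frac_ip W s w w.
pose P (w : 'rV[R]_d -> R) : R := \int[vol Omega]_x (`|w x| `^ p).
have P0 w : 0 <= P w by apply: Rintegral_ge0 => x _; exact: powR_ge0.
have PE w : frac_set W s w -> (\int[vol Omega]_x (`|w x| `^ p)%:E = (P w)%:E)%E.
  move=> /frac_L2 wL; rewrite /P /Rintegral fineK// ge0_fin_numE.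
    by apply: (powR_norm_lty (vol_lty Omega) p_gt0 p_lt1); exact: wL.
  by apply: integral_ge0 => x _; rewrite lee_fin powR_ge0.
pose J := objective W s f alpha beta gamma p.
have JE u w : frac_set W s w ->
    J (u, w) = f u + alpha / 2 * n2 u + beta / 2 * q w + gamma * P w.
  move=> wW; rewrite /J /objective /= nE sqr_sqrtr// /frac_norm sqr_sqrtr//.
  exact: frac_ip_ge0.
(* Half of the quadratic term absorbs the linear minorant of [f] at this cost; the other half bounds
   [u]. *)
pose m0 := c - K ^+ 2 / alpha.
have low u : m0 + alpha / 4 * n2 u <= f u + alpha / 2 * n2 u.
  by apply: (coercive_bound alpha_gt0 (n20 u) (Lf u)); rewrite -nE; exact: LK.
have J0 uw : admissible W s uw -> m0 <= J uw.
  case: uw => u w [/= wW _]; rewrite (JE u w wW).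
  have h1 : 0 <= alpha / 4 * n2 u by rewrite mulr_ge0// divr_ge0// ltW.
  have h2 : 0 <= beta / 2 * q w.
    by apply: mulr_ge0; [rewrite divr_ge0// ltW|exact: frac_ip_ge0].
  have h3 : 0 <= gamma * P w by rewrite mulr_ge0// ltW.
  by have := low u; lra.
have adm0 : (admissible W s : set (U Omega T * ('rV[R]_d -> R))) !=set0.
  exists (0 : U Omega T, fun=> 0 : R); split; first exact: frac_set0.
  by apply: aeW => z /=; change (`|0 : R| <= 0); rewrite normr0.
have [m [mJ [v vP]]] := minimizing_sequence adm0 J0.
(* A common bound for the energies, since [1 / (k + 1) <= 1]. *)
pose M := m + 1.
pose u k := (v k).1; pose w k := (v k).2.
have wW k : frac_set W s (w k) by have [[]] := vP k.
have vJ k : J (v k) = f (u k) + alpha / 2 * n2 (u k) + beta / 2 * q (w k) + gamma * P (w k).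
  by rewrite -(JE _ _ (wW k)) -surjective_pairing.
have bounds k : [/\ n2 (u k) <= (M - m0) * (4 / alpha),
    q (w k) <= (M - m0) * (2 / beta), P (w k) <= (M - m0) / gamma &
    `|f (u k)| <= `|M| + `|m0| + (M - m0)].
  apply: (energy_bounds alpha_gt0 beta_gt0 gamma_gt0 (n20 (u k))
    (frac_ip_ge0 s_gt0 s_lt1 (wW k)) (P0 (w k)) (low (u k))).
  apply: le_trans (_ : J (v k) <= M); first by rewrite vJ.
  by apply: le_trans (vP k).2 _; rewrite lerD2l invf_le1// ler1n.
have wC k : q (w k) <= (M - m0) * (2 / beta) by have [] := bounds k.
have [phi1 i1 [g1 mg1 wg1]] := frac_compact d_gt0 s_gt0 s_lt1 wW wC.
(* All four parts of the objective are made convergent at once; later indices give the zero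
   sequence. *)
pose a j k := nth 0 [:: f (u k); n2 (u k); q (w k); P (w k)] j.
pose B j := nth 0 [:: `|M| + `|m0| + (M - m0); (M - m0) * (4 / alpha);
  (M - m0) * (2 / beta); (M - m0) / gamma] j.
have aB j k : `|a j (phi1 k)| <= B j.
  have [h1 h2 h3 h4] := bounds (phi1 k).
  case: j => [|[|[|[|j]]]]; rewrite /a /B //=.
  - by rewrite ger0_norm.
  - by rewrite ger0_norm//; exact: frac_ip_ge0.
  - by rewrite ger0_norm.
  - by rewrite nth_nil normr0.
have [phi2 i2 aphi] := bounded_subseq aB.
have [phi3 i3 [l [ul [z [zu zl]]]]] := L2_weak_subseq (mu := cyl) (cyl_lty Omega T_gt0)
  (u := fun k => u (phi1 (phi2 k))) (fun k => let: And4 h _ _ _ := bounds (phi1 (phi2 k)) in h).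
pose psi := phi1 \o (phi2 \o phi3).
have ipsi : incr psi by apply: incr_comp => //; exact: incr_comp.
have apsi j : exists A : R, a j (psi k) @[k --> \oo] --> A.
  by have [A hA] := aphi j; exists A; exact: (incr_cvg i3 hA).
have [Af hf] := apsi 0%N; have [Au hu] := apsi 1%N.
have [Aq hq] := apsi 2%N; have [AP hP] := apsi 3%N.
rewrite /a /= in hf hu hq hP.
(* The limit is determined on the domain only; cutting it off outside serves the tilde space. *)
pose g x := g1 x * \1_(Omega : set 'rV[R]_d) x.
have mg : measurable_fun setT g.
  by apply: measurable_funM => //; apply: measurable_indic; exact: measurable_domain.
have g0 x : ~ (Omega : set _) x -> g x = 0.
  by move=> Ox; rewrite /g indicE memNset// mulr0.
have wg : {ae vol Omega, forall x, w (psi k) x @[k --> \oo] --> (g x : R)}.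
  apply: filterS2 wg1 (ae_domain Omega) => x h Ox.
  rewrite /g indicE mem_set// mulr1.
  exact: (incr_cvg (incr_comp i2 i3) h).
have fl : f l <= Af.
  by rewrite -lee_fin -(limn_einf_EFin hf); exact: f_wlsc ul.
have nl : n2 l <= Au by exact: (weak_ip_le ul hu).
have eventually (b : nat -> R) (A : R) : b k @[k --> \oo] --> A -> forall e, 0 < e ->
    exists N, forall k, b (k + N)%N <= A + e.
  move=> /cvgn_epsP h e /h[N hN]; exists N => k.
  by have := hN (k + N)%N (leq_addl _ _); rewrite ler_norml => /andP[_ ?]; lra.
have shift N : {ae vol Omega, forall x, w (psi (k + N)%N) x @[k --> \oo] --> (g x : R)}.
  by apply: filterS wg => x h; rewrite (cvg_shiftn N (fun k => w (psi k) x)).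
(* Late terms lie in the ball of squared radius [Aq + e], which is closed; letting [e] tend to zero
   gives lower semicontinuity of the norm. *)
have qg e : 0 < e -> frac_set W s g /\ q g <= Aq + e.
  move=> e0; have [N hN] := eventually _ _ hq e e0.
  exact: (frac_closed d_gt0 s_gt0 s_lt1 (fun k => wW (psi (k + N)%N)) hN mg g0 (shift N)).
have gW : frac_set W s g by have [] := qg 1 ltr01.
have qgA : q g <= Aq by apply/ler_addgt0Pr => e /qg[].
have PgA : P g <= AP.
  apply/ler_addgt0Pr => e e0; have [N hN] := eventually _ _ hP e e0.
  rewrite -lee_fin -(PE g gW).
  have mw k : measurable_fun setT (w (psi (k + N)%N)).
    exact: Lfun2_measurable (frac_L2 s_gt0 s_lt1 (wW _)).
  apply: (@fatou_le _ _ _ (vol Omega) (fun k x => `|w (psi (k + N)%N) x| `^ p)).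
  - by move=> k; exact: measurable_powR_norm.
  - by move=> k x; exact: powR_ge0.
  - exact: measurable_powR_norm.
  - by move=> x; exact: powR_ge0.
  - by apply: filterS (shift N) => x; exact: powR_norm_cvg.
  - by move=> k; rewrite (PE _ (wW _)) lee_fin.
(* The four limits add up to the limit of the energies, which is at most the infimum. *)
have Am : Af + alpha / 2 * Au + beta / 2 * Aq + gamma * AP <= m.
  have h : J (v (psi k)) @[k --> \oo] --> Af + alpha / 2 * Au + beta / 2 * Aq + gamma * AP.
    rewrite (_ : (fun k => J _) = (fun k => f (u (psi k)) + alpha / 2 * n2 (u (psi k)) +
      beta / 2 * q (w (psi k)) + gamma * P (w (psi k)))); last first.
      by apply/funext => k; exact: vJ.
    have cM (b : nat -> R) (A r : R) : b k @[k --> \oo] --> A -> r * b k @[k --> \oo] --> r * A.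
      by move=> hb; apply: cvgM; [exact: cvg_cst|exact: hb].
    by apply: cvgD (cM _ _ _ hP); apply: cvgD (cM _ _ _ hq); apply: cvgD hf (cM _ _ _ hu).
  apply/ler_addgt0Pr => e e0; rewrite -(cvg_lim _ h)//.
  have [N _ hN] := near_infty_natSinv_lt (PosNum e0).
  apply: limr_le; first by apply/cvg_ex; eexists; exact: h.
  exists N => // k Nk; apply: le_trans (vP _).2 _; rewrite lerD2l; apply: ltW.
  apply: le_lt_trans (hN k Nk).
  by rewrite lef_pV2 ?posrE// ler_nat ltnS; exact: incr_ge.
(* Each part of the objective at [(l, g)] is below its limit; the constraint follows from hulls of
   the [u] part against the almost everywhere limit of the [w] part. *)
exists (l, g).
  split; first exact: gW.
  apply: (@limit_dominated _ _ _ cyl (cyl_lty Omega T_gt0) (fun k => u (psi k)) z l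
    (fun k x => w (psi k) x.2) (fun x => g x.2)) => //.
    apply: (ae_foralln (P := fun k (x : measurableTypeR R * 'rV[R]_d) =>
      `|u (psi k) x| <= w (psi k) x.2)) => k.
    by have [[]] := vP (psi k).
  exact: (ae_cyl T_gt0 wg).
move=> uw' /mJ; apply: le_trans; apply: le_trans Am; rewrite -/J (JE l g gW).
by apply: lerD; [apply: lerD; [apply: lerD => //|]|]; rewrite ler_pM2l// divr_gt0.
Qed.
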